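(* Let $0<p\le\infty$ and $0<\lambda\le 1$, and let $\mu$ be a finite positive Borel measure on $[0,1)$. Let $X$ be a Banach space of analytic functions on $\mathbb{D}$, continuously embedded in $H(\mathbb{D})$, with $L^{2,\lambda}\subseteq X\subseteq \mathcal{B}^{\frac{3-\lambda}{2}}$. Then $\mathcal{C}_\mu(H^p)\subseteq X$ if and only if $\mu$ is a $\left(\frac{1+\lambda}{2}+\frac1p\right)$-Carleson measure (with the convention $\frac1p=0$ when $p=\infty$).
   Context: $\mathbb{D}$ is the open unit disc and $H(\mathbb{D})$ the space of analytic functions on $\mathbb{D}$. For a finite positive Borel measure $\mu$ on $[0,1)$, let $\mu_n=\int_{[0,1)}t^n\,d\mu(t)$; the Cesàro-like operator is $\mathcal{C}_\mu(f)(z)=\sum_{n\ge0}\big(\mu_n\sum_{k=0}^n a_k\big)z^n=\int_{[0,1)}\frac{f(tz)}{1-tz}\,d\mu(t)$ for $f(z)=\sum_{n\ge 0} a_nz^n\in H(\mathbb{D})$. For $s>0$, $\mu$ is an $s$-Carleson measure if there is $C>0$ with $\mu([t,1))\le C(1-t)^s$ for all $t\in[0,1)$. For $\alpha>0$, the Bloch-type space $\mathcal{B}^\alpha$ consists of $f\in H(\mathbb{D})$ with $\|f\|_{\mathcal{B}^\alpha}=|f(0)|+\sup_{z\in\mathbb{D}}(1-|z|^2)^\alpha|f'(z)|<\infty$. $H^p$ ($0<p\le\infty$) is the Hardy space. For $0<\lambda\le1$, the Morrey space $L^{2,\lambda}$ is the set of $f\in H^2$ with $\|f\|_{L^{2,\lambda}}=|f(0)|+\sup_{I\subset\partial\mathbb{D}}\big(|I|^{-\lambda}\int_I|f(e^{i\theta})-f_I|^2d\theta\big)^{1/2}<\infty$,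 where $I$ ranges over arcs, $|I|$ is arc length and $f_I$ is the mean of the boundary function $f$ over $I$ ($L^{2,1}=BMOA$). *)

(* Defs.v *)
From HB Require Import structures.
From mathcomp Require Import all_boot all_order all_algebra.
From mathcomp Require Import all_classical all_reals all_analysis.
From mathcomp.real_closed Require Import complex.
Import Order.TTheory GRing.Theory Num.Theory numFieldNormedType.Exports.

Set Implicit Arguments.
Unset Strict Implicit.
Unset Printing Implicit Defensive.

Local Open Scope ring_scope.
Local Open Scope classical_set_scope.

(* R[i] as a normed module over itself (complex differentiability). *)
Section ComplexNormed.
Variable R : rcfType.
HB.instance Definition _ := GRing.ComAlgebra.copy R[i] (R[i])^o.
HB.instance Definition _ := Vector.copy R[i] (R[i])^o.
HB.instance Definition _ := NormedModule.copy R[i] (R[i])^o.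
End ComplexNormed.

Section Defs.
Variable R : realType.
Local Notation C := R[i].
Local Notation normc := (@ComplexField.Normc.normc R).

Definition RtoC (x : R) : C := Complex x 0.

Definition cis (t : R) : C := Complex (cos t) (sin t).

Definition pitv (a l : R) : set R := `[a, a + l].

Definition analytic_on_disc (f : C -> C) : Prop :=
  forall z : C, normc z < 1 -> derivable f z 1.

Definition bloch_type (alpha : R) (f : C -> C) : Prop :=
  analytic_on_disc f /\
  exists M : R, forall z : C, normc z < 1 ->
    (1 - normc z ^+ 2) `^ alpha * normc (f^`() z) <= M.

(* Hardy space H^p, 0 < p <= oo (p = -oo or p <= 0 never used) *)
Definition hardy (p : \bar R) (f : C -> C) : Prop :=
  match p with
  | EFin q => analytic_on_disc f /\
      exists M : R, forall r : R, 0 <= r < 1 ->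
        (\int[lebesgue_measure]_(t in pitv 0 (2 * pi))
            ((normc (f (RtoC r * cis t))) `^ q)%:E <= M%:E)%E
  | +oo%E => analytic_on_disc f /\
      exists M : R, forall z : C, normc z < 1 -> normc (f z) <= M
  | -oo%E => False
  end.

Definition cmean (g : R -> C) (a l : R) : C :=
  Complex (l^-1 * Rintegral lebesgue_measure (pitv a l) (fun t => complex.Re (g t)))
          (l^-1 * Rintegral lebesgue_measure (pitv a l) (fun t => complex.Im (g t))).

(* Morrey space L^{2,lambda}: f in H^2 whose boundary function g
   (a.e. radial limit, g(t) = f(e^{it})) satisfies
   sup_I |I|^{-lambda} int_I |g - g_I|^2 < oo; the arc
   I = {e^{it} : a <= t <= a + l}, 0 < l <= 2 pi, has length l. *)
Definition morrey (lam : R) (f : C -> C) : Prop :=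
  hardy 2%:E f /\
  exists g : R -> C,
    measurable_fun setT (fun t => complex.Re (g t)) /\
    measurable_fun setT (fun t => complex.Im (g t)) /\
    {ae lebesgue_measure, forall t : R,
        (fun r : R => f (RtoC r * cis t)) @ at_left (1 : R) --> g t} /\
    exists M : R, forall a l : R, 0 < l <= 2 * pi ->
      ((l `^ (- lam))%:E *
       \int[lebesgue_measure]_(t in pitv a l)
           ((normc (g t - cmean g a l)) ^+ 2)%:E <= M%:E)%E.

Definition cesaro_like (mu : {measure set R -> \bar R}) (f : C -> C) : C -> C :=
  fun z => Complex
    (Rintegral mu `[0, 1[ (fun t => complex.Re (f (RtoC t * z) / (1 - RtoC t * z))))
    (Rintegral mu `[0, 1[ (fun t => complex.Im (f (RtoC t * z) / (1 - RtoC t * z)))).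

Definition carleson (s : R) (mu : {measure set R -> \bar R}) : Prop :=
  exists c : R, 0 < c /\
    forall t : R, 0 <= t < 1 -> (mu `[t, 1%R[ <= (c * (1 - t) `^ s)%:E)%E.

Definition invp (p : \bar R) : R :=
  match p with EFin q => q^-1 | _ => 0 end.

(* (X, nX) is a Banach space of analytic functions on D, continuously
   embedded in H(D).  Elements of H(D) are represented by functions C -> C;
   only their values on D matter, so X and nX are required to be invariant
   under changing values off D. *)
Definition banach_space_in_HD (X : set (C -> C)) (nX : (C -> C) -> R) : Prop :=
  (forall f, X f -> analytic_on_disc f) /\
  (forall f g, X f -> (forall z, normc z < 1 -> f z = g z) ->
     X g /\ nX g = nX f) /\
  X (fun _ => 0) /\
  (forall f g, X f -> X g -> X (f \+ g)) /\
  (forall (c : C) f, X f -> X (fun z => c * f z)) /\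
  (forall f, X f -> 0 <= nX f) /\
  (forall f, X f -> nX f = 0 -> forall z, normc z < 1 -> f z = 0) /\
  (forall f g, X f -> X g -> nX (f \+ g) <= nX f + nX g) /\
  (forall (c : C) f, X f -> nX (fun z => c * f z) = normc c * nX f) /\
  (forall u : nat -> C -> C, (forall n, X (u n)) ->
     (forall e : R, 0 < e -> exists N : nat, forall m n : nat,
        (N <= m)%N -> (N <= n)%N -> nX (u m \- u n) < e) ->
     exists g, X g /\ (fun n => nX (u n \- g)) @ \oo --> (0 : R)) /\
  (* continuous embedding into H(D): uniform bounds on compact subsets *)
  (forall r : R, 0 <= r < 1 -> exists K : R, forall f, X f ->
     forall z : C, normc z <= r -> normc (f z) <= K * nX f).

End Defs.

(* Main.v *)
(** Let k(t,z) = f(tz)/(1-tz), so that C_mu f(z) is the integral of k(t,z) dmu(t), and let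
s = (1+lam)/2 + 1/p.

Sufficiency. Cauchy's formula gives |f(z)| <= K (1-|z|)^(-1/p) for f in H^p. Split the integral at
1-t = u. Put b = 1/2 - lam/4. Since |1-tz| >= 1-t and |1-tz| >= |1-z|/2, summing the s-Carleson
condition over dyadic layers shows that the part 1-t <= u is O(|1-z|^(-b) u^(lam/4)), while the part
1-t > u is Lipschitz in z with constant O(u^((lam-3)/2)). With u = 1 this bounds C_mu f by
|1-z|^(-b), which is square integrable on the circle; with u = |I| it bounds the mean oscillation on
an arc I, because the integral of |1-z|^(-2b) over I is O(|I|^(1-2b)).

Necessity. If f is nonnegative and nondecreasing on [0,1), then the derivative of C_mu f at a >= 1/2
is at least f(a^2) mu([a,1)) / (8 (1-a)^2), so the Bloch condition forces
f(a^2) mu([a,1)) <= M (1-a)^((1+lam)/2). For p = oo take f = 1. For p < oo, if mu were not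
s-Carleson there would be points a_n with mu([a_n,1)) > 16^n (1-a_n)^s, and the function
f(z) = sum_n 4^-n (1-a_n)^(k-1/p) / (1-a_n z)^k of H^p, with k > 1/p, violates that bound. *)
Require Import Defs.
From HB Require Import structures.
From mathcomp Require Import all_boot all_order all_algebra.
From mathcomp Require Import all_classical all_reals all_analysis.
From mathcomp.real_closed Require Import complex.
From mathcomp Require Import measurable_realfun ring lra.
Import Order.TTheory GRing.Theory Num.Theory numFieldNormedType.Exports.
Import ComplexField.Normc.

Set Implicit Arguments.
Unset Strict Implicit.
Unset Printing Implicit Defensive.

Local Open Scope ring_scope.
Local Open Scope classical_set_scope.

(** * Moduli and complex differentiability in epsilon-delta form *)

Section ComplexEps.
Variable R : realType.
Local Notation C := R[i].
Implicit Types (f g : C -> C) (z w A B h : C).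

(** The exponents fit together as follows, with g = 1/p. After |1-tz|^(-b) has been taken out, the
    near part leaves (1-t)^-(g+1-b), and g+1-b < s makes it summable near t = 1. The far part has
    (1-t)^-(g+2), and g+2 > s makes its layers summable away from t = 1. At u = |I| both parts
    contribute |I|^lam to the squared oscillation: the near one |I|^(lam/2) times |I|^(1-2b), the
    far one the square of |I| times |I|^((lam-3)/2), times |I|. The only boundary point where the
    bounds blow up is 1, so everything on the circle is measured by |1 - e^(it)|. In the necessity
    part the Bloch constant M depends on f, so testing one point at a time with different functions
    gives nothing uniform. All bad points have to be served by a single f; its weights 4^-n leave
    the unbounded factor 4^n against 16^n. The holomorphic tools rest on Goursat's theorem in the
    coordinates s + i t of exp, where circles about 0 are segments and every integral is over a real
    interval. *)

Lemma normc_ge0 z : 0 <= normc z.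
Proof. by case: z => a b; rewrite /normc sqrtr_ge0. Qed.

Lemma normc_RtoC (x : R) : normc (RtoC x) = `|x|.
Proof. by rewrite /normc /= expr0n addr0 sqrtr_sqr. Qed.

Lemma normcB z w : normc (z - w) = normc (w - z).
Proof. by rewrite -normcN opprB. Qed.

Lemma normc_eq0 z : (normc z == 0) = (z == 0).
Proof.
apply/eqP/eqP => [/eq0_normc//|->]; exact: normc0.
Qed.

Lemma normc_gt0 z : (0 < normc z) = (z != 0).
Proof. by rewrite lt_def normc_ge0 andbT normc_eq0. Qed.

Lemma normcX z n : normc (z ^+ n) = normc z ^+ n.
Proof.
elim: n => [|n ih]; first by rewrite !expr0 normc1.
by rewrite !exprS normcM ih.
Qed.

Lemma ler_normcB z w : normc (z - w) <= normc z + normc w.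
Proof. by rewrite -(normcN w); exact: le_normcD. Qed.

Lemma lerB_normc z w : normc z - normc w <= normc (z - w).
Proof. by rewrite lerBlDr; rewrite -{1}(subrK w z); exact: le_normcD. Qed.

Lemma normc_triangle w z z' : normc (z - z') <= normc (z - w) + normc (w - z').
Proof. by rewrite -{1}(subrK w z) -addrA; exact: le_normcD. Qed.

Lemma Re_le_normc z : `|complex.Re z| <= normc z.
Proof.
case: z => a b; rewrite /normc /= -sqrtr_sqr.
by rewrite ler_sqrt ?addr_ge0 ?sqr_ge0// lerDl sqr_ge0.
Qed.

Lemma Im_le_normc z : `|complex.Im z| <= normc z.
Proof.
case: z => a b; rewrite /normc /= -sqrtr_sqr.
by rewrite ler_sqrt ?addr_ge0 ?sqr_ge0// lerDr sqr_ge0.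
Qed.

Lemma normc_sqr z : normc z ^+ 2 = complex.Re z ^+ 2 + complex.Im z ^+ 2.
Proof. by case: z => a b; rewrite /normc /= sqr_sqrtr// addr_ge0 ?sqr_ge0. Qed.

Lemma normc_le_ReIm z : normc z <= `|complex.Re z| + `|complex.Im z|.
Proof.
rewrite -(@ler_pXn2r _ 2)// ?nnegrE ?addr_ge0 ?normc_ge0//.
rewrite normc_sqr sqrrD !real_normK ?num_real// addrAC lerDl.
by rewrite mulrn_wge0// mulr_ge0.
Qed.

Lemma normc_cis (t : R) : normc (cis t) = 1.
Proof. by rewrite /cis /normc cos2Dsin2 sqrtr1. Qed.

Lemma normc_circle (r t : R) : 0 <= r -> normc (RtoC r * cis t) = r.
Proof. by move=> r0; rewrite normcM normc_cis mulr1 normc_RtoC ger0_norm. Qed.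

Lemma Re_add z w : complex.Re (z + w) = complex.Re z + complex.Re w.
Proof. by case: z; case: w. Qed.
Lemma Im_add z w : complex.Im (z + w) = complex.Im z + complex.Im w.
Proof. by case: z; case: w. Qed.
Lemma Re_sub z w : complex.Re (z - w) = complex.Re z - complex.Re w.
Proof. by case: z; case: w. Qed.
Lemma Im_sub z w : complex.Im (z - w) = complex.Im z - complex.Im w.
Proof. by case: z; case: w. Qed.
Lemma Re_mul z w : complex.Re (z * w) =
  complex.Re z * complex.Re w - complex.Im z * complex.Im w.
Proof. by case: z; case: w. Qed.
Lemma Im_mul z w : complex.Im (z * w) =
  complex.Re z * complex.Im w + complex.Im z * complex.Re w.
Proof. by case: z => a b; case: w => c d /=. Qed.
Lemma complex_ReIm_eq z w : complex.Re z = complex.Re w -> complex.Im z = complex.Im w -> z = w.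
Proof. by case: z => a b; case: w => c d /= -> ->. Qed.

Lemma RtoCD (x y : R) : RtoC (x + y) = RtoC x + RtoC y.
Proof. by rewrite /RtoC; apply: complex_ReIm_eq; rewrite /= ?addr0. Qed.
Lemma RtoCN (x : R) : RtoC (- x) = - RtoC x.
Proof. by rewrite /RtoC; apply: complex_ReIm_eq; rewrite /= ?oppr0. Qed.
Lemma RtoCB (x y : R) : RtoC (x - y) = RtoC x - RtoC y.
Proof. by rewrite RtoCD RtoCN. Qed.
Lemma RtoCM (x y : R) : RtoC (x * y) = RtoC x * RtoC y.
Proof. by rewrite /RtoC; apply: complex_ReIm_eq; rewrite Re_mul /= || rewrite Im_mul /=; ring. Qed.
Lemma RtoC1 : RtoC 1 = 1 :> C.
Proof. by []. Qed.
Lemma RtoCV (x : R) : RtoC x^-1 = (RtoC x)^-1.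
Proof.
have [->|x0] := eqVneq x 0; first by rewrite invr0 (_ : RtoC 0 = 0)// invr0.
have X0 : RtoC x != 0 by rewrite -normc_eq0 normc_RtoC normr_eq0.
by apply: (mulfI X0); rewrite -RtoCM !divff// RtoC1.
Qed.
Lemma RtoCX (x : R) n : RtoC (x ^+ n) = RtoC x ^+ n.
Proof. by elim: n => [//|n ih]; rewrite !exprS RtoCM ih. Qed.

Lemma eps_normc_eq0 z : (forall e : R, 0 < e -> normc z <= e) -> z = 0.
Proof.
move=> H; apply/eqP; rewrite -normc_eq0; apply/eqP/le_anti; rewrite normc_ge0 andbT.
by apply/ler_addgt0Pl => e e0; rewrite addr0; exact: H.
Qed.

(** The remainder form has no quotient, so [h = 0] needs no exception and every estimate lives in
    the real field. *)
Definition cdiff f z A : Prop :=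
  forall e : R, 0 < e -> exists2 d : R, 0 < d & forall h, normc h < d ->
    normc (f (z + h) - f z - A * h) <= e * normc h.

Definition ccont f z : Prop :=
  forall e : R, 0 < e -> exists2 d : R, 0 < d & forall w, normc (w - z) < d ->
    normc (f w - f z) <= e.

Lemma posC_RtoC (e : C) : 0 < e -> e = RtoC (complex.Re e) /\ 0 < complex.Re e.
Proof. by case: e => a b; rewrite ltcE /= => /andP[/eqP -> ->]. Qed.

(** Radii of balls in [C] are themselves elements of [C]; a positive one is real by [posC_RtoC],
    which allows real radii throughout. *)
Lemma dnbhs0C_P (P : C -> Prop) :
  (\forall h \near (0 : C)^', P h) <->
  (exists2 d : R, 0 < d & forall h : C, h != 0 -> normc h < d -> P h).
Proof.
split.
- rewrite near_withinE => /nbhs_ballP[e /= e0 H].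
  have [eE e0'] := posC_RtoC e0.
  exists (complex.Re e) => // h h0 hd; apply: H => //.
  rewrite -ball_normE /ball_ /= sub0r normrN.
  rewrite eE. by rewrite ltcR.
- move=> [d d0 H]; rewrite near_withinE; apply/nbhs_ballP; exists (RtoC d) => /=.
    by rewrite ltcR.
  move=> h; rewrite -ball_normE /ball_ /= sub0r normrN => hd h0; apply: H => //.
  by move: hd; rewrite ltcR.
Qed.

Lemma cdiff_quotP f z A : cdiff f z A <->
  (forall e : R, 0 < e -> exists2 d : R, 0 < d & forall h, h != 0 -> normc h < d ->
     normc (A - h^-1 * (f (h + z) - f z)) <= e).
Proof.
split=> H e e0; have [d d0 Hd] := H e e0; exists d => // h.
- move=> h0 hd; have hp : 0 < normc h by rewrite normc_gt0.
  rewrite -(ler_pM2r hp) -normcM.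
  have := Hd h hd; rewrite -normcN; congr (normc _ <= _).
  by rewrite (addrC z); field.
- move=> hd; have [->|h0] := eqVneq h 0.
    by rewrite addr0 subrr mulr0 subrr normc0 mulr0.
  have hp : 0 < normc h by rewrite normc_gt0.
  have := Hd h h0 hd; rewrite -(ler_pM2r hp) -normcM.
  rewrite -normcN; congr (normc _ <= _).
  by rewrite (addrC z); field.
Qed.

Lemma derivable_cdiff f z : derivable f z 1 -> cdiff f z (f^`() z).
Proof.
move=> H; apply/cdiff_quotP => e e0.
have e0C : 0 < RtoC e :> C by rewrite ltcR.
move: H; rewrite /derivable => /cvgrPdist_le/(_ _ e0C)/dnbhs0C_P[d d0 Hd].
exists d => // h h0 hd; rewrite derive1E.
have := Hd h h0 hd; rewrite lecR.
congr (normc (_ - _) <= _).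
by rewrite /= /GRing.scale/= /shift/= mulr1.
Qed.

Lemma cdiff_cvg f z A : cdiff f z A ->
  h^-1 *: (f (h + z) - f z) @[h --> (0 : C)^'] --> A.
Proof.
move=> /cdiff_quotP H; apply/cvgrPdist_le => e e0.
have [eE e0'] := posC_RtoC e0.
have [d d0 Hd] := H _ e0'; apply/dnbhs0C_P; exists d => // h h0 hd.
by rewrite eE lecR; exact: Hd.
Qed.

Lemma cdiff_derivable f z A : cdiff f z A -> derivable f z 1.
Proof.
move=> /cdiff_cvg H; apply/cvg_ex; exists A.
rewrite (_ : (fun _ => _) = (fun h : C => h^-1 *: (f (h + z) - f z)))//.
by apply/funext => h; rewrite /= /GRing.scale/= /shift/= mulr1.
Qed.

Lemma cdiff_uniq f z A B : cdiff f z A -> cdiff f z B -> A = B.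
Proof.
move=> HA HB; apply/eqP; rewrite -subr_eq0; apply/eqP; apply: eps_normc_eq0 => e e0.
have e20 : 0 < e / 2 by lra.
have [d d0 Hd] := HA _ e20; have [d' d'0 Hd'] := HB _ e20.
set m := Num.min d d'; have m0 : 0 < m by rewrite lt_min d0.
pose h : C := RtoC (m / 2); have hn : normc h = m / 2.
  by rewrite normc_RtoC ger0_norm; lra.
have md : m <= d by rewrite /m ge_min lexx.
have md' : m <= d' by rewrite /m ge_min lexx orbT.
have /Hd h1 : normc h < d by rewrite hn; lra.
have /Hd' h2 : normc h < d' by rewrite hn; lra.
have : normc ((A - B) * h) <= e * normc h.
  rewrite (_ : (A - B) * h = (f (z + h) - f z - B * h) - (f (z + h) - f z - A * h)); last by ring.
  by apply: le_trans (ler_normcB _ _) _; lra.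
by rewrite normcM ler_pM2r// hn; lra.
Qed.

Lemma cdiff_derive1 f z A : cdiff f z A -> f^`() z = A.
Proof. by move=> H; apply: (cdiff_uniq (derivable_cdiff (cdiff_derivable H)) H). Qed.

Lemma cdiff_cont f z A : cdiff f z A -> ccont f z.
Proof.
move=> H e e0; have [d d0 Hd] := H 1 ltr01.
have nA := normc_ge0 A.
exists (Num.min d (e / (1 + normc A))).
  by rewrite lt_min d0 divr_gt0//; lra.
move=> w; rewrite lt_min => /andP[wd we].
have := Hd _ wd; rewrite [z + _]addrC subrK => wz.
have -> : f w - f z = (f w - f z - A * (w - z)) + A * (w - z) by ring.
apply: le_trans (le_normcD _ _) _; rewrite normcM.
have : normc (w - z) * (1 + normc A) <= e by rewrite -ler_pdivlMr; [exact: ltW|lra].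
nra.
Qed.

Lemma cdiff_id z : cdiff (fun w => w) z 1.
Proof.
move=> e e0; exists 1 => // h _; rewrite mul1r (addrC z) addrK subrr.
by rewrite normc0 mulr_ge0 ?normc_ge0// ltW.
Qed.

Lemma cdiff_cst c z : cdiff (fun=> c) z 0.
Proof.
move=> e e0; exists 1 => // h _; rewrite mul0r !subrr.
by rewrite normc0 mulr_ge0 ?normc_ge0// ltW.
Qed.

Lemma cdiffD f g z A B : cdiff f z A -> cdiff g z B -> cdiff (fun w => f w + g w) z (A + B).
Proof.
move=> HA HB e e0.
have e20 : 0 < e / 2 by lra.
have [d d0 Hd] := HA _ e20; have [d' d'0 Hd'] := HB _ e20.
exists (Num.min d d'); first by rewrite lt_min d0.
move=> h; rewrite lt_min => /andP[/Hd h1 /Hd' h2].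
rewrite (_ : _ - _ = (f (z + h) - f z - A * h) + (g (z + h) - g z - B * h)); last by ring.
by apply: le_trans (le_normcD _ _) _; lra.
Qed.

Lemma cdiffM f g z A B : cdiff f z A -> cdiff g z B ->
  cdiff (fun w => f w * g w) z (A * g z + f z * B).
Proof.
move=> HA HB e e0.
have nA := normc_ge0 A. have nB := normc_ge0 B. have nf := normc_ge0 (f z). have ng := normc_ge0 (g z).
(* [K] adds up the coefficients of [e1 * normc h] in the four pieces of the remainder; the 1 pays
   for the product of two small factors, where [e1 <= 1] is used. *)
pose K := 1 + normc (g z) + normc (f z) + normc A.
have K0 : 0 < K by rewrite /K; lra.
pose e1 := Num.min 1 (e / (2 * K)).
have e10 : 0 < e1 by rewrite lt_min ltr01 divr_gt0//; lra.
have [d d0 Hd] := HA _ e10; have [d' d'0 Hd'] := HB _ e10.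
have [d2 d20 Hd2] := cdiff_cont HB e10.
exists (Num.min d (Num.min d' d2)); first by rewrite !lt_min d0 d'0.
move=> h; rewrite !lt_min => /andP[/Hd h1 /andP[/Hd' h2 hd2]].
have h3 : normc (g (z + h) - g z) <= e1 by apply: Hd2; rewrite (addrC z) addrK.
rewrite (_ : _ - _ = (f (z + h) - f z - A * h) * (g (z + h) - g z) + 
   (f (z + h) - f z - A * h) * g z + A * h * (g (z + h) - g z) + 
   f z * (g (z + h) - g z - B * h)); last by ring.
have nh := normc_ge0 h.
apply: le_trans (le_normcD _ _) _; rewrite -lerBrDr.
apply: le_trans (le_normcD _ _) _; rewrite -lerBrDr.
apply: le_trans (le_normcD _ _) _; rewrite -lerBrDr.
rewrite !normcM.
have e11 : e1 <= 1 by rewrite /e1 ge_min lexx.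
have eK : e1 * K <= e / 2.
  have : e1 <= e / (2 * K) by rewrite /e1 ge_min lexx orbT.
  by rewrite ler_pdivlMr; [lra|lra].
have t1 : normc (f (z + h) - f z - A * h) * normc (g (z + h) - g z) <= e1 * normc h.
  rewrite -[leRHS]mulr1; apply: ler_pM; rewrite ?normc_ge0//; exact: le_trans h3 _.
have t2 : normc (f (z + h) - f z - A * h) * normc (g z) <= e1 * normc h * normc (g z).
  exact: ler_wpM2r.
have t3 : normc A * normc h * normc (g (z + h) - g z) <= normc A * normc h * e1.
  by apply: ler_wpM2l => //; exact: mulr_ge0.
have t4 : normc (f z) * normc (g (z + h) - g z - B * h) <= normc (f z) * (e1 * normc h).
  exact: ler_wpM2l.
have : e1 * K * normc h <= e / 2 * normc h by exact: ler_wpM2r.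
have : 0 <= e * normc h by rewrite mulr_ge0// ltW.
rewrite /K; lra.
Qed.

Lemma cdiffV f z A : f z != 0 -> cdiff f z A -> cdiff (fun w => (f w)^-1) z (- A / (f z) ^+ 2).
Proof.
move=> fz HA e e0.
have n0 : 0 < normc (f z) by rewrite normc_gt0.
set n := normc (f z) in n0.
have nA := normc_ge0 A.
(* [e1] and [e2] make each of the two pieces of the remainder at most [e / 2 * normc h], given that
   [normc (f (z + h))] stays above [n / 2]. *)
pose e1 := e * n ^+ 2 / 4.
have e10 : 0 < e1 by rewrite /e1 !divr_gt0 ?mulr_gt0// exprn_gt0.
have [d d0 Hd] := HA _ e10.
pose e2 := Num.min (n / 2) (e * n ^+ 3 / (4 * (normc A + 1))).
have e20 : 0 < e2.
  rewrite lt_min divr_gt0// divr_gt0 ?mulr_gt0 ?exprn_gt0//; lra.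
have [d2 d20 Hd2] := cdiff_cont HA e20.
exists (Num.min d d2); first by rewrite lt_min d0.
move=> h; rewrite lt_min => /andP[/Hd h1 hd2].
have h3 : normc (f (z + h) - f z) <= e2 by apply: Hd2; rewrite (addrC z) addrK.
have e2n : e2 <= n / 2 by rewrite ge_min lexx.
have nfh : n / 2 <= normc (f (z + h)).
  by have := lerB_normc (f z) (f z - f (z + h)); rewrite subKr (normcB (f z)) -/n; lra.
have fzh : f (z + h) != 0 by rewrite -normc_gt0; lra.
have nh := normc_ge0 h.
have -> : (f (z + h))^-1 - (f z)^-1 - - A / (f z) ^+ 2 * h =
  - (f (z + h) - f z - A * h) / (f z * f (z + h)) + A * h * (f (z + h) - f z) / (f z ^+ 2 * f (z + h)).
  by field; rewrite fz fzh.
apply: le_trans (le_normcD _ _) _.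
rewrite !normcM !normcV !normcM normcN -/n -?expr2.
have nzh : 0 < normc (f (z + h)) by rewrite normc_gt0.
have t1 : normc (f (z + h) - f z - A * h) / (n * normc (f (z + h))) <= e / 2 * normc h.
  rewrite ler_pdivrMr ?mulr_gt0//; apply: le_trans h1 _; rewrite /e1.
  have : n ^+ 2 / 2 <= n * normc (f (z + h)) by rewrite expr2; nra.
  have : 0 <= e * normc h by rewrite mulr_ge0// ltW.
  nra.
have t2 : normc A * normc h * normc (f (z + h) - f z) / (n ^+ 2 * normc (f (z + h))) <= e / 2 * normc h.
  rewrite ler_pdivrMr ?mulr_gt0 ?exprn_gt0//.
  have n3 : n ^+ 3 / 2 <= n ^+ 2 * normc (f (z + h)).
    by rewrite exprSr -mulrA ler_pM2l ?exprn_gt0.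
  have h4 : normc (f (z + h) - f z) * (normc A + 1) <= e * n ^+ 3 / 4.
    apply: (@le_trans _ _ (e2 * (normc A + 1))); first by apply: ler_wpM2r => //; lra.
    have : e2 <= e * n ^+ 3 / (4 * (normc A + 1)) by rewrite ge_min lexx orbT.
    by rewrite ler_pdivlMr; lra.
  have := normc_ge0 (f (z + h) - f z) => q0.
  apply: (@le_trans _ _ (normc h * (e * n ^+ 3 / 4))).
    rewrite mulrAC (mulrC _ (normc h)); apply: ler_wpM2l => //; lra.
  have eh : 0 <= e * normc h by rewrite mulr_ge0// ltW.
  have : e * normc h * (n ^+ 3 / 2) <= e * normc h * (n ^+ 2 * normc (f (z + h))) by exact: ler_wpM2l.
  lra.
lra.
Qed.

Lemma cdiff_affine f z0 (c z : C) A : cdiff f (z0 + c * z) A -> cdiff (fun w => f (z0 + c * w)) z (A * c).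
Proof.
move=> HA e e0; have nc := normc_ge0 c.
have e10 : 0 < e / (1 + normc c) by rewrite divr_gt0//; lra.
have [d d0 Hd] := HA _ e10.
have d1 : 0 < d / (1 + normc c) by rewrite divr_gt0//; lra.
exists (d / (1 + normc c)) => // h hd; have nh := normc_ge0 h.
have hc : normc (c * h) < d.
  move: hd; rewrite normcM ltr_pdivlMr; last lra. nra.
have := Hd _ hc; rewrite mulrDr addrA mulrA => /le_trans; apply.
rewrite normcM mulrA; apply: ler_wpM2r => //.
rewrite -mulrAC ler_pdivrMr; [nra|lra].
Qed.

Lemma cdiff_local f g z A (d : R) : 0 < d -> (forall w, normc (w - z) < d -> f w = g w) ->
  cdiff f z A -> cdiff g z A.
Proof.
move=> d0 fg HA e e0; have [d1 d10 Hd] := HA _ e0.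
exists (Num.min d d1); first by rewrite lt_min d0.
move=> h; rewrite lt_min => /andP[hd /Hd].
by rewrite (fg z) ?subrr ?normc0// (fg (z + h))// addrAC subrr add0r.
Qed.

Lemma cdiffX f z A n : cdiff f z A -> exists B, cdiff (fun w => f w ^+ n) z B.
Proof.
move=> HA; elim: n => [|n [B HB]]; first by exists 0; exact: cdiff_cst.
by eexists; move: (cdiffM HA HB); under eq_fun do rewrite -exprS; exact.
Qed.

Definition cdifferentiable f z := exists A, cdiff f z A.

Lemma analytic_cdiffP f : analytic_on_disc f <->
  (forall z, normc z < 1 -> cdifferentiable f z).
Proof.
split=> H z z1; first by eexists; exact: (derivable_cdiff (H z z1)).
by have [A HA] := H z z1; exact: (cdiff_derivable HA).
Qed.

End ComplexEps.

(** * Integrals of complex-valued functions *)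

Section ComplexIntegral.
Context d (T : measurableType d) (R : realType) (mu : {measure set T -> \bar R}).
Local Notation C := R[i].
Implicit Types (D : set T) (h k : T -> C).

(** The shape is that of [cesaro_like], which is therefore convertible to a [cint] over [0,1). *)
Definition cint D h : C :=
  Complex (Rintegral mu D (fun t => complex.Re (h t)))
          (Rintegral mu D (fun t => complex.Im (h t))).

Definition cintegrable D h : Prop :=
  mu.-integrable D (EFin \o (fun t => complex.Re (h t))) /\
  mu.-integrable D (EFin \o (fun t => complex.Im (h t))).

Lemma eq_cint D h k : (forall t, D t -> h t = k t) -> cint D h = cint D k.
Proof.
by move=> hk; congr Complex; apply: eq_Rintegral => t /[!inE] Dt; rewrite hk.
Qed.

Lemma eq_cintegrable D h k : measurable D -> (forall t, D t -> h t = k t) -> cintegrable D h -> cintegrable D k.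
Proof.
move=> mD hk [h1 h2]; split.
  by move: h1; apply: eq_integrable => // t /[!inE] Dt /=; rewrite hk.
by move: h2; apply: eq_integrable => // t /[!inE] Dt /=; rewrite hk.
Qed.

Lemma cintegrableD D h k : measurable D -> cintegrable D h -> cintegrable D k ->
  cintegrable D (fun t => h t + k t).
Proof.
move=> mD [h1 h2] [k1 k2]; split.
  by move: (integrableD mD h1 k1); apply: eq_integrable => // t _ /=; rewrite Re_add.
by move: (integrableD mD h2 k2); apply: eq_integrable => // t _ /=; rewrite Im_add.
Qed.

Lemma cintegrableZ D h (c : C) : measurable D -> cintegrable D h -> cintegrable D (fun t => c * h t).
Proof.
move=> mD [h1 h2]; split.
  have := integrableB mD (integrableZl mD (complex.Re c) h1) (integrableZl mD (complex.Im c) h2).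
  by apply: eq_integrable => // t _ /=; rewrite Re_mul.
have := integrableD mD (integrableZl mD (complex.Re c) h2) (integrableZl mD (complex.Im c) h1).
by apply: eq_integrable => // t _ /=; rewrite Im_mul.
Qed.

Lemma cintegrableB D h k : measurable D -> cintegrable D h -> cintegrable D k ->
  cintegrable D (fun t => h t - k t).
Proof.
move=> mD hi ki; have := cintegrableD mD hi (cintegrableZ (-1) mD ki).
by apply: eq_cintegrable => // t _; rewrite mulN1r.
Qed.

Lemma cintD D h k : measurable D -> cintegrable D h -> cintegrable D k ->
  cint D (fun t => h t + k t) = cint D h + cint D k.
Proof.
move=> mD [h1 h2] [k1 k2]; apply: complex_ReIm_eq => /=.
  by rewrite -RintegralD//; apply: eq_Rintegral => t _; rewrite Re_add.
by rewrite -RintegralD//; apply: eq_Rintegral => t _; rewrite Im_add.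
Qed.

Lemma cintZ D h (c : C) : measurable D -> cintegrable D h ->
  cint D (fun t => c * h t) = c * cint D h.
Proof.
move=> mD [h1 h2].
have Z (r : R) f : mu.-integrable D (EFin \o f) -> mu.-integrable D (EFin \o (fun t => r * f t)).
  by move=> fi; move: (integrableZl mD r fi); apply: eq_integrable.
apply: complex_ReIm_eq; rewrite ?Re_mul ?Im_mul /= -!RintegralZl//.
  by rewrite -RintegralB//; [|exact: Z..]; apply: eq_Rintegral => t _; rewrite Re_mul.
by rewrite -RintegralD//; [|exact: Z..]; apply: eq_Rintegral => t _; rewrite Im_mul.
Qed.

Lemma cintB D h k : measurable D -> cintegrable D h -> cintegrable D k ->
  cint D (fun t => h t - k t) = cint D h - cint D k.
Proof.
move=> mD hi ki; rewrite -[- cint D k]mulN1r -cintZ// -cintD//; last exact: cintegrableZ.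
by apply: eq_cint => t _; rewrite mulN1r.
Qed.

Lemma cint_cst D (c : C) : measurable D -> cint D (fun=> c) = c * RtoC (fine (mu D)).
Proof.
by move=> mD; apply: complex_ReIm_eq; rewrite ?Re_mul ?Im_mul /= Rintegral_cst//; ring.
Qed.

(* The factor 2 comes from estimating the real and imaginary parts separately. *)
Lemma normc_cint_le D h (B : T -> R) : measurable D -> cintegrable D h ->
  mu.-integrable D (EFin \o B) -> (forall t, D t -> normc (h t) <= B t) ->
  normc (cint D h) <= 2 * Rintegral mu D B.
Proof.
move=> mD [h1 h2] Bi hB.
have N f : mu.-integrable D (EFin \o f) -> (forall t, D t -> `|f t| <= B t) ->
    `|Rintegral mu D f| <= Rintegral mu D B.
  move=> fi fB; apply: le_trans (le_normr_Rintegral mD fi) _.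
  by apply: le_Rintegral => //; exact: (integrable_abse fi).
apply: le_trans (normc_le_ReIm _) _; rewrite mulr_natl mulr2n lerD//=.
  by apply: N => // t Dt; apply: le_trans (Re_le_normc _) (hB t Dt).
by apply: N => // t Dt; apply: le_trans (Im_le_normc _) (hB t Dt).
Qed.

Lemma cintegrableS D E h : measurable D -> measurable E -> E `<=` D -> cintegrable D h -> cintegrable E h.
Proof. by move=> mD mE ED [h1 h2]; split; [exact: integrableS h1|exact: integrableS h2]. Qed.

Lemma cint_setU (A B : set T) h : measurable A -> measurable B -> cintegrable (A `|` B) h ->
  [disjoint A & B] -> cint (A `|` B) h = cint A h + cint B h.
Proof. by move=> mA mB [h1 h2] AB; apply: complex_ReIm_eq => /=; rewrite Rintegral_setU. Qed.

Lemma cintegrable_le D h (B : T -> R) : measurable D ->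
  measurable_fun D (fun t => complex.Re (h t)) -> measurable_fun D (fun t => complex.Im (h t)) ->
  mu.-integrable D (EFin \o B) -> (forall t, D t -> normc (h t) <= B t) -> cintegrable D h.
Proof.
move=> mD m1 m2 Bi hB; split; apply: (le_integrable mD _ _ Bi).
- exact/measurable_EFinP.
- move=> t Dt /=; rewrite lee_fin; apply: le_trans (Re_le_normc _) _.
  by apply: le_trans (hB t Dt) (ler_norm _).
- exact/measurable_EFinP.
- move=> t Dt /=; rewrite lee_fin; apply: le_trans (Im_le_normc _) _.
  by apply: le_trans (hB t Dt) (ler_norm _).
Qed.

End ComplexIntegral.

(** * Continuous complex functions of a real parameter *)

Section Paths.
Variable R : realType.
Local Notation C := R[i].
Local Notation leb := (@lebesgue_measure R).
Implicit Types (h k : R -> C) (a b c d m t : R).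

Definition pcont h t := forall e : R, 0 < e ->
  exists2 d : R, 0 < d & forall s, `|s - t| < d -> normc (h s - h t) <= e.

Lemma pcont_Re h t : pcont h t -> {for t, continuous (fun s => complex.Re (h s))}.
Proof.
move=> H; apply/cvgrPdist_le => e e0; have [d d0 Hd] := H e e0.
exists d => //= s; rewrite /ball_/= distrC => /Hd.
by apply: le_trans; rewrite -Re_sub -normcN opprB; exact: Re_le_normc.
Qed.

Lemma pcont_Im h t : pcont h t -> {for t, continuous (fun s => complex.Im (h s))}.
Proof.
move=> H; apply/cvgrPdist_le => e e0; have [d d0 Hd] := H e e0.
exists d => //= s; rewrite /ball_/= distrC => /Hd.
by apply: le_trans; rewrite -Im_sub -normcN opprB; exact: Im_le_normc.
Qed.

Lemma continuous_pcont h t : {for t, continuous (fun s => complex.Re (h s))} ->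
  {for t, continuous (fun s => complex.Im (h s))} -> pcont h t.
Proof.
move=> h1 h2 e e0; have e20 : 0 < e / 2 by lra.
move/cvgrPdist_le : h1 => /(_ _ e20)/nbhs_ballP[d1 /= d10 H1].
move/cvgrPdist_le : h2 => /(_ _ e20)/nbhs_ballP[d2 /= d20 H2].
exists (Num.min d1 d2); first by rewrite lt_min d10.
move=> s; rewrite lt_min => /andP[s1 s2].
apply: le_trans (normc_le_ReIm _) _; rewrite Re_sub Im_sub.
have := H1 s; rewrite -ball_normE /ball_/= distrC => /(_ s1).
have := H2 s; rewrite -ball_normE /ball_/= (distrC t) => /(_ s2).
rewrite (distrC (complex.Re (h t))) (distrC (complex.Im (h t))); lra.
Qed.

Lemma pcont_cintegrable h a b : (forall t, a <= t <= b -> pcont h t) ->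
  cintegrable leb `[a, b] h.
Proof.
move=> H; split; apply: continuous_compact_integrable; do ?exact: segment_compact;
  apply: continuous_subspace_itv => t; rewrite in_itv/= => /H.
  exact: pcont_Re.
exact: pcont_Im.
Qed.

Lemma pcontB h k t : pcont h t -> pcont k t -> pcont (fun s => h s - k s) t.
Proof.
move=> H1 H2 e e0; have e20 : 0 < e / 2 by lra.
have [d d0 Hd] := H1 _ e20; have [d' d'0 Hd'] := H2 _ e20.
exists (Num.min d d'); first by rewrite lt_min d0.
move=> s; rewrite lt_min => /andP[/Hd h1 /Hd' h2].
rewrite (_ : h s - k s - _ = (h s - h t) - (k s - k t)); last by ring.
by apply: le_trans (ler_normcB _ _) _; lra.
Qed.

Lemma pcont_comp (f : C -> C) h t : pcont h t -> ccont f (h t) -> pcont (fun s => f (h s)) t.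
Proof.
move=> H1 H2 e e0; have [d d0 Hd] := H2 _ e0; have d20 : 0 < d / 2 by lra.
have [d' d'0 Hd'] := H1 _ d20.
by exists d' => // s /Hd' hs; apply: Hd; lra.
Qed.

Lemma measurable_itv_setU a b c : a <= b -> b <= c ->
  (`[a, c] = `[a, b] `|` `]b, c] :> set R)%classic.
Proof.
move=> ab bc; apply/seteqP; split=> x /=; rewrite !in_itv/=.
  by case: (leP x b) => xb /andP[ax xc]; [left; rewrite ax|right; rewrite xc].
by case=> /andP[ax xc]; apply/andP; split; lra.
Qed.

Lemma cint_itv_split h a b c : a <= b -> b <= c -> cintegrable leb `[a, c] h ->
  cint leb `[a, c] h = cint leb `[a, b] h + cint leb `[b, c] h.
Proof.
move=> ab bc hi.
have sub : (`]b, c] `<=` `[a, c])%classic.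
  by move=> x /=; rewrite !in_itv/= => /andP[bx xc]; rewrite xc andbT; lra.
have hi' : cintegrable leb `]b, c] h by apply: cintegrableS hi.
rewrite (measurable_itv_setU ab bc) cint_setU//; last first.
- apply/disj_setPS => x [] /=; rewrite !in_itv/= => /andP[_ xb] /andP[bx _]; lra.
- by rewrite -measurable_itv_setU.
by congr (_ + _); case: hi' => h1 h2; apply: complex_ReIm_eq; rewrite /= Rintegral_itv_obnd_cbnd.
Qed.

Lemma lebesgue_measure_cc a b : a <= b -> lebesgue_measure (`[a, b]%classic : set R) = (b - a)%:E.
Proof.
move=> ab; rewrite lebesgue_measure_itv /= lte_fin EFinB.
case: ltP => //= ba; have -> : b = a by apply/le_anti/andP.
by rewrite subee.
Qed.

Lemma cint_itv_cst (w : C) a b : a <= b -> cint leb `[a, b] (fun=> w) = w * RtoC (b - a).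
Proof.
move=> ab; rewrite cint_cst//; congr (_ * RtoC _).
exact: (congr1 fine (lebesgue_measure_cc ab)).
Qed.

Lemma normc_cint_itv_le h a b (B : R) : a <= b -> cintegrable leb `[a, b] h ->
  (forall t, a <= t <= b -> normc (h t) <= B) -> normc (cint leb `[a, b] h) <= 2 * (B * (b - a)).
Proof.
move=> ab hi hB.
have -> : B * (b - a) = Rintegral leb `[a, b] (fun=> B).
  rewrite Rintegral_cst//; congr (_ * _).
  exact: (congr1 fine (esym (lebesgue_measure_cc ab))).
apply: normc_cint_le => //.
  apply: continuous_compact_integrable; first exact: segment_compact.
  by apply: continuous_subspaceT => x; exact: cvg_cst.
Qed.

End Paths.

(** * Goursat's theorem on rectangles *)

Section Goursat.
Variable R : realType.
Local Notation C := R[i].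
Local Notation leb := (@lebesgue_measure R).
Implicit Types (g : R -> R -> C) (a b c d m s t w h : R).

(** Complex differentiability of [g] as a function of s + i t: the real differential is
    multiplication by [A], which encodes the Cauchy-Riemann equations. The error is measured in the
    l1 norm of the increment. *)
Definition pdiff g s t (A : C) := forall e : R, 0 < e ->
  exists2 dl : R, 0 < dl & forall s' t', `|s' - s| < dl -> `|t' - t| < dl ->
  normc (g s' t' - g s t - A * Complex (s' - s) (t' - t)) <= e * (`|s' - s| + `|t' - t|).

Lemma pdiff_pcont1 g s t A : pdiff g s t A -> pcont (fun x => g x t) s.
Proof.
move=> H e e0; have [dl dl0 Hd] := H 1 ltr01.
have nA := normc_ge0 A.
exists (Num.min dl (e / (1 + normc A))); first by rewrite lt_min dl0 divr_gt0//; lra.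
move=> s'; rewrite lt_min => /andP[s1 s2].
have := Hd s' t s1; rewrite subrr normr0 addr0 mul1r => /(_ dl0) h1.
have E : normc (A * Complex (s' - s) 0) = normc A * `|s' - s|.
  by rewrite normcM (normc_RtoC (s' - s)).
have -> : g s' t - g s t = (g s' t - g s t - A * Complex (s' - s) 0) + A * Complex (s' - s) 0 by ring.
apply: le_trans (le_normcD _ _) _; rewrite E.
have : `|s' - s| * (1 + normc A) <= e by rewrite -ler_pdivlMr; [exact: ltW|lra].
lra.
Qed.

Lemma pdiff_pcont2 g s t A : pdiff g s t A -> pcont (fun x => g s x) t.
Proof.
move=> H e e0; have [dl dl0 Hd] := H 1 ltr01.
have nA := normc_ge0 A.
exists (Num.min dl (e / (1 + normc A))); first by rewrite lt_min dl0 divr_gt0//; lra.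
move=> t'; rewrite lt_min => /andP[s1 s2].
have := Hd s t'; rewrite subrr normr0 add0r mul1r => /(_ dl0 s1) h1.
have E : normc (A * Complex 0 (t' - t)) = normc A * `|t' - t|.
  by rewrite normcM /normc /= expr0n add0r sqrtr_sqr.
have -> : g s t' - g s t = (g s t' - g s t - A * Complex 0 (t' - t)) + A * Complex 0 (t' - t) by ring.
apply: le_trans (le_normcD _ _) _; rewrite E.
have : `|t' - t| * (1 + normc A) <= e by rewrite -ler_pdivlMr; [exact: ltW|lra].
lra.
Qed.

(** The counterclockwise contour integral of g(s, t) d(s + i t) round the rectangle [a,b] x [c,d],
    with opposite sides already combined. *)
Definition rectint g a b c d : C :=
  cint leb `[a, b] (fun s => g s c - g s d) +
  Complex 0 1 * cint leb `[c, d] (fun t => g b t - g a t).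

Definition pdiff_on g a b c d :=
  forall s t, a <= s <= b -> c <= t <= d -> exists A, pdiff g s t A.

Lemma pdiff_on_cintegrable1 g a b c d c' d' : pdiff_on g a b c d -> c <= c' <= d -> c <= d' <= d ->
  cintegrable leb `[a, b] (fun s => g s c' - g s d').
Proof.
move=> H cc dd; apply: pcont_cintegrable => s sab.
have [A HA] := H s c' sab cc; have [B HB] := H s d' sab dd.
by apply: pcontB; [exact: pdiff_pcont1 HA|exact: pdiff_pcont1 HB].
Qed.

Lemma pdiff_on_cintegrable2 g a b c d a' b' : pdiff_on g a b c d -> a <= a' <= b -> a <= b' <= b ->
  cintegrable leb `[c, d] (fun t => g b' t - g a' t).
Proof.
move=> H aa bb; apply: pcont_cintegrable => t tcd.
have [A HA] := H b' t bb tcd; have [B HB] := H a' t aa tcd.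
by apply: pcontB; [exact: pdiff_pcont2 HA|exact: pdiff_pcont2 HB].
Qed.

Lemma pdiff_onS g a b c d a' b' c' d' : a <= a' -> b' <= b -> c <= c' -> d' <= d ->
  pdiff_on g a b c d -> pdiff_on g a' b' c' d'.
Proof. by move=> aa bb cc dd H s t /andP[? ?] /andP[? ?]; apply: H; apply/andP; split; lra. Qed.

Lemma rectint_split1 g a b c d m : a <= m -> m <= b -> c <= d -> pdiff_on g a b c d ->
  rectint g a b c d = rectint g a m c d + rectint g m b c d.
Proof.
move=> am mb cd H; rewrite /rectint (@cint_itv_split _ _ a m b)//; last first.
  by apply: (pdiff_on_cintegrable1 H); rewrite lexx ?andbT.
have -> : cint leb `[c, d] (fun t => g b t - g a t) =
    cint leb `[c, d] (fun t => g b t - g m t) + cint leb `[c, d] (fun t => g m t - g a t).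
  rewrite -cintD//; first by apply: eq_cint => t _; ring.
    by apply: (pdiff_on_cintegrable2 H); apply/andP; split; lra.
  by apply: (pdiff_on_cintegrable2 H); apply/andP; split; lra.
ring.
Qed.

Lemma rectint_split2 g a b c d m : c <= m -> m <= d -> a <= b -> pdiff_on g a b c d ->
  rectint g a b c d = rectint g a b c m + rectint g a b m d.
Proof.
move=> am mb cd H; rewrite /rectint (@cint_itv_split _ _ c m d)//; last first.
  by apply: (pdiff_on_cintegrable2 H); rewrite lexx ?andbT.
have -> : cint leb `[a, b] (fun t => g t c - g t d) =
    cint leb `[a, b] (fun t => g t c - g t m) + cint leb `[a, b] (fun t => g t m - g t d).
  rewrite -cintD//; first by apply: eq_cint => t _; ring.
    by apply: (pdiff_on_cintegrable1 H); apply/andP; split; lra.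
  by apply: (pdiff_on_cintegrable1 H); apply/andP; split; lra.
ring.
Qed.

(** The affine part of [g] at (s, t) contributes -A (i h) w + i A w h = 0, so only the remainder [r]
    survives, and it is at most e (w + h) on the boundary. The constant 4 is two opposite sides
    times the 2 of [normc_cint_le]. *)
Lemma rectint_small g s t A (e dl : R) x y w h :
  (forall s' t', `|s' - s| < dl -> `|t' - t| < dl ->
    normc (g s' t' - g s t - A * Complex (s' - s) (t' - t)) <= e * (`|s' - s| + `|t' - t|)) ->
  0 <= e -> 0 <= w < dl -> 0 <= h < dl -> x <= s <= x + w -> y <= t <= y + h ->
  pdiff_on g x (x + w) y (y + h) ->
  normc (rectint g x (x + w) y (y + h)) <= 4 * (e * (w + h) ^+ 2).
Proof.
move=> H e0 /andP[w0 wd] /andP[h0 hd] /andP[xs sx] /andP[yt ty] Hon.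
pose r s' t' := g s' t' - g s t - A * Complex (s' - s) (t' - t).
have rb s' t' : x <= s' <= x + w -> y <= t' <= y + h -> normc (r s' t') <= e * (w + h).
  move=> /andP[? ?] /andP[? ?].
  have ? : `|s' - s| <= w by rewrite ler_norml; apply/andP; split; lra.
  have ? : `|t' - t| <= h by rewrite ler_norml; apply/andP; split; lra.
  apply: le_trans (H _ _ _ _) _; [lra|lra|].
  by apply: ler_wpM2l => //; lra.
have i1 : cintegrable leb `[x, x + w] (fun s' => g s' y - g s' (y + h)).
  by apply: (pdiff_on_cintegrable1 Hon); apply/andP; split; lra.
have i2 : cintegrable leb `[y, y + h] (fun t' => g (x + w) t' - g x t').
  by apply: (pdiff_on_cintegrable2 Hon); apply/andP; split; lra.
have c1 (z : C) u v : cintegrable leb `[u, v] (fun=> z).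
  by apply: pcont_cintegrable => ? _ eps eps0; exists 1 => // ? _; rewrite subrr normc0 ltW.
have E1 : cint leb `[x, x + w] (fun s' => g s' y - g s' (y + h)) =
    cint leb `[x, x + w] (fun s' => r s' y - r s' (y + h)) - A * Complex 0 h * RtoC w.
  have -> : RtoC w = RtoC (x + w - x) by congr RtoC; ring.
  rewrite -cint_itv_cst; last lra.
  rewrite -cintB//.
    apply: eq_cint => s' _; rewrite /r.
    have -> : Complex (s' - s) (y + h - t) = Complex (s' - s) (y - t) + Complex 0 h.
      by apply: complex_ReIm_eq => /=; ring.
    by ring.
  have := cintegrableD _ i1 (c1 (A * Complex 0 h) x (x + w)).
  move=> /(_ ltac:(by [])); apply: eq_cintegrable => // s' _; rewrite /r.
  have -> : Complex (s' - s) (y + h - t) = Complex (s' - s) (y - t) + Complex 0 h.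
    by apply: complex_ReIm_eq => /=; ring.
  by ring.
have E2 : cint leb `[y, y + h] (fun t' => g (x + w) t' - g x t') =
    cint leb `[y, y + h] (fun t' => r (x + w) t' - r x t') + A * RtoC w * RtoC h.
  have -> : RtoC h = RtoC (y + h - y) by congr RtoC; ring.
  rewrite -cint_itv_cst; last lra.
  rewrite -cintD//.
    apply: eq_cint => t' _; rewrite /r.
    have -> : Complex (x + w - s) (t' - t) = Complex (x - s) (t' - t) + RtoC w.
      by apply: complex_ReIm_eq => /=; ring.
    by ring.
  have := cintegrableB _ i2 (c1 (A * RtoC w) y (y + h)).
  move=> /(_ ltac:(by [])); apply: eq_cintegrable => // t' _; rewrite /r.
  have -> : Complex (x + w - s) (t' - t) = Complex (x - s) (t' - t) + RtoC w.
    by apply: complex_ReIm_eq => /=; ring.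
  by ring.
rewrite /rectint E1 E2.
set I1 := cint _ _ _; set I2 := cint _ _ _.
have -> : I1 - A * Complex 0 h * RtoC w + Complex 0 1 * (I2 + A * RtoC w * RtoC h) = I1 + Complex 0 1 * I2.
  have -> : Complex 0 h = Complex 0 1 * RtoC h :> C.
    by apply: complex_ReIm_eq; rewrite ?Re_mul ?Im_mul /=; ring.
  ring.
apply: le_trans (le_normcD _ _) _; rewrite normcM.
have -> : normc (Complex 0 1 : C) = 1 by rewrite /normc /= expr0n add0r expr1n sqrtr1.
have ew : 0 <= e * (w + h) by apply: mulr_ge0 => //; lra.
have b1 : normc I1 <= 2 * (2 * (e * (w + h)) * (x + w - x)).
  apply: normc_cint_itv_le; first lra.
    have := cintegrableD _ i1 (c1 (A * Complex 0 h) x (x + w)).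
    move=> /(_ ltac:(by [])); apply: eq_cintegrable => // s' _; rewrite /r.
    have -> : Complex (s' - s) (y + h - t) = Complex (s' - s) (y - t) + Complex 0 h.
      by apply: complex_ReIm_eq => /=; ring.
    by ring.
  move=> s' Hs'; apply: le_trans (ler_normcB _ _) _.
  have := rb s' y Hs'; have := rb s' (y + h) Hs'.
  by move=> /(_ ltac:(lra)) ? /(_ ltac:(lra)) ?; lra.
have b2 : normc I2 <= 2 * (2 * (e * (w + h)) * (y + h - y)).
  apply: normc_cint_itv_le; first lra.
    have := cintegrableB _ i2 (c1 (A * RtoC w) y (y + h)).
    move=> /(_ ltac:(by [])); apply: eq_cintegrable => // t' _; rewrite /r.
    have -> : Complex (x + w - s) (t' - t) = Complex (x - s) (t' - t) + RtoC w.
      by apply: complex_ReIm_eq => /=; ring.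
    by ring.
  move=> t' Ht'; apply: le_trans (ler_normcB _ _) _.
  have := rb (x + w) t' ; have := rb x t'.
  by move=> /(_ ltac:(lra) Ht') ? /(_ ltac:(lra) Ht') ?; lra.
have -> : 4 * (e * (w + h) ^+ 2) = 2 * (2 * (e * (w + h)) * (x + w - x)) + 2 * (2 * (e * (w + h)) * (y + h - y)) by ring.
by rewrite mul1r lerD.
Qed.

(** The left ends increase and stay below every right end, so their supremum belongs to all the
    intervals. *)
Lemma nested_limit (x W : nat -> R) : (forall n, x n <= x n.+1) ->
  (forall n, x n.+1 + W n.+1 <= x n + W n) -> (forall n, 0 <= W n) ->
  exists s, forall n, x n <= s <= x n + W n.
Proof.
move=> xi xd W0.
have hx : {homo x : n m / (n <= m)%N >-> n <= m} by apply/nondecreasing_seqP.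
have hd n k : x (n + k)%N + W (n + k)%N <= x n + W n.
  elim: k => [|k ih]; first by rewrite addn0.
  by rewrite addnS; apply: le_trans (xd _) ih.
have ub n (m : nat) : x m <= x n + W n.
  have [mn|/ltnW nm] := leqP m n; first by have := hx _ _ mn; have := W0 n; lra.
  by have := hd n (m - n)%N; rewrite subnKC// => ?; have := W0 m; lra.
exists (sup (range x)) => n; apply/andP; split.
  by apply: ub_le_sup; [exists (x 0%N + W 0%N) => _ [m _ <-]|exists n].
by apply: ge_sup; [exists (x 0%N); exists 0%N|move=> _ [m _ <-]].
Qed.

Theorem rectint_eq0 g a b c d : a <= b -> c <= d -> pdiff_on g a b c d -> rectint g a b c d = 0.
Proof.
move=> ab cd Hon; pose w := b - a; pose h := d - c.
pose W (n : nat) := w / 2 ^+ n; pose H (n : nat) := h / 2 ^+ n.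
have W0 n : 0 <= W n by rewrite divr_ge0 ?exprn_ge0 /w; lra.
have H0 n : 0 <= H n by rewrite divr_ge0 ?exprn_ge0 /h; lra.
have WS n : W n = W n.+1 + W n.+1 by rewrite /W exprS; field.
have HS n : H n = H n.+1 + H n.+1 by rewrite /H exprS; field.
pose V n x y := normc (rectint g x (x + W n) y (y + H n)).
(* Bisection: take a quarter carrying at least a fourth of the integral. The last quarter is taken
   untested; if the other three fail, the triangle inequality forces it to qualify ([Vstep]). *)
pose fix corner n : R * R := if n is k.+1 then
  let x := (corner k).1 in let y := (corner k).2 in
  if V k x y <= 4 * V n x y then (x, y) else
  if V k x y <= 4 * V n (x + W n) y then (x + W n, y) else
  if V k x y <= 4 * V n x (y + H n) then (x, y + H n) else (x + W n, y + H n)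
  else (a, c).
pose x n := (corner n).1; pose y n := (corner n).2.
have step n : [/\ x n <= x n.+1, x n.+1 + W n.+1 <= x n + W n, y n <= y n.+1 & y n.+1 + H n.+1 <= y n + H n].
  have := WS n; have := HS n; have := W0 n.+1; have := H0 n.+1.
  rewrite /x /y /=; case: ifP => _ /=; [|case: ifP => _ /=; [|case: ifP => _ /=]];
  by move=> ? ? ? ?; split; lra.
have inside n : [/\ a <= x n, x n + W n <= b, c <= y n & y n + H n <= d].
  elim: n => [|n [? ? ? ?]]; last by case: (step n) => ? ? ? ?; split; lra.
  by rewrite /x /y /W /H /= expr0 !divr1 /w /h; split; lra.
have on n : pdiff_on g (x n) (x n + W n) (y n) (y n + H n).
  by case: (inside n) => ? ? ? ?; apply: pdiff_onS Hon.
have Vstep n : V n (x n) (y n) <= 4 * V n.+1 (x n.+1) (y n.+1).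
  have tot : V n (x n) (y n) <= V n.+1 (x n) (y n) + V n.+1 (x n + W n.+1) (y n) +
      V n.+1 (x n) (y n + H n.+1) + V n.+1 (x n + W n.+1) (y n + H n.+1).
    have w0 := W0 n.+1; have h0 := H0 n.+1; have wS := WS n; have hS := HS n.
    rewrite /V (@rectint_split1 _ _ _ _ _ (x n + W n.+1))//; [|lra..].
    rewrite (@rectint_split2 _ _ _ _ _ (y n + H n.+1)); [|lra..|]; last first.
      by apply: pdiff_onS (on n); lra.
    rewrite (@rectint_split2 _ (x n + W n.+1) _ _ _ (y n + H n.+1)); [|lra..|]; last first.
      by apply: pdiff_onS (on n); lra.
    have -> : x n + W n = x n + W n.+1 + W n.+1 by lra.
    have -> : y n + H n = y n + H n.+1 + H n.+1 by lra.
    have T (u v u' v' : C) : normc (u + v + (u' + v')) <= normc u + normc u' + normc v + normc v'.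
      by have := le_normcD (u + v) (u' + v'); have := le_normcD u v; have := le_normcD u' v'; lra.
    exact: T.
  rewrite [x n.+1]/x [y n.+1]/y /= -/(x n) -/(y n).
  case: ifPn => [//|]; rewrite -ltNge => c1.
  case: ifPn => [//|]; rewrite -ltNge => c2.
  case: ifPn => [//|]; rewrite -ltNge => c3 /=.
  by clear -tot c1 c2 c3; lra.
have V0 n : normc (rectint g a b c d) <= 4 ^+ n * V n (x n) (y n).
  elim: n => [|n ih].
    rewrite expr0 mul1r /V /x /y /= /W /H expr0 !divr1 /w /h.
    by rewrite (addrC a) subrK (addrC c) subrK.
  apply: le_trans ih _; rewrite exprSr -mulrA; apply: ler_wpM2l (Vstep n).
  exact: exprn_ge0.
have [s Hs] := @nested_limit x W (fun n => let: And4 p _ _ _ := step n in p)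
   (fun n => let: And4 _ p _ _ := step n in p) W0.
have [t Ht] := @nested_limit y H (fun n => let: And4 _ _ p _ := step n in p)
   (fun n => let: And4 _ _ _ p := step n in p) H0.
have [A HA] : exists A, pdiff g s t A.
  apply: Hon; [have := Hs 0%N; have [? ? _ _] := inside 0%N|have := Ht 0%N; have [_ _ ? ?] := inside 0%N];
  by move=> /andP[? ?]; apply/andP; split; lra.
apply: eps_normc_eq0 => e e0.
(* The summand 1 keeps [K] positive when the rectangle is a point. *)
pose K := 4 * (w + h) ^+ 2 + 1.
have K0 : 0 < K by rewrite /K; have := sqr_ge0 (w + h); lra.
have eK : 0 < e / K by rewrite divr_gt0.
have [dl dl0 Hdl] := HA _ eK.
have [n [Wn Hn]] : exists n, W n < dl /\ H n < dl.
  have h2 : `|2^-1 : R| < 1 by rewrite ger0_norm ?invr_ge0//; lra.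
  have /cvgrPdist_lt := cvg_expr h2.
  have wh : 0 < w + h + 1 by rewrite /w /h; lra.
  have q0 : 0 < dl / (w + h + 1) by rewrite divr_gt0.
  move=> /(_ _ q0) [n _ /(_ n (leqnn n))] /=.
  rewrite sub0r normrN ger0_norm ?exprn_ge0 ?invr_ge0// exprVn ltr_pdivlMr// => q.
  have p2 : 0 < (2 ^+ n)^-1 :> R by rewrite invr_gt0 exprn_gt0.
  exists n; rewrite /W /H /w /h in wh q *; split; nra.
have rs := rectint_small Hdl (ltW eK) (_ : 0 <= W n < dl) (_ : 0 <= H n < dl) (Hs n) (Ht n) (on n).
apply: le_trans (V0 n) _.
have p2 : 0 < 4 ^+ n :> R by rewrite exprn_gt0.
apply: (@le_trans _ _ (4 ^+ n * (4 * (e / K * (W n + H n) ^+ 2)))).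
  by apply: ler_wpM2l; [exact: ltW|apply: rs; rewrite ?W0 ?H0].
(* The factor 4^n lost by the n quarterings is exactly regained from (W n + H n)^2 = (w + h)^2 /
   4^n. *)
have -> : 4 ^+ n = (2 ^+ n) ^+ 2 :> R.
  by rewrite -exprM mulnC exprM; congr (_ ^+ n); rewrite expr2; lra.
have n2 : 2 ^+ n != 0 :> R by rewrite expf_neq0.
have -> : (2 ^+ n) ^+ 2 * (4 * (e / K * (W n + H n) ^+ 2)) = e / K * (4 * (w + h) ^+ 2).
  by rewrite /W /H; field; rewrite n2 gt_eqF.
rewrite mulrAC ler_pdivrMr// /K; nra.
Qed.

End Goursat.

(** * Integrals over circles and Cauchy's formula *)

Section Circle.
Variable R : realType.
Local Notation C := R[i].
Local Notation leb := (@lebesgue_measure R).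
Local Notation circ := (`[0, 2 * pi]%classic : set R).
Implicit Types (f : C -> C) (r s t u v : R).

Lemma is_derive_eps (f : R -> R) (x df : R) : is_derive x (1 : R) f df -> forall e : R, 0 < e ->
  exists2 d : R, 0 < d & forall h : R, `|h| < d -> `|f (x + h) - f x - df * h| <= e * `|h|.
Proof.
move=> [df1 <-] e e0; move: df1; rewrite /derivable => /cvgrPdist_le/(_ _ e0) [d /= d0 Hd].
exists d => // h hd; have [->|h0] := eqVneq h 0.
  by rewrite addr0 subrr mulr0 subrr !normr0 mulr0.
have := Hd h; rewrite /ball_ /= sub0r normrN => /(_ hd h0).
have h0' : 0 < `|h| by rewrite normr_gt0.
rewrite -(ler_pM2r h0') -normrM -normrN; congr (`| _ | <= _).
by rewrite /GRing.scale /= mulr1 (addrC x) /derive; field.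
Qed.

Lemma cisD s t : cis (s + t) = cis s * cis t.
Proof. by apply: complex_ReIm_eq; rewrite ?Re_mul ?Im_mul /= ?cosD ?sinD; ring. Qed.

Lemma cis0 : cis 0 = 1 :> C.
Proof. by rewrite /cis cos0 sin0. Qed.

Lemma cis2pi : cis (2 * pi) = 1 :> C.
Proof. by rewrite /cis mulr_natl cos2pi sin2pi. Qed.

(** This is exp (s + i t). The circle of radius r about 0 is the vertical segment s = ln r. *)
Definition expc s t : C := RtoC (expR s) * cis t.

Lemma expcD s t u v : expc (s + u) (t + v) = expc s t * expc u v.
Proof. by rewrite /expc expRD RtoCM cisD; ring. Qed.

Lemma normc_expc s t : normc (expc s t) = expR s.
Proof. by rewrite normc_circle// expR_ge0. Qed.

(** The group law [expcD] transports differentiability from 0 to every point, so only the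
    derivatives of [expR], [cos] and [sin] at 0 enter. *)
Lemma expc_diff0 (e : R) : 0 < e -> exists2 d : R, 0 < d & forall u v, `|u| < d -> `|v| < d ->
  normc (expc u v - 1 - Complex u v) <= e * (`|u| + `|v|).
Proof.
move=> e0; pose e1 := Num.min 1 (e / 8).
have e10 : 0 < e1 by rewrite lt_min ltr01 divr_gt0.
have e11 : e1 <= 1 by rewrite ge_min lexx.
have e1e : e1 <= e / 8 by rewrite ge_min lexx orbT.
have [d1 d10 H1] := is_derive_eps (is_derive_expR (0 : R)) e10.
have [d2 d20 H2] := is_derive_eps (is_derive_cos (0 : R)) e10.
have [d3 d30 H3] := is_derive_eps (is_derive_sin (0 : R)) e10.
exists (Num.min (Num.min d1 d2) (Num.min d3 e1)); first by rewrite !lt_min d10 d20 d30 ltr01 divr_gt0.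
move=> u v; rewrite !lt_min => /andP[/andP[u1 _] /andP[_ ue]] /andP[/andP[_ v2] /andP[v3 _]].
have := H1 u u1; rewrite add0r expR0 mul1r => {}H1.
have := H2 v v2; rewrite add0r cos0 sin0 oppr0 mul0r subr0 => {}H2.
have := H3 v v3; rewrite add0r cos0 sin0 subr0 mul1r => {}H3.
have u0 := normr_ge0 u; have v0 := normr_ge0 v.
have ex1 : `|expR u - 1| <= 2 * `|u|.
  have -> : expR u - 1 = (expR u - 1 - u) + u by ring.
  by apply: le_trans (ler_normD _ _) _; nra.
have ex3 : `|expR u| <= 3.
  have -> : expR u = (expR u - 1) + 1 by ring.
  by apply: le_trans (ler_normD _ _) _; rewrite normr1; lra.
have sv : `|sin v| <= 2 * `|v|.
  have -> : sin v = (sin v - v) + v by ring.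
  by apply: le_trans (ler_normD _ _) _; nra.
apply: le_trans (normc_le_ReIm _) _; rewrite /expc !Re_sub !Im_sub Re_mul Im_mul /=.
have -> : expR u * cos v - 0 * sin v - 1 - u = (expR u - 1 - u) + expR u * (cos v - 1) by ring.
have -> : expR u * sin v + 0 * cos v - 0 - v = (expR u - 1) * sin v + (sin v - v) by ring.
have t1 : `|expR u * (cos v - 1)| <= 3 * (e1 * `|v|) by rewrite normrM; exact: ler_pM.
have t2 : `|(expR u - 1) * sin v| <= 2 * e1 * (2 * `|v|).
  have ue1 : `|u| <= e1 by rewrite le_min; case/andP: ue => /ltW -> /ltW ->.
  by rewrite normrM; apply: ler_pM => //; lra.
have a1 := ler_normD (expR u - 1 - u) (expR u * (cos v - 1)).
have a2 := ler_normD ((expR u - 1) * sin v) (sin v - v).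
have : 8 * e1 * (`|u| + `|v|) <= e * (`|u| + `|v|) by apply: ler_wpM2r; lra.
nra.
Qed.

(** Chain rule: the new point is z + z k with k = [expc u v - 1], and k differs from u + i v by a
    small error ([expc_diff0]). Hence the factor [expc s t] in the derivative. *)
Lemma cdiff_pdiff f s t A : cdiff f (expc s t) A -> pdiff (fun s t => f (expc s t)) s t (A * expc s t).
Proof.
move=> HA e e0; set z := expc s t in HA *.
have z0 := normc_ge0 z; have A0 := normc_ge0 A.
have AZ : 0 <= normc A * normc z by exact: mulr_ge0.
pose e1 := e / (4 * (normc z + 1)).
have e10 : 0 < e1 by rewrite divr_gt0//; lra.
pose e2 := Num.min 1 (e / (2 * (normc A * normc z + 1))).
have e20 : 0 < e2 by rewrite lt_min ltr01 divr_gt0//; lra.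
have e21 : e2 <= 1 by rewrite ge_min lexx.
have e2e : e2 * (normc A * normc z + 1) <= e / 2.
  have : e2 <= e / (2 * (normc A * normc z + 1)) by rewrite ge_min lexx orbT.
  by rewrite ler_pdivlMr; lra.
have e1e : e1 * (normc z + 1) = e / 4 by rewrite /e1; field; lra.
have [d1 d10 H1] := HA _ e10; have [d2 d20 H2] := expc_diff0 e20.
pose d := Num.min d2 (d1 / (4 * (normc z + 1))).
exists d; first by rewrite lt_min d20 divr_gt0//; lra.
move=> s' t'; rewrite !lt_min => /andP[s2 s1] /andP[t2 t1].
set u := s' - s in s1 s2 *; set v := t' - t in t1 t2 *.
have -> : expc s' t' = z + z * (expc u v - 1).
  by rewrite mulrBr mulr1 addrC subrK -expcD /u /v !(addrC _ (_ - _)) !subrK.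
set k := expc u v - 1.
have := H2 u v s2 t2; rewrite -/k => Hk.
have u0 := normr_ge0 u; have v0 := normr_ge0 v.
have nk : normc k <= 2 * (`|u| + `|v|).
  have -> : k = (k - Complex u v) + Complex u v by ring.
  apply: le_trans (le_normcD _ _) _.
  have : normc (Complex u v : C) <= `|u| + `|v| by exact: normc_le_ReIm.
  nra.
have nzk : normc (z * k) <= (normc z + 1) * (2 * (`|u| + `|v|)).
  by rewrite normcM; apply: ler_pM; rewrite ?normc_ge0//; lra.
have nzk1 : normc (z * k) < d1.
  apply: le_lt_trans nzk _.
  move: s1 t1; rewrite !ltr_pdivlMr; [|lra..].
  nra.
have -> : f (z + z * k) - f z - A * z * Complex u v =
  (f (z + z * k) - f z - A * (z * k)) + A * z * (k - Complex u v) by ring.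
apply: le_trans (le_normcD _ _) _; rewrite (normcM (A * z)) (normcM A).
have b1 := H1 _ nzk1.
have b2 : e1 * normc (z * k) <= e1 * ((normc z + 1) * (2 * (`|u| + `|v|))).
  by apply: ler_wpM2l => //; exact: ltW.
have b3 : normc A * normc z * normc (k - Complex u v) <= normc A * normc z * (e2 * (`|u| + `|v|)).
  exact: ler_wpM2l.
have b4 : e2 * (normc A * normc z) * (`|u| + `|v|) <= e / 2 * (`|u| + `|v|).
  by apply: ler_wpM2r; [lra|]; lra.
have b5 : e1 * ((normc z + 1) * (2 * (`|u| + `|v|))) = e / 2 * (`|u| + `|v|).
  by rewrite mulrA e1e; field.
lra.
Qed.

Lemma pcont_circle r t : pcont (fun s => RtoC r * cis s) t.
Proof.
apply: continuous_pcont.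
  have -> : (fun s => complex.Re (RtoC r * cis s)) = (fun s => r * cos s).
    by apply/funext => s; rewrite Re_mul /=; ring.
  by apply: cvgM; [exact: cvg_cst|exact: continuous_cos].
have -> : (fun s => complex.Im (RtoC r * cis s)) = (fun s => r * sin s).
  by apply/funext => s; rewrite Im_mul /=; ring.
by apply: cvgM; [exact: cvg_cst|exact: continuous_sin].
Qed.

Lemma circle_cintegrable f r : (forall t, ccont f (RtoC r * cis t)) ->
  cintegrable leb circ (fun t => f (RtoC r * cis t)).
Proof.
move=> H; apply: pcont_cintegrable => t _.
by apply: (@pcont_comp _ f (fun s => RtoC r * cis s)); [exact: pcont_circle|exact: H].
Qed.

Lemma twopi_ge0 : 0 <= 2 * pi :> R.
Proof. by have := pi_gt0 R; lra. Qed.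

(* Goursat's theorem for [f (exp (s + i t))] on the rectangle [ln r1, ln r2] x [0, 2 pi]: the sides
   [t = 0] and [t = 2 pi] cancel by periodicity. *)
Lemma circle_invariant f r1 r2 : 0 < r1 -> r1 <= r2 ->
  (forall z, r1 <= normc z <= r2 -> cdifferentiable f z) ->
  cint leb circ (fun t => f (RtoC r1 * cis t)) = cint leb circ (fun t => f (RtoC r2 * cis t)).
Proof.
move=> r10 r12 H; have r20 : 0 < r2 by exact: lt_le_trans r12.
have E1 : expR (ln r1) = r1 by rewrite lnK// posrE.
have E2 : expR (ln r2) = r2 by rewrite lnK// posrE.
have ln12 : ln r1 <= ln r2 by rewrite ler_ln.
pose g s t := f (expc s t).
have Hg : pdiff_on g (ln r1) (ln r2) 0 (2 * pi).
  move=> s t /andP[s1 s2] _; have [|A HA] := H (expc s t).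
    by rewrite normc_expc -E1 -E2 !ler_expR s1 s2.
  by eexists; exact: cdiff_pdiff HA.
have := rectint_eq0 ln12 twopi_ge0 Hg; rewrite /rectint.
have -> : cint leb `[ln r1, ln r2] (fun s => g s 0 - g s (2 * pi)) = 0.
  rewrite (_ : cint _ _ _ = cint leb `[ln r1, ln r2] (fun=> 0)).
    by rewrite cint_itv_cst// mul0r.
  by apply: eq_cint => s _; rewrite /g /expc cis2pi cis0 subrr.
rewrite add0r => /eqP; rewrite mulf_eq0 => /orP[|/eqP].
  by rewrite eq_complex /= oner_eq0 andbF.
rewrite cintB//; last 2 first.
- apply: pcont_cintegrable => t t01; have [|A HA] := Hg (ln r2) t _ t01; first by rewrite lexx ln12.
  exact: pdiff_pcont2 HA.
- apply: pcont_cintegrable => t t01; have [|A HA] := Hg (ln r1) t _ t01; first by rewrite lexx ln12.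
  exact: pdiff_pcont2 HA.
by rewrite /g /expc E1 E2 => /eqP; rewrite subr_eq0 => /eqP.
Qed.

(** Each angle has a neighbourhood in angle and radius that works, and compactness of [0, 2 pi]
    makes the radius uniform. *)
Lemma circle_uniform_cont f r0 : 0 <= r0 -> (forall z, normc z = r0 -> ccont f z) ->
  forall e, 0 < e -> exists2 d, 0 < d & forall r, `|r - r0| < d -> forall t, circ t ->
    normc (f (RtoC r * cis t) - f (RtoC r0 * cis t)) <= e.
Proof.
move=> r00 H e e0.
pose P r t := normc (f (RtoC r * cis t) - f (RtoC r0 * cis t)) <= e.
have cov := (compact_near_coveringP _).1 (@segment_compact R 0 (2 * pi)).
have [|d /= d0 Hd] := cov R (nbhs r0) P.
- move=> t0 _; set z0 := RtoC r0 * cis t0.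
  have e20 : 0 < e / 2 by lra.
  have [d d0 Hd] := H z0 (normc_circle _ r00) _ e20.
  have d20 : 0 < d / 4 by lra.
  have [d1 d10 Hd1] := @pcont_circle r0 t0 _ d20.
  exists (ball t0 d1, ball r0 (d / 4)); first by split; exact: nbhsx_ballx.
  move=> [t r] [] /=; rewrite -!ball_normE /ball_ /= (distrC t0) (distrC r0) => /Hd1 tt rr.
  have c0 : normc (RtoC r0 * cis t - z0) < d by apply: le_lt_trans tt _; lra.
  have c1 : normc (RtoC r * cis t - z0) < d.
    apply: le_lt_trans (normc_triangle (RtoC r0 * cis t) _ _) _.
    rewrite -mulrBl -RtoCB normcM normc_cis mulr1 normc_RtoC; lra.
  apply: le_trans (normc_triangle (f z0) _ _) _.
  by rewrite (normcB (f z0)); have := Hd _ c0; have := Hd _ c1; lra.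
exists d => // r rd t tc; apply: (Hd r) => //.
by rewrite /ball_ /= distrC.
Qed.

(** The integral [J r] is locally constant by [circle_invariant] on annuli that avoid 0 and the
    circle of radius [rho], and it is continuous in r, so the pieces agree across both.
    Differentiability may fail on |z| = rho because the lemma is meant for a difference quotient,
    known to be merely continuous at its base point. *)
Lemma circle_mean_value (f : C -> C) (rho : R) :
  (forall z, normc z < 1 -> ccont f z) ->
  (forall z, 0 < normc z < 1 -> normc z != rho -> cdifferentiable f z) ->
  forall r, 0 <= r < 1 -> cint leb circ (fun t => f (RtoC r * cis t)) = f 0 * RtoC (2 * pi).
Proof.
move=> Hc Hd.
pose J r := cint leb circ (fun t => f (RtoC r * cis t)).
have fi r : 0 <= r < 1 -> cintegrable leb circ (fun t => f (RtoC r * cis t)).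
  by move=> /andP[r0 r1]; apply: circle_cintegrable => t; apply: Hc; rewrite normc_circle.
have pi0 := pi_gt0 R.
have Jc r0 : 0 <= r0 < 1 -> forall e, 0 < e -> exists2 d, 0 < d &
    forall r, 0 <= r < 1 -> `|r - r0| < d -> normc (J r - J r0) <= e.
  move=> /[dup] r01 /andP[r00 r01'] e e0.
  have e4 : 0 < e / (4 * pi) by rewrite divr_gt0//; lra.
  have Hr0 z : normc z = r0 -> ccont f z by move=> zr; apply: Hc; rewrite zr.
  have [d d0 Hdd] := circle_uniform_cont r00 Hr0 e4.
  exists d => // r r01'' rd; rewrite /J -cintB//; [|exact: fi..].
  apply: le_trans (normc_cint_itv_le twopi_ge0 (cintegrableB _ (fi r r01'') (fi r0 r01)) _) _ => //.
    by move=> t tc; apply: Hdd => //; rewrite /= in_itv.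
  by rewrite subr0 le_eqVlt; apply/orP; left; apply/eqP; field; lra.
have Jinv r1 r2 : 0 < r1 -> r1 <= r2 -> r2 < 1 -> (r2 < rho) || (rho < r1) -> J r1 = J r2.
  move=> r10 r12 r21 rr; apply: circle_invariant => // z /andP[z1 z2]; apply: Hd.
    by apply/andP; split; lra.
  by apply/negP => /eqP zr; move: rr; rewrite -zr => /orP[|]; lra.
have J0 : J 0 = f 0 * RtoC (2 * pi).
  have -> : J 0 = cint leb circ (fun=> f 0).
    by apply: eq_cint => t _; rewrite (_ : RtoC 0 = 0)// mul0r.
  by rewrite cint_itv_cst ?subr0// twopi_ge0.
(* A radius r0 that the invariance cannot reach is approached by radii r' where [J r' = J r]. *)
have close r r0 : 0 <= r < 1 -> 0 <= r0 < 1 ->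
   (forall d, 0 < d -> exists r', [/\ 0 <= r' < 1, `|r' - r0| < d & J r' = J r]) -> J r = J r0.
  move=> r01 r001 HH; apply/eqP; rewrite -subr_eq0; apply/eqP; apply: eps_normc_eq0 => e e0.
  by have [d d0 Hdd] := Jc r0 r001 e e0; have [r' [r'1 r'd <-]] := HH d d0; exact: Hdd.
have case1 r : 0 <= r < 1 -> r < rho -> J r = J 0.
  move=> /andP[r0 r1] rr; have [->//|rn0] := eqVneq r 0.
  have rp : 0 < r by rewrite lt_def rn0.
  apply: close; rewrite ?r0 ?lexx ?ltr01// => d d0.
  have m0 : 0 < Num.min r (d / 2) by rewrite lt_min rp; lra.
  have mr : Num.min r (d / 2) <= r by rewrite ge_min lexx.
  have md : Num.min r (d / 2) <= d / 2 by rewrite ge_min lexx orbT.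
  exists (Num.min r (d / 2)); split; [by apply/andP; split; lra| |].
    by rewrite subr0 ger0_norm; lra.
  by apply: Jinv => //; rewrite rr.
have case2 : 0 <= rho < 1 -> J rho = J 0.
  move=> /andP[r0 r1]; have [->//|rn0] := eqVneq rho 0.
  have rp : 0 < rho by rewrite lt_def rn0.
  apply/esym; apply: close; rewrite ?r0 ?lexx ?ltr01// => d d0.
  pose r' := Num.max (rho / 2) (rho - d / 2).
  have a1 : rho / 2 <= r' by rewrite le_max lexx.
  have a2 : rho - d / 2 <= r' by rewrite le_max lexx orbT.
  have a3 : r' < rho by rewrite gt_max; apply/andP; split; lra.
  exists r'; split; [by apply/andP; split; lra| |].
    by rewrite ltr_norml; apply/andP; split; lra.
  by apply: case1 => //; apply/andP; split; lra.
move=> r /[dup] r01 /andP[r0 r1]; rewrite -J0 -/(J r).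
have [rr|rr|rr] := ltgtP r rho; [exact: case1| |by rewrite rr; apply: case2; rewrite -rr].
(* For negative [rho] there is no exceptional circle, and only the origin has to be reached by a
   limit. *)
have [rhon|rhop] := ltP rho 0.
  have [->//|rn0] := eqVneq r 0; have rp : 0 < r by rewrite lt_def rn0.
  apply: close; rewrite ?r0 ?lexx ?ltr01// => d d0.
  have m0 : 0 < Num.min r (d / 2) by rewrite lt_min rp; lra.
  have mr : Num.min r (d / 2) <= r by rewrite ge_min lexx.
  have md : Num.min r (d / 2) <= d / 2 by rewrite ge_min lexx orbT.
  exists (Num.min r (d / 2)); split; [by apply/andP; split; lra| |].
    by rewrite subr0 ger0_norm; lra.
  by apply: Jinv => //; apply/orP; right; lra.
rewrite -case2; last by apply/andP; split; lra.
apply: close => //; first by apply/andP; split; lra.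
move=> d d0; pose r' := Num.min r (rho + d / 2).
have a1 : r' <= r by rewrite ge_min lexx.
have a2 : r' <= rho + d / 2 by rewrite ge_min lexx orbT.
have a3 : rho < r' by rewrite lt_min; apply/andP; split; lra.
exists r'; split; [by apply/andP; split; lra| |].
  by rewrite ltr_norml; apply/andP; split; lra.
by apply: Jinv => //; [lra|rewrite a3 orbT].
Qed.

Lemma cdiff_kernel (w z : C) : z != w -> cdifferentiable (fun x => x / (x - w)) z.
Proof.
move=> zw; have zw0 : z - w != 0 by rewrite subr_eq0.
have h : cdiff (fun x => x - w) z (1 + 0) by apply: cdiffD; [exact: cdiff_id|exact: cdiff_cst].
by eexists; exact: (cdiffM (cdiff_id z) (@cdiffV _ (fun x => x - w) z _ zw0 h)).
Qed.

Lemma normc_kernel (w : C) r t : normc w < r -> 0 <= r ->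
  normc (RtoC r * cis t / (RtoC r * cis t - w)) <= r / (r - normc w).
Proof.
move=> wr r0; rewrite normcM normcV normc_circle//.
have := lerB_normc (RtoC r * cis t) w; rewrite normc_circle// => q.
by apply: ler_wpM2l => //; rewrite lef_pV2 ?posrE//; lra.
Qed.

Lemma circle_neq (w : C) r t : normc w < r -> RtoC r * cis t != w.
Proof.
move=> wr; have r0 : 0 <= r by have := normc_ge0 w; lra.
by apply/negP => /eqP E; move: wr; rewrite -E normc_circle// ltxx.
Qed.

(** The function z / (z - w) is holomorphic for |z| > |w|, so the radius may be increased at will,
    and at infinity the integrand tends to 1. The radius [r'] is chosen so that |w| / (r' - |w|),
    integrated over the circle and doubled by [normc_cint_le], is at most e. *)
Lemma cint_kernel (w : C) r : normc w < r ->
  cint leb circ (fun t => RtoC r * cis t / (RtoC r * cis t - w)) = RtoC (2 * pi).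
Proof.
move=> wr; have w0 := normc_ge0 w; have pi0 := pi_gt0 R.
apply/eqP; rewrite -subr_eq0; apply/eqP; apply: eps_normc_eq0 => e e0.
pose r' := r + 4 * pi * normc w / e.
have q0 : 0 <= 4 * pi * normc w / e by rewrite divr_ge0 ?mulr_ge0//; lra.
have rr' : r <= r' by rewrite /r'; lra.
have r'0 : 0 <= r' by lra.
rewrite (@circle_invariant (fun z => z / (z - w)) r r')//; [|lra|]; last first.
  by move=> z /andP[z1 _]; apply: cdiff_kernel; apply/negP => /eqP zw; rewrite -zw in wr; lra.
have wr' : normc w < r' by lra.
have -> : RtoC (2 * pi) = cint leb circ (fun=> 1).
  by rewrite cint_itv_cst ?mul1r ?subr0// twopi_ge0.
have i1 : cintegrable leb circ (fun t => RtoC r' * cis t / (RtoC r' * cis t - w)).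
  apply: (@circle_cintegrable (fun z => z / (z - w))) => t.
  by have [A HA] := cdiff_kernel (circle_neq t wr'); exact: cdiff_cont HA.
have i2 : cintegrable leb circ (fun=> 1).
  by apply: pcont_cintegrable => ? _ eps eps0; exists 1 => // ? _; rewrite subrr normc0 ltW.
rewrite -cintB//.
apply: le_trans (normc_cint_itv_le (B := normc w / (r' - normc w)) twopi_ge0 (cintegrableB _ i1 i2) _) _ => //.
  move=> t _; have zw := circle_neq t wr'; have zw0 : RtoC r' * cis t - w != 0 by rewrite subr_eq0.
  have -> : RtoC r' * cis t / (RtoC r' * cis t - w) - 1 = w / (RtoC r' * cis t - w) by field.
  rewrite normcM normcV; apply: ler_wpM2l => //.
  have := lerB_normc (RtoC r' * cis t) w; rewrite normc_circle// => ?.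
  by rewrite lef_pV2 ?posrE//; lra.
have -> : 2 * (normc w / (r' - normc w) * (2 * pi - 0)) = 4 * pi * normc w / (r' - normc w).
  by field; lra.
rewrite ler_pdivrMr; last lra.
have : 4 * pi * normc w = e * (4 * pi * normc w / e) by field; lra.
rewrite /r'; nra.
Qed.

(** On a circle dz / i is z dt, whence the kernel z / (z - w). The mean value property applies to
    the difference quotient [H], and H(0) = 0 because of the extra factor z; the remaining term f(w)
    times the kernel is [cint_kernel]. *)
Theorem cauchy_formula f (w : C) r : (forall z, normc z < 1 -> cdifferentiable f z) ->
  normc w < r < 1 ->
  cint leb circ (fun t => f (RtoC r * cis t) * (RtoC r * cis t / (RtoC r * cis t - w))) =
  f w * RtoC (2 * pi).
Proof.
move=> Hf /andP[wr r1]; have w0 := normc_ge0 w; have r0 : 0 <= r by lra.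
have [|A HA] := Hf w; first lra.
(* The value at [w] is the limit of the quotient, [A] being the derivative of f at [w]. *)
pose H z := if z == w then w * A else z * (f z - f w) / (z - w).
have Hn z : z != w -> H z = z * (f z - f w) / (z - w) by move=> /negbTE zw; rewrite /H zw.
have Hdiff z : normc z < 1 -> z != w -> cdifferentiable H z.
  move=> z1 zw; have [B HB] := Hf z z1; have [K HK] := cdiff_kernel zw.
  have h : cdiff (fun x => f x - f w) z (B + 0) by apply: cdiffD => //; exact: cdiff_cst.
  eexists; apply: (cdiff_local (d := normc (z - w))); last exact: (cdiffM h HK).
    by rewrite normc_gt0 subr_eq0.
  move=> x xz; rewrite Hn; first by ring.
  by apply/negP => /eqP xw; move: xz; rewrite xw normcB ltxx.
have Hc z : normc z < 1 -> ccont H z.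
  move=> z1; have [->|zw] := eqVneq z w; last by have [B HB] := Hdiff z z1 zw; exact: cdiff_cont HB.
  move=> e e0; have A0 := normc_ge0 A.
  have e20 : 0 < e / 4 by lra.
  have [d d0 Hd] := HA _ e20.
  exists (Num.min d (Num.min 1 (e / (2 * (normc A + 1))))).
    by rewrite !lt_min d0 ltr01 divr_gt0//; lra.
  move=> x; rewrite !lt_min => /andP[xd /andP[x1 xe]].
  have -> : H w = w * A by rewrite /H eqxx.
  have [->|xw] := eqVneq x w; first by rewrite /H eqxx subrr normc0; lra.
  have xw0 : x - w != 0 by rewrite subr_eq0.
  have xwp : 0 < normc (x - w) by rewrite normc_gt0.
  rewrite Hn//.
  have -> : x * (f x - f w) / (x - w) - w * A = x * ((f x - f w - A * (x - w)) / (x - w)) + (x - w) * A by field.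
  apply: le_trans (le_normcD _ _) _; rewrite !normcM normcV.
  have := Hd _ xd; rewrite [w + _]addrC subrK -ler_pdivrMr// => q.
  have nx : normc x <= 2.
    by have := le_normcD (x - w) w; rewrite subrK; lra.
  have : normc x * (normc (f x - f w - A * (x - w)) / normc (x - w)) <= 2 * (e / 4).
    by apply: ler_pM; rewrite ?normc_ge0 ?divr_ge0 ?normc_ge0.
  move: xe; rewrite ltr_pdivlMr; [|lra].
  nra.
have := @circle_mean_value H (normc w) Hc _ r.
have -> : H 0 = 0.
  by rewrite /H; case: eqP => [<-|_]; rewrite ?mul0r ?mul0r.
rewrite mul0r => /(_ _ _) mv.
have {}mv : cint leb circ (fun t => H (RtoC r * cis t)) = 0.
  apply: mv; last by rewrite r0.
  move=> z /andP[_ z1] zw; apply: Hdiff => //.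
  by apply/negP => /eqP E; move: zw; rewrite E eqxx.
have i2 : cintegrable leb circ (fun t => RtoC r * cis t / (RtoC r * cis t - w)).
  apply: (@circle_cintegrable (fun z => z / (z - w))) => t.
  by have [K HK] := cdiff_kernel (circle_neq t wr); exact: cdiff_cont HK.
have i1 : cintegrable leb circ (fun t => f (RtoC r * cis t) * (RtoC r * cis t / (RtoC r * cis t - w))).
  apply: (@circle_cintegrable (fun z => f z * (z / (z - w)))) => t.
  have [K HK] := cdiff_kernel (circle_neq t wr).
  have [|B HB] := Hf (RtoC r * cis t); first by rewrite normc_circle.
  exact: (cdiff_cont (cdiffM HB HK)).
rewrite -(cint_kernel wr) -cintZ//; apply/eqP; rewrite -subr_eq0 -cintB//; last exact: cintegrableZ.
rewrite -mv; apply/eqP/eq_cint => t _; rewrite Hn ?circle_neq//; ring.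
Qed.

End Circle.

(** * Scalar multiples, real powers and nonnegative integrals *)

Lemma integrable_EFinZl d (T : measurableType d) (R : realType) (mu : {measure set T -> \bar R})
  (D : set T) (r : R) (f : T -> R) : measurable D ->
  mu.-integrable D (EFin \o f) -> mu.-integrable D (EFin \o (fun x => r * f x)).
Proof. by move=> mD fi; move: (integrableZl mD r fi); apply: eq_integrable. Qed.

Lemma powR_invE (R : realType) (x a : R) : 0 <= x -> x^-1 `^ a = x `^ (- a).
Proof. by move=> x0; rewrite -(powR_inv1 x0) -powRrM mulN1r. Qed.

Section NonnegativeIntegral.
Context d (T : measurableType d) (R : realType) (mu : {measure set T -> \bar R}).

Lemma ge0_integrable (A : set T) (h : T -> R) (M : R) : measurable A -> measurable_fun A h ->
  (forall t, A t -> 0 <= h t) -> (\int[mu]_(t in A) (h t)%:E <= M%:E)%E ->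
  mu.-integrable A (EFin \o h).
Proof.
move=> mA mh h0 hM; apply/integrableP; split; first exact/measurable_EFinP.
rewrite (eq_integral (fun t => (h t)%:E)).
  by apply: le_lt_trans hM _; exact: ltry.
by move=> t /[!inE] At /=; rewrite ger0_norm// h0.
Qed.

Lemma ge0_Rintegral_le (A : set T) (h : T -> R) (M : R) :
  (forall t, A t -> 0 <= h t) -> (\int[mu]_(t in A) (h t)%:E <= M%:E)%E ->
  Rintegral mu A h <= M.
Proof.
move=> h0 hM; have : (0 <= \int[mu]_(t in A) (h t)%:E)%E by apply: integral_ge0 => t At; rewrite lee_fin h0.
by move: hM; rewrite /Rintegral; case: integral => [x| |]//=; rewrite lee_fin.
Qed.

End NonnegativeIntegral.

(** * Growth, Taylor and Lipschitz estimates from Cauchy's formula *)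

Section Growth.
Variable R : realType.
Local Notation C := R[i].
Local Notation leb := (@lebesgue_measure R).
Local Notation circ := (`[0, 2 * pi]%classic : set R).
Implicit Types (f : C -> C) (r s t : R).
Local Notation holo f := (forall z : C, normc z < 1 -> cdifferentiable f z).

Lemma pcont_normc (h : R -> C) t : pcont h t -> {for t, continuous (fun s => normc (h s))}.
Proof.
move=> H; apply/cvgrPdist_le => e e0; have [d d0 Hd] := H e e0.
exists d => //= s; rewrite /ball_/= distrC => /Hd; apply: le_trans.
rewrite ler_norml; have := lerB_normc (h t) (h s); have := lerB_normc (h s) (h t).
by rewrite (normcB (h t)) => ? ?; apply/andP; split; lra.
Qed.

Lemma circle_pcont f r t : holo f -> 0 <= r < 1 -> pcont (fun t => f (RtoC r * cis t)) t.
Proof.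
move=> hf /andP[r0 r1]; apply: (@pcont_comp _ f (fun s => RtoC r * cis s)); first exact: pcont_circle.
by have [|A HA] := hf (RtoC r * cis t); [rewrite normc_circle|exact: cdiff_cont HA].
Qed.

Lemma continuous_itv_integrable (g : R -> R) a b : (forall t, {for t, continuous g}) ->
  leb.-integrable `[a, b] (EFin \o g).
Proof.
move=> H; apply: continuous_compact_integrable; first exact: segment_compact.
exact: continuous_subspaceT.
Qed.

Lemma circle_normc_continuous f r t : holo f -> 0 <= r < 1 ->
  {for t, continuous (fun t => normc (f (RtoC r * cis t)))}.
Proof. by move=> hf r01; apply: pcont_normc; exact: circle_pcont. Qed.

(** The kernel is at most r / (r - |w|) with r < 1, and dividing by 2 pi more than absorbs the 2 of
    [normc_cint_le]. *)
Lemma cauchy_le f (w : C) r : holo f -> normc w < r < 1 ->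
  normc (f w) <= (r - normc w)^-1 * Rintegral leb circ (fun t => normc (f (RtoC r * cis t))).
Proof.
move=> hf /[dup] wr1 /andP[wr r1]; have w0 := normc_ge0 w; have r0 : 0 <= r by lra.
have r01 : 0 <= r < 1 by rewrite r0.
have rw : 0 < r - normc w by lra.
have ni : leb.-integrable circ (EFin \o (fun t => normc (f (RtoC r * cis t)))).
  by apply: continuous_itv_integrable => t; exact: circle_normc_continuous.
set I := Rintegral _ _ _.
have I0 : 0 <= I by apply: Rintegral_ge0 => t _; exact: normc_ge0.
have pi1 : 1 <= pi :> R by have := pi_ge2 R; lra.
have : normc (f w * RtoC (2 * pi)) <= 2 * ((r - normc w)^-1 * I).
  rewrite -(cauchy_formula hf wr1) /I -RintegralZl//.
  apply: normc_cint_le => //.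
  - apply: (@circle_cintegrable _ (fun z => f z * (z / (z - w)))) => t.
    have [K HK] := cdiff_kernel (circle_neq t wr).
    have [|B HB] := hf (RtoC r * cis t); first by rewrite normc_circle.
    exact: (cdiff_cont (cdiffM HB HK)).
  - exact: integrable_EFinZl.
  - move=> t _; rewrite normcM mulrC; apply: ler_wpM2r; first exact: normc_ge0.
    apply: le_trans (normc_kernel t wr r0) _.
    by rewrite -[leRHS]mul1r; apply: ler_wpM2r; [rewrite invr_ge0|]; lra.
rewrite normcM normc_RtoC ger0_norm; last lra.
set q := (_^-1 * I); have : 0 <= q by rewrite mulr_ge0// invr_ge0 ltW.
have := normc_ge0 (f w); nra.
Qed.

Lemma holo_bounded f r : holo f -> r < 1 ->
  exists2 M : R, 0 <= M & forall z, normc z <= r -> normc (f z) <= M.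
Proof.
move=> hf r1; pose r' := (1 + Num.max r 0) / 2.
have m1 : Num.max r 0 < 1 by rewrite gt_max r1 ltr01.
have m2 : r <= Num.max r 0 by rewrite le_max lexx.
have m3 : 0 <= Num.max r 0 by rewrite le_max lexx orbT.
set I := Rintegral leb circ (fun t => normc (f (RtoC r' * cis t))).
have I0 : 0 <= I by apply: Rintegral_ge0 => t _; exact: normc_ge0.
have rr' : 0 < r' - r by rewrite /r'; lra.
exists ((r' - r)^-1 * I); first by rewrite mulr_ge0 ?invr_ge0// ltW.
move=> z zr; apply: le_trans (cauchy_le hf (_ : normc z < r' < 1)) _.
  by apply/andP; split; rewrite /r'; lra.
by apply: ler_wpM2r => //; rewrite lef_pV2 ?posrE//; lra.
Qed.

(* Let N be the supremum of |f|^q (rho - |w|) over |w| <= rho. Near a point where it is almost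
   attained, |f| <= C |f(w)|, so writing |f| = |f|^(1-q) |f|^q in Cauchy's formula bounds N by M. *)
Lemma holo_growth_le1 f (q M : R) : holo f -> 0 < q <= 1 -> 0 <= M ->
  (forall r, 0 <= r < 1 ->
     (\int[leb]_(t in circ) ((normc (f (RtoC r * cis t))) `^ q)%:E <= M%:E)%E) ->
  forall z, normc z < 1 -> normc (f z) `^ q * (1 - normc z) <= 4 * 4 `^ q^-1 * M.
Proof.
move=> hf /andP[q0 q1] M0 HM z z1; set K := 4 * 4 `^ q^-1 * M.
have c0 : 0 < 4 `^ q^-1 :> R by rewrite powR_gt0.
have K0 : 0 <= K by rewrite /K !mulr_ge0// ltW.
(* Stopping at [rho < 1] makes the supremum finite through [holo_bounded]; the choice of [dl] then
   lets [rho] tend to 1 at a cost of at most e. *)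
suff key rho : 0 <= rho < 1 -> normc z <= rho -> normc (f z) `^ q * (rho - normc z) <= K.
  have z0 := normc_ge0 z; have p0 := powR_ge0 (normc (f z)) q.
  apply/ler_addgt0Pr => e e0.
  pose dl := Num.min (1 - normc z) (e / (normc (f z) `^ q + 1)).
  have dl0 : 0 < dl by rewrite lt_min divr_gt0//; lra.
  have dl1 : dl <= 1 - normc z by rewrite ge_min lexx.
  have dle : dl * (normc (f z) `^ q + 1) <= e.
    by rewrite -ler_pdivlMr; [rewrite ge_min lexx orbT|lra].
  have := key (1 - dl) ; move=> /(_ ltac:(lra) ltac:(lra)); nra.
move=> /[dup] rho01 /andP[rho0 rho1] zrho.
pose E := [set normc (f w) `^ q * (rho - normc w) | w in [set w : C | normc w <= rho]].
have [B B0 HB] := holo_bounded hf rho1.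
have supE : has_sup E.
  split; first by exists (normc (f z) `^ q * (rho - normc z)); exists z.
  exists (B `^ q * rho) => _ [w /= wr <-]; have w0 := normc_ge0 w.
  apply: ler_pM; rewrite ?powR_ge0//; [lra| |lra].
  by apply: ge0_ler_powR; rewrite ?nnegrE ?normc_ge0//; [exact: ltW|exact: HB].
have ubE w : normc w <= rho -> normc (f w) `^ q * (rho - normc w) <= sup E.
  by move=> wr; apply: ub_le_sup; [exact: supE.2|exists w].
apply: le_trans (ubE _ zrho) _.
have [N0|N0] := leP (sup E) 0; first exact: le_trans N0 K0.
set N := sup E in N0 ubE *.
have N20 : 0 < N / 2 by lra.
have [_ [w /= wr <-] wN] := sup_adherent N20 supE.
rewrite -/N in wN; have {}wN : N / 2 < normc (f w) `^ q * (rho - normc w) by lra.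
set x := normc (f w) in wN *; set d := rho - normc w in wN *.
have w0 := normc_ge0 w; have x0 : 0 <= x := normc_ge0 _.
have xq0 : 0 <= x `^ q := powR_ge0 _ _.
have d0 : 0 < d.
  rewrite lt_def; apply/andP; split; last by rewrite /d; lra.
  by apply/negP => /eqP d0; rewrite d0 mulr0 in wN; lra.
have xp : 0 < x.
  rewrite lt_def x0 andbT; apply/negP => /eqP x00; rewrite x00 powR0 ?gt_eqF// mul0r in wN; lra.
(* On the circle halfway between |w| and [rho] the distance to [rho] is d / 2, so there |f|^q <= N /
   (d / 2) <= 4 |f(w)|^q. *)
pose r := normc w + d / 2.
have r01 : 0 <= r < 1 by clear -w0 d0 rho1; rewrite /r /d in d0 *; apply/andP; split; lra.
have fb t : normc (f (RtoC r * cis t)) <= 4 `^ q^-1 * x.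
  have /ubE : normc (RtoC r * cis t) <= rho by rewrite normc_circle; case/andP: r01 => // ? ?; rewrite /r /d; lra.
  rewrite normc_circle; last by case/andP: r01.
  have -> : rho - r = d / 2 by rewrite /r /d; lra.
  move=> h; set y := normc _ in h *.
  have y0 : 0 <= y := normc_ge0 _.
  have yx : y `^ q <= 4 * x `^ q by nra.
  have -> : y = (y `^ q) `^ q^-1 by rewrite -powRrM divff ?gt_eqF// powRr1.
  have -> : x = (x `^ q) `^ q^-1 by rewrite -powRrM divff ?gt_eqF// powRr1.
  rewrite -powRM//; apply: ge0_ler_powR; rewrite ?nnegrE ?invr_ge0 ?powR_ge0//; first exact: ltW.
  by rewrite mulr_ge0.
set c := 4 `^ q^-1 in c0 fb K K0 *.
have c1 : 1 <= c.
  by rewrite /c -[leLHS](powRr0 4); apply: ler_powR; rewrite ?invr_ge0; lra.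
have mes : measurable_fun circ (fun t => normc (f (RtoC r * cis t))).
  have : leb.-integrable circ (EFin \o (fun t => normc (f (RtoC r * cis t)))).
    by apply: continuous_itv_integrable => t; exact: circle_normc_continuous.
  by move=> /measurable_int/measurable_EFinP.
have mesq : measurable_fun circ (fun t => normc (f (RtoC r * cis t)) `^ q).
  exact: (measurableT_comp (measurable_powR q) mes).
have Ib : Rintegral leb circ (fun t => normc (f (RtoC r * cis t))) <= (c * x) `^ (1 - q) * M.
  apply: ge0_Rintegral_le; first by move=> t _; exact: normc_ge0.
  have p0 : 0 <= (c * x) `^ (1 - q) := powR_ge0 _ _.
  apply: (@le_trans _ _ (\int[leb]_(t in circ) (((c * x) `^ (1 - q))%:E * (normc (f (RtoC r * cis t)) `^ q)%:E))%E).
    apply: ge0_le_integral => //.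
    - by move=> t _; rewrite lee_fin normc_ge0.
    - exact/measurable_EFinP.
    - apply/measurable_EFinP; exact: (measurable_funM (measurable_cst _) mesq).
    - move=> t _; rewrite -EFinM lee_fin; set y := normc _.
      have y0 : 0 <= y := normc_ge0 _.
      rewrite [leLHS](_ : y = y `^ (1 - q) * y `^ q); last first.
        by rewrite -powRD ?subrK ?powRr1// oner_eq0.
      apply: ler_wpM2r; first exact: powR_ge0.
      apply: ge0_ler_powR; rewrite ?nnegrE//; [lra|by rewrite mulr_ge0// ltW|exact: fb].
  rewrite ge0_integralZl_EFin//; last exact/measurable_EFinP.
    by rewrite EFinM; apply: lee_wpmul2l; rewrite ?lee_fin//; exact: HM.
  by move=> t _; rewrite lee_fin powR_ge0.
have dE : d = rho - normc w by [].
clear fb mes mesq HM K0 supE ubE B HB B0 N20 zrho wr.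
have wr1 : normc w < r < 1 by rewrite /r; apply/andP; split; lra.
have := cauchy_le hf wr1.
have -> : r - normc w = d / 2 by rewrite /r; lra.
move=> h.
have {h}h : x * d <= 2 * ((c * x) `^ (1 - q) * M).
  have : x <= (d / 2)^-1 * ((c * x) `^ (1 - q) * M).
    by apply: le_trans h _; apply: ler_wpM2l => //; rewrite invr_ge0; lra.
  by rewrite mulrC ler_pdivlMr; lra.
have xq : 0 < x `^ q by rewrite powR_gt0.
have E1 : x = x `^ (1 - q) * x `^ q by rewrite -powRD ?subrK ?powRr1// oner_eq0.
have E2 : (c * x) `^ (1 - q) = c `^ (1 - q) * x `^ (1 - q) by rewrite powRM// ltW.
have x1q : 0 < x `^ (1 - q) by rewrite powR_gt0.
have cc : c `^ (1 - q) <= c by apply: ler1_powR => //; lra.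
have h2 : x `^ q * d <= 2 * (c `^ (1 - q) * M).
  rewrite -(ler_pM2l x1q); move: h; rewrite {1}E1 E2; lra.
have : c `^ (1 - q) * M <= c * M by exact: ler_wpM2r.
rewrite /K; lra.
Qed.

(** For finite p, take an integer m > p: the power F = f^m is holomorphic and |F|^(p/m) = |f|^p, so
    the case of an exponent at most 1 applies to F. *)
Theorem hardy_growth (p : \bar R) f : (0 < p)%E -> hardy p f ->
  exists2 K : R, 0 <= K & forall z, normc z < 1 -> normc (f z) <= K * (1 - normc z) `^ (- invp p).
Proof.
case: p => [p| |]//=; last first.
  move=> _ [hf [M HM]]; exists (Num.max M 0); first by rewrite le_max lexx orbT.
  by move=> z z1; rewrite oppr0 powRr0 mulr1; apply: le_trans (HM z z1) _; rewrite le_max lexx.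
rewrite lte_fin => p0 [/analytic_cdiffP hf [M HM]].
pose m := Num.bound p; have pm : p < m%:R by rewrite archi_boundP// ltW.
have m0 : 0 < m%:R :> R by exact: lt_trans pm.
pose F z := f z ^+ m.
have hF : holo F by move=> z z1; have [A HA] := hf z z1; exact: cdiffX HA.
have FE z : normc (F z) `^ (p / m%:R) = normc (f z) `^ p.
  rewrite /F normcX -powR_mulrn ?normc_ge0// -powRrM; congr powR.
  by field; rewrite gt_eqF.
have M0 : 0 <= M.
  have := HM 0 ltac:(by rewrite lexx ltr01); rewrite -lee_fin; apply: le_trans.
  by apply: integral_ge0 => t _; rewrite lee_fin powR_ge0.
have q01 : 0 < p / m%:R <= 1 by rewrite divr_gt0//= ler_pdivrMr// mul1r ltW.
have HFM r : 0 <= r < 1 ->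
     (\int[leb]_(t in circ) ((normc (F (RtoC r * cis t))) `^ (p / m%:R))%:E <= M%:E)%E.
  by move=> /HM; rewrite /pitv add0r; under eq_integral do rewrite -FE; exact.
have := holo_growth_le1 hF q01 M0 HFM.
set K := 4 * _ * M => HK; have K0 : 0 <= K by rewrite /K !mulr_ge0// powR_ge0.
exists (K `^ p^-1); first exact: powR_ge0.
move=> z z1; have zp : 0 < 1 - normc z by lra.
have := HK z z1; rewrite FE -ler_pdivlMr// => h.
have -> : normc (f z) = (normc (f z) `^ p) `^ p^-1.
  by rewrite -powRrM divff ?gt_eqF// powRr1// normc_ge0.
have zp' := ltW zp; rewrite -powR_invE// -powRM ?invr_ge0//.
apply: ge0_ler_powR; rewrite ?nnegrE ?invr_ge0 ?powR_ge0//; first exact: ltW.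
by rewrite mulr_ge0// invr_ge0.
Qed.

(** Two steps of the geometric expansion, z / (z - u) = 1 + u / z + u^2 / (z (z - u)), in Cauchy's
    formula on |z| = 3/4, where |z - u| >= 1/4. The constants 3 and 11 round up 8/3 and 32/3. *)
Lemma holo_taylor0 f (S : R) : holo f -> (forall z, normc z < 1 -> normc (f z) <= S) ->
  exists a, normc a <= 3 * S /\
    forall u, normc u <= 1 / 2 -> normc (f u - f 0 - a * u) <= 11 * S * normc u ^+ 2.
Proof.
move=> hf fS; pose r : R := 3 / 4.
have r0 : 0 < r by rewrite /r; lra.
have r01 : 0 <= r < 1 by rewrite /r; apply/andP; split; lra.
have pi0 := pi_gt0 R.
have S0 : 0 <= S by apply: le_trans (normc_ge0 _) (fS 0 _); rewrite normc0.
have nz t : RtoC r * cis t != 0 by apply: circle_neq; rewrite normc0.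
have nzn t : normc (RtoC r * cis t) = r by apply: normc_circle; rewrite ltW.
have p2 : RtoC (2 * pi) != 0 :> C by rewrite -normc_eq0 normc_RtoC gt_eqF// normr_gt0 gt_eqF//; lra.
have np2 : normc (RtoC (2 * pi) : C) = 2 * pi by rewrite normc_RtoC ger0_norm//; lra.
pose a := cint leb circ (fun t => f (RtoC r * cis t) / (RtoC r * cis t)) / RtoC (2 * pi).
have ii g : (forall t, cdifferentiable g (RtoC r * cis t)) -> cintegrable leb circ (fun t => g (RtoC r * cis t)).
  by move=> H; apply: circle_cintegrable => t; have [A HA] := H t; exact: cdiff_cont HA.
have fd t : cdifferentiable f (RtoC r * cis t) by apply: hf; rewrite nzn /r; lra.
have ia : cintegrable leb circ (fun t => f (RtoC r * cis t) / (RtoC r * cis t)).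
  apply: (ii (fun z => f z / z)) => t; have [A HA] := fd t.
  by eexists; exact: (cdiffM HA (@cdiffV _ (fun z => z) _ _ (nz t) (cdiff_id _))).
have fb t : normc (f (RtoC r * cis t)) <= S by apply: fS; rewrite nzn /r; lra.
exists a; split.
  rewrite /a normcM normcV np2 ler_pdivrMr; last lra.
  apply: le_trans (normc_cint_itv_le (B := S / r) (twopi_ge0 R) ia _) _.
    by move=> t _; rewrite normcM normcV nzn; apply: ler_wpM2r; rewrite ?invr_ge0 ?fb// ltW.
  rewrite subr0 /r; have : 0 <= S * pi by rewrite mulr_ge0// ltW.
  have -> : 2 * (S / (3 / 4) * (2 * pi)) = 16 / 3 * (S * pi) by field.
  lra.
move=> u u12; have ur : normc u < r by rewrite /r; lra.
have unz t : RtoC r * cis t - u != 0 by rewrite subr_eq0 circle_neq.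
have iu : cintegrable leb circ (fun t => f (RtoC r * cis t) * (RtoC r * cis t / (RtoC r * cis t - u))).
  apply: (ii (fun z => f z * (z / (z - u)))) => t; have [A HA] := fd t.
  have [K HK] := cdiff_kernel (circle_neq t ur).
  by eexists; exact: (cdiffM HA HK).
have i0 : cintegrable leb circ (fun t => f (RtoC r * cis t) * (RtoC r * cis t / (RtoC r * cis t - 0))).
  apply: (ii (fun z => f z * (z / (z - 0)))) => t; have [A HA] := fd t.
  have [K HK] := cdiff_kernel (nz t).
  by eexists; exact: (cdiffM HA HK).
have E : (f u - f 0 - a * u) * RtoC (2 * pi) =
    cint leb circ (fun t => f (RtoC r * cis t) * (u ^+ 2 / (RtoC r * cis t * (RtoC r * cis t - u)))).
  rewrite !mulrBl -(cauchy_formula hf (_ : normc u < r < 1)); last by rewrite ur /r; lra.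
  rewrite -(cauchy_formula hf (_ : normc 0 < r < 1)); last by rewrite normc0 r0 /r; lra.
  have -> : a * u * RtoC (2 * pi) = u * cint leb circ (fun t => f (RtoC r * cis t) / (RtoC r * cis t)).
    by rewrite /a; field.
  rewrite -cintZ// -cintB// -cintB//; [|exact: cintegrableB|exact: cintegrableZ].
  apply: eq_cint => t _; rewrite subr0; have := unz t; have := nz t.
  by set x := _ * cis t => x0 xu; field; rewrite x0 xu.
have := normc_cint_itv_le (B := S * (normc u ^+ 2 / (r * (1 / 4)))) (twopi_ge0 R)
   (_ : cintegrable leb circ (fun t => f (RtoC r * cis t) * (u ^+ 2 / (RtoC r * cis t * (RtoC r * cis t - u))))).
rewrite -E normcM np2 => H.
have {H} : normc (f u - f 0 - a * u) * (2 * pi) <= 2 * (S * (normc u ^+ 2 / (r * (1 / 4))) * (2 * pi - 0)).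
  apply: H.
    apply: (ii (fun z => f z * (u ^+ 2 / (z * (z - u))))) => t; have [A HA] := fd t.
    have nn : RtoC r * cis t * (RtoC r * cis t - u) != 0 by rewrite mulf_neq0.
    have d1 := cdiffM (cdiff_id (RtoC r * cis t)) (cdiffD (cdiff_id (RtoC r * cis t)) (cdiff_cst (- u) _)).
    have d2 := @cdiffV _ (fun z => z * (z - u)) _ _ nn d1.
    by eexists; exact: (cdiffM HA (cdiffM (cdiff_cst (u ^+ 2) _) d2)).
  move=> t _; rewrite !normcM normcV normcM nzn.
  apply: ler_pM; rewrite ?normc_ge0 ?fb//.
    by rewrite mulr_ge0 ?mulr_ge0 ?invr_ge0 ?mulr_ge0 ?normc_ge0// ltW.
  rewrite -expr2; apply: ler_wpM2l; first exact: sqr_ge0.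
  have := lerB_normc (RtoC r * cis t) u; rewrite nzn => q.
  have q2 : 1 / 4 <= normc (RtoC r * cis t - u) by move: q; rewrite /r; lra.
  rewrite lef_pV2 ?posrE; [|by rewrite mulr_gt0//; lra..].
  by apply: ler_wpM2l => //; exact: ltW.
have -> : 2 * (S * (normc u ^+ 2 / (r * (1 / 4))) * (2 * pi - 0)) = 32 / 3 * S * normc u ^+ 2 * (2 * pi).
  by rewrite /r; field; lra.
rewrite ler_pM2r; last lra.
move=> h; apply: le_trans h _; apply: ler_wpM2r; first exact: sqr_ge0.
by apply: ler_wpM2r => //; lra.
Qed.

Lemma holo_taylor f (z0 : C) (rho S : R) : 0 < rho ->
  (forall z, normc (z - z0) < rho -> cdifferentiable f z) ->
  (forall z, normc (z - z0) < rho -> normc (f z) <= S) ->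
  exists a, normc a <= 3 * S / rho /\
    forall h, normc h <= rho / 2 -> normc (f (z0 + h) - f z0 - a * h) <= 11 * S * (normc h / rho) ^+ 2.
Proof.
move=> rho0 hf fS; pose g u := f (z0 + RtoC rho * u).
have nr : normc (RtoC rho : C) = rho by rewrite normc_RtoC gtr0_norm.
have rn0 : RtoC rho != 0 :> C by rewrite -normc_gt0 nr.
have lt u : normc u < 1 -> normc (z0 + RtoC rho * u - z0) < rho.
  by move=> u1; rewrite (addrC z0) addrK normcM nr -[ltRHS]mulr1 ltr_pM2l.
have hg : holo g.
  by move=> u u1; have [A HA] := hf _ (lt u u1); eexists; exact: cdiff_affine HA.
have [a [aS Ha]] := @holo_taylor0 g S hg (fun u u1 => fS _ (lt u u1)).
exists (a / RtoC rho); split.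
  by rewrite normcM normcV nr; apply: ler_wpM2r => //; rewrite invr_ge0 ltW.
move=> h hr; have nh : normc (h / RtoC rho) = normc h / rho by rewrite normcM normcV nr.
have := Ha (h / RtoC rho); rewrite nh ler_pdivrMr// => /(_ ltac:(lra)).
by rewrite /g mulr0 addr0 mulrCA divff// mulr1 mulrA mulrAC.
Qed.

(** If |z - w| <= (1-t)/4, the Taylor estimate on the disc of radius rho = (1-t)/2 about z applies,
    since 1 - |x| >= rho in that disc. Otherwise the triangle inequality suffices, |z - w| / (1-t)
    being bounded below. The 18 is (3 + 11/2) rounded up to 9, doubled by 1 / rho = 2 / (1-t). *)
Lemma holo_lipschitz f (K g t : R) (z w : C) : holo f -> 0 <= K -> 0 <= g ->
  (forall z, normc z < 1 -> normc (f z) <= K * (1 - normc z) `^ (- g)) ->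
  t < 1 -> normc z <= t -> normc w <= t ->
  normc (f z - f w) <= 18 * K * 2 `^ g * (1 - t) `^ (- (g + 1)) * normc (z - w).
Proof.
move=> hf K0 g0 fK t1 zt wt.
pose rho := (1 - t) / 2; have rho0 : 0 < rho by rewrite /rho; lra.
have tp : 0 < 1 - t by lra.
have z0 := normc_ge0 z.
set P := (1 - t) `^ (- g).
have P0 : 0 < P by rewrite powR_gt0.
have c0 : 0 < 2 `^ g :> R by rewrite powR_gt0.
have c1 : 1 <= 2 `^ g :> R by rewrite -[leLHS](powRr0 2); apply: ler_powR => //; lra.
have PE : (1 - t) `^ (- (g + 1)) = P / (1 - t).
  rewrite opprD powRD; last by rewrite (gt_eqF tp) implybT.
  by rewrite powR_inv1// ltW.
have mono x : normc x < 1 -> forall s, 0 < s -> s <= 1 - normc x -> normc (f x) <= K * s `^ (- g).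
  move=> x1 s s0 sx; apply: le_trans (fK x x1) _; apply: ler_wpM2l => //.
  rewrite !powRN lef_pV2 ?posrE ?powR_gt0//; last lra.
  by apply: ge0_ler_powR; rewrite ?nnegrE//; lra.
have nzw := normc_ge0 (z - w).
have PP : 0 <= K * P by rewrite mulr_ge0// ltW.
have inR x : normc (x - z) < rho -> normc x < 1 /\ rho <= 1 - normc x.
  by move=> xz; have := le_normcD (x - z) z; rewrite subrK /rho in xz *; split; lra.
have [zw|zw] := leP (normc (w - z)) (rho / 2).
  have [a [aS Ha]] := @holo_taylor f z rho (K * rho `^ (- g)) rho0
    (fun x xz => hf x (inR x xz).1) (fun x xz => mono x (inR x xz).1 _ rho0 (inR x xz).2).
  have := Ha _ zw; rewrite [z + _]addrC subrK => {}Ha.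
  have PR : rho `^ (- g) = 2 `^ g * P.
    rewrite /rho powRM ?ltW ?invr_gt0// mulrC; congr (_ * _).
    by rewrite -powR_inv1// -powRrM mulN1r opprK.
  set S := K * rho `^ (- g) in aS Ha.
  have S0 : 0 <= S by rewrite mulr_ge0// powR_ge0.
  have : normc (f w - f z) <= 3 * S / rho * normc (w - z) + 11 * S * (normc (w - z) / rho) ^+ 2.
    have -> : f w - f z = a * (w - z) + (f w - f z - a * (w - z)) by ring.
    apply: le_trans (le_normcD _ _) _; apply: lerD => //.
    by rewrite normcM; apply: ler_wpM2r; rewrite ?normc_ge0.
  have : (normc (w - z) / rho) ^+ 2 <= 1 / 2 * (normc (w - z) / rho).
    rewrite expr2; apply: ler_wpM2r; first by rewrite divr_ge0 ?normc_ge0// ltW.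
    by rewrite ler_pdivrMr//; lra.
  move=> h1 h2; rewrite normcB; apply: le_trans h2 _.
  have h3 : 11 * S * (normc (w - z) / rho) ^+ 2 <= 11 * S * (1 / 2 * (normc (w - z) / rho)).
    by apply: ler_wpM2l => //; rewrite mulr_ge0.
  rewrite PE (normcB z) /S PR in h3 *.
  have -> : 18 * K * 2 `^ g * (P / (1 - t)) * normc (w - z) = 9 * (K * (2 `^ g * P)) * (normc (w - z) / rho).
    by rewrite /rho; field; lra.
  have : 0 <= K * (2 `^ g * P) * (normc (w - z) / rho).
    by rewrite !mulr_ge0 ?invr_ge0 ?normc_ge0// ltW.
  lra.
apply: le_trans (ler_normcB _ _) _.
have b1 : normc (f z) <= K * P by apply: mono => //; lra.
have b2 : normc (f w) <= K * P by apply: mono => //; lra.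
rewrite PE.
have h4 : (1 - t) / 4 < normc (z - w) by rewrite normcB; move: zw; rewrite /rho; lra.
have h5 : 1 <= 4 * (normc (z - w) / (1 - t)) by rewrite mulrA ler_pdivlMr//; lra.
have -> : 18 * K * 2 `^ g * (P / (1 - t)) * normc (z - w) = 18 * 2 `^ g * (K * P) * (normc (z - w) / (1 - t)) by field; lra.
have h6 : 18 * 1 * (K * P) * (1 / 4) <= 18 * 2 `^ g * (K * P) * (normc (z - w) / (1 - t)).
  by apply: ler_pM; [lra|lra|apply: ler_wpM2r => //; apply: ler_wpM2l|lra].
lra.
Qed.

End Growth.

Lemma eq_ler (R : realType) (x y : R) : x = y -> x <= y.
Proof. by move=> ->. Qed.

(** * Dyadic layers, and holomorphy of parameter integrals *)

Section LayerCake.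
Context d (T : measurableType d) (R : realType) (mu : {measure set T -> \bar R}).
Implicit Types (D : set T) (phi : T -> R).

Lemma nneseries_geometric_le (a q : R) : 0 <= a -> 0 <= q < 1 ->
  (\sum_(0 <= n <oo) (a * q ^+ n)%:E <= (a / (1 - q))%:E)%E.
Proof.
move=> a0 /andP[q0 q1]; apply: lime_le.
  by apply: is_cvg_nneseries => n _ _; rewrite lee_fin mulr_ge0// exprn_ge0.
apply: nearW => n; rewrite sumEFin lee_fin.
have := congr1 (fun s => s n) (geometric_seriesE a (_ : q != 1)).
rewrite /series /geometric /= => -> //; last by rewrite lt_eqF.
apply: ler_wpM2r; first by rewrite invr_ge0; lra.
rewrite -[leRHS]mulr1; apply: ler_wpM2l => //.
by have := exprn_ge0 n q0; lra.
Qed.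

Lemma nneseries_ge_term (u : nat -> \bar R) n : (forall k, (0 <= u k)%E) ->
  (u n <= \sum_(0 <= k <oo) u k)%E.
Proof.
move=> u0; apply: le_trans (nneseries_lim_ge n.+1 (fun k _ _ => u0 k)).
rewrite big_nat_recr//=; apply: leeDr.
by apply: sume_ge0.
Qed.

(* Points with [phi x = 0] do not contribute, since [0 `^ (- b) = 0]. *)
Lemma layer_cake D phi (b a q : R) (u v m : nat -> R) : measurable D -> measurable_fun D phi ->
  0 < b -> 0 <= a -> 0 <= q < 1 -> (forall n, 0 < u n) -> (forall n, 0 <= m n) ->
  (forall x, D x -> phi x != 0 -> exists n, u n <= phi x <= v n) ->
  (forall n, (mu (D `&` [set x | (phi x <= v n)%R]) <= (m n)%:E)%E) ->
  (forall n, (u n) `^ (- b) * m n <= a * q ^+ n) ->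
  (\int[mu]_(x in D) ((phi x) `^ (- b))%:E <= (a / (1 - q))%:E)%E.
Proof.
move=> mD mphi b0 a0 q01 u0 m0 cover mE bound.
pose E n := D `&` [set x | (phi x <= v n)%R].
have mE' n : measurable (E n) by apply: measurable_fun_le => //; exact: measurable_cst.
have mp : measurable_fun D (fun x => (phi x) `^ (- b)).
  exact: (measurableT_comp (measurable_powR (- b)) mphi).
(* The sets [E n] are sublevel sets and overlap, which only enlarges the sum: a point with
   [u n <= phi x <= v n] is already covered by its n-th term. *)
pose g n x := ((u n `^ (- b)) * \1_(E n) x)%:E : \bar R.
have g0 n x : (0 <= g n x)%E by rewrite lee_fin mulr_ge0 ?powR_ge0//.
have mg n : measurable_fun D (g n).
  by apply/measurable_EFinP; apply: measurable_funM; [exact: measurable_cst|exact: measurable_indic].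
apply: (@le_trans _ _ (\int[mu]_(x in D) (\sum_(0 <= n <oo) g n x))%E).
  apply: ge0_le_integral => //.
  - by move=> x _; rewrite lee_fin powR_ge0.
  - exact/measurable_EFinP.
  - by apply: ge0_emeasurable_sum.
  - move=> x Dx; have [p0|p0] := eqVneq (phi x) 0.
      rewrite p0 powR0; last by rewrite oppr_eq0 gt_eqF.
      by apply: nneseries_ge0 => n _ _; exact: g0.
    have [n /andP[un vn]] := cover x Dx p0.
    apply: le_trans (nneseries_ge_term n (fun k => g0 k x)).
    rewrite /g indicE mem_set; last by split.
    rewrite mulr1 lee_fin !powRN lef_pV2 ?posrE ?powR_gt0//; last exact: lt_le_trans un.
    apply: ge0_ler_powR; rewrite ?nnegrE//; [exact: ltW|exact: ltW|].
    by apply: le_trans un; exact: ltW.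
rewrite integral_nneseries//; apply: le_trans (nneseries_geometric_le a0 q01).
apply: lee_nneseries => [n _ _|n _]; first by apply: integral_ge0.
have -> : (\int[mu]_(x in D) g n x = (u n `^ (- b))%:E * mu (E n))%E.
  rewrite /g; under eq_integral do rewrite EFinM.
  rewrite ge0_integralZl_EFin//; last 2 first.
  - by apply/measurable_EFinP; exact: measurable_indic.
  - exact: powR_ge0.
  by rewrite integral_indic// setIidl// => x [].
apply: (@le_trans _ _ ((u n `^ (- b))%:E * (m n)%:E)%E).
  by apply: lee_wpmul2l; [rewrite lee_fin powR_ge0|exact: mE].
by rewrite -EFinM lee_fin.
Qed.

Lemma dyadic_between (x l : R) : 0 < x -> x <= l ->
  exists n, l / 2 ^+ n.+1 <= x <= l / 2 ^+ n.
Proof.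
move=> x0 xl; have l0 : 0 < l by exact: lt_le_trans xl.
have ex : exists n, l / 2 ^+ n.+1 <= x.
  have h2 : `|2^-1 : R| < 1 by rewrite ger0_norm ?invr_ge0//; lra.
  have /cvgrPdist_lt := cvg_expr h2.
  have q0 : 0 < x / l by rewrite divr_gt0.
  move=> /(_ _ q0) [n _ /(_ n.+1 (leqnSn n))] /=.
  rewrite sub0r normrN ger0_norm ?exprn_ge0 ?invr_ge0// exprVn ltr_pdivlMr// => q.
  by exists n; rewrite mulrC ltW.
case: (ex_minnP ex) => n hn min; exists n; rewrite hn /=.
case: n hn min => [|n] hn min; first by rewrite expr0 divr1.
rewrite leNgt; apply/negP => /ltW /min; by rewrite ltnn.
Qed.

Lemma dyadic_above (x l : R) : 0 < l -> l < x ->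
  exists n, l * 2 ^+ n <= x <= l * 2 ^+ n.+1.
Proof.
move=> l0 lx; have x0 : 0 < x by exact: lt_trans lx.
have ex : exists n, x <= l * 2 ^+ n.+1.
  have h2 : `|2^-1 : R| < 1 by rewrite ger0_norm ?invr_ge0//; lra.
  have /cvgrPdist_lt := cvg_expr h2.
  have q0 : 0 < l / x by rewrite divr_gt0.
  move=> /(_ _ q0) [n _ /(_ n.+1 (leqnSn n))] /=.
  rewrite sub0r normrN ger0_norm ?exprn_ge0 ?invr_ge0// exprVn ltr_pdivlMr// => q.
  by exists n; rewrite -ler_pdivrMr ?exprn_gt0// mulrC ltW.
case: (ex_minnP ex) => n hn min; exists n; rewrite hn andbT.
case: n hn min => [|n] hn min; first by rewrite expr0 mulr1 ltW.
rewrite leNgt; apply/negP => /ltW /min; by rewrite ltnn.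
Qed.

Lemma powR_exprn (x y : R) n : 0 <= x -> (x ^+ n) `^ y = (x `^ y) ^+ n.
Proof.
move=> x0; elim: n => [|n ih]; first by rewrite !expr0 powR1.
by rewrite !exprS powRM ?exprn_ge0// ih.
Qed.

Lemma powR2_lt1 (x : R) : x < 0 -> 0 <= (2 : R) `^ x < 1.
Proof.
move=> x0; rewrite powR_ge0 /= -[x]opprK powRN invf_lt1 ?powR_gt0//.
have := @gt0_ltr_powR R (- x) _ 1 2; rewrite powR1; apply; rewrite ?nnegrE//; lra.
Qed.

(** Shells between l / 2^(n+1) and l / 2^n: the n-th costs a multiple of 2^(n(b - sg)), which is
    summable because b < sg. *)
Lemma layer_cake_small D phi (c sg b l : R) : measurable D -> measurable_fun D phi ->
  (forall x, D x -> 0 <= phi x <= l) -> 0 < b < sg -> 0 <= c -> 0 < l ->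
  (forall u, 0 < u -> u <= l -> (mu (D `&` [set x | (phi x <= u)%R]) <= (c * u `^ sg)%:E)%E) ->
  (\int[mu]_(x in D) ((phi x) `^ (- b))%:E <= (2 `^ b * c * l `^ (sg - b) / (1 - 2 `^ (b - sg)))%:E)%E.
Proof.
move=> mD mphi hphi /andP[b0 bs] c0 l0 H.
have p2 n : 0 < 2 ^+ n :> R by rewrite exprn_gt0.
have p21 n : 1 <= 2 ^+ n :> R by rewrite exprn_ege1//; lra.
apply: (@layer_cake D phi b _ _ (fun n => l / 2 ^+ n.+1) (fun n => l / 2 ^+ n)
   (fun n => c * (l / 2 ^+ n) `^ sg)) => //.
- by rewrite !mulr_ge0// powR_ge0.
- by apply: powR2_lt1; lra.
- by move=> n; rewrite divr_gt0.
- by move=> n; rewrite mulr_ge0// powR_ge0.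
- move=> x Dx p0; have /andP[h0 hl] := hphi x Dx.
  by apply: dyadic_between => //; rewrite lt_def p0.
- move=> n; apply: H; first by rewrite divr_gt0.
  by rewrite ler_pdivrMr//; have := p21 n; nra.
- move=> n; have l0' := ltW l0; have t0 : 0 <= 2 :> R by [].
  rewrite powRM ?invr_ge0 ?(ltW (p2 _))// powR_invE ?(ltW (p2 _))// opprK powR_exprn//.
  rewrite powRM ?invr_ge0 ?(ltW (p2 _))// powR_invE ?(ltW (p2 _))// powR_exprn//.
  rewrite !powRD ?(gt_eqF l0) ?implybT// ?pnatr_eq0 ?implybT// exprMn exprS.
  by apply: eq_ler; ring.
Qed.

(** The mirror image: the shells go up from l, and now sg < b makes the ratio 2^(sg - b) less than
    1. *)
Lemma layer_cake_large D phi (c sg b l : R) : measurable D -> measurable_fun D phi ->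
  (forall x, D x -> l < phi x) -> 0 < b -> sg < b -> 0 <= c -> 0 < l ->
  (forall u, 0 < u -> (mu (D `&` [set x | (phi x <= u)%R]) <= (c * u `^ sg)%:E)%E) ->
  (\int[mu]_(x in D) ((phi x) `^ (- b))%:E <= (2 `^ sg * c * l `^ (sg - b) / (1 - 2 `^ (sg - b)))%:E)%E.
Proof.
move=> mD mphi hphi b0 bs c0 l0 H.
have p2 n : 0 < 2 ^+ n :> R by rewrite exprn_gt0.
apply: (@layer_cake D phi b _ _ (fun n => l * 2 ^+ n) (fun n => l * 2 ^+ n.+1)
   (fun n => c * (l * 2 ^+ n.+1) `^ sg)) => //.
- by rewrite !mulr_ge0// powR_ge0.
- by apply: powR2_lt1; lra.
- by move=> n; rewrite mulr_gt0.
- by move=> n; rewrite mulr_ge0// powR_ge0.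
- by move=> x Dx _; apply: dyadic_above => //; exact: hphi.
- by move=> n; apply: H; rewrite mulr_gt0.
- move=> n; have l0' := ltW l0; have t0 : 0 <= 2 :> R by [].
  rewrite powRM ?(ltW (p2 _))// powR_exprn// powRM ?(ltW (p2 _))// powR_exprn//.
  rewrite !powRD ?(gt_eqF l0) ?implybT// ?pnatr_eq0 ?implybT// exprMn exprS.
  by apply: eq_ler; ring.
Qed.

Lemma quadratic_cdiff (f : R[i] -> R[i]) (z a : R[i]) (K dl : R) : 0 <= K -> 0 < dl ->
  (forall h, normc h <= dl -> normc (f (z + h) - f z - a * h) <= K * normc h ^+ 2) -> cdiff f z a.
Proof.
move=> K0 dl0 H e e0; exists (Num.min dl (e / (K + 1))).
  by rewrite lt_min dl0 divr_gt0//; lra.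
move=> h; rewrite lt_min => /andP[/ltW hd]; rewrite ltr_pdivlMr; last lra.
move=> he; have h0 := normc_ge0 h.
apply: le_trans (H h hd) _; rewrite expr2 mulrA; apply: ler_wpM2r => //; nra.
Qed.

(** A single integrable bound [B] on a disc about z0 controls, through [holo_taylor], both the
    derivative in z (by 3 B / rho) and the quadratic remainder (by 11 B), so the Taylor expansion
    can be integrated in t. *)
Lemma holo_cint D (G : T -> R[i] -> R[i]) : measurable D ->
  (forall t, D t -> forall z, normc z < 1 -> cdifferentiable (G t) z) ->
  (forall z, normc z < 1 -> cintegrable mu D (fun t => G t z)) ->
  (forall r : R, r < 1 -> exists2 B : T -> R, mu.-integrable D (EFin \o B) &
     forall t, D t -> forall z, normc z <= r -> normc (G t z) <= B t) ->
  forall z, normc z < 1 -> cdifferentiable (fun z => cint mu D (fun t => G t z)) z.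
Proof.
move=> mD hG iG bG z0 z01; pose rho := (1 - normc z0) / 2.
have rho0 : 0 < rho by rewrite /rho; lra.
have [|B iB hB] := bG (normc z0 + rho); first by rewrite /rho; lra.
pose a t := (G t)^`() z0.
have inD z : normc (z - z0) < rho -> normc z < 1 /\ normc z <= normc z0 + rho.
  by move=> zz; have := le_normcD (z - z0) z0; rewrite subrK => ?; split; [rewrite /rho in zz *|]; lra.
have B0 t : D t -> 0 <= B t.
  by move=> Dt; apply: le_trans (normc_ge0 _) (hB t Dt z0 _); lra.
have key t : D t -> normc (a t) <= 3 * B t / rho /\
    forall h, normc h <= rho / 2 ->
    normc (G t (z0 + h) - G t z0 - a t * h) <= 11 * B t * (normc h / rho) ^+ 2.
  move=> Dt; have [b [b1 b2]] := @holo_taylor _ (G t) z0 rho (B t) rho0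
    (fun z zz => hG t Dt z (inD z zz).1) (fun z zz => hB t Dt z (inD z zz).2).
  have bd : cdiff (G t) z0 b.
    apply: (@quadratic_cdiff _ _ _ (11 * B t / rho ^+ 2) (rho / 2)).
    - by apply: divr_ge0; [rewrite mulr_ge0 ?B0|exact: sqr_ge0].
    - lra.
    - move=> h /b2 /le_trans; apply; apply: eq_ler.
      by field; lra.
  by rewrite /a (cdiff_derive1 bd).
(* A sequence of increments tending to 0: the derivative [a] is measurable in t as the pointwise
   limit of the difference quotients [q n]. *)
pose hn (n : nat) : R[i] := RtoC (rho / 2 * harmonic n).
have hnn n : normc (hn n) = rho / 2 * harmonic n.
  by rewrite normc_RtoC ger0_norm// mulr_ge0 ?invr_ge0//; lra.
have har1 n : harmonic n <= 1 :> R by rewrite /harmonic /= invf_le1 ?ler1n.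
have har0 n : 0 < harmonic n :> R by rewrite /harmonic /= invr_gt0.
have hnr n : normc (hn n) <= rho / 2.
  by rewrite hnn -[leRHS]mulr1; apply: ler_wpM2l => //; lra.
have hn0 n : hn n != 0 by rewrite -normc_gt0 hnn mulr_gt0//; lra.
pose q n t := (hn n)^-1 * (G t (z0 + hn n) - G t z0).
have iq n : cintegrable mu D (q n).
  apply: cintegrableZ => //; apply: cintegrableB => //; last exact: iG.
  apply: iG; have := le_normcD z0 (hn n); have := hnr n; rewrite /rho; lra.
have qa t : D t -> forall e : R, 0 < e -> \forall n \near \oo, normc (a t - q n t) <= e.
  move=> Dt e e0; have [_ k2] := key t Dt.
  have BB := B0 t Dt.
  have X0 : 0 <= 11 * B t / rho by apply: divr_ge0; [rewrite mulr_ge0|exact: ltW].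
  have e1 : 0 < e / (11 * B t / rho + 1) by apply: divr_gt0 => //; lra.
  have /cvgrPdist_le/(_ _ e1) := @cvg_harmonic R.
  apply: filterS => n; rewrite sub0r normrN ger0_norm; last exact: ltW.
  rewrite ler_pdivlMr; last lra.
  move=> he; have hp : 0 < normc (hn n) by rewrite normc_gt0.
  rewrite -(ler_pM2r hp) -normcM.
  have -> : (a t - q n t) * hn n = - (G t (z0 + hn n) - G t z0 - a t * hn n) by rewrite /q; field.
  rewrite normcN; apply: le_trans (k2 _ (hnr n)) _; rewrite hnn.
  have h0 := har0 n; have h1 := har1 n.
  have -> : 11 * B t * (rho / 2 * harmonic n / rho) ^+ 2 = (11 * B t / rho) * harmonic n * (rho / 2 * harmonic n) / 2.
    by field; lra.
  have Y0 : 0 <= rho / 2 * harmonic n by rewrite mulr_ge0//; lra.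
  have : 11 * B t / rho * harmonic n * (rho / 2 * harmonic n) <= e * (rho / 2 * harmonic n).
    by apply: ler_wpM2r => //; nra.
  have : 0 <= 11 * B t / rho * harmonic n * (rho / 2 * harmonic n).
    by rewrite !mulr_ge0 ?invr_ge0//; lra.
  lra.
have mRe : measurable_fun D (fun t => complex.Re (a t)).
  apply: (@measurable_fun_cvg _ _ _ _ (fun n t => complex.Re (q n t))).
    by move=> n; case: (iq n) => /measurable_int/measurable_EFinP.
  move=> t Dt; apply/cvgrPdist_le => e e0; have := qa t Dt e e0.
  by apply: filterS => n; apply: le_trans; rewrite -Re_sub; exact: Re_le_normc.
have mIm : measurable_fun D (fun t => complex.Im (a t)).
  apply: (@measurable_fun_cvg _ _ _ _ (fun n t => complex.Im (q n t))).
    by move=> n; case: (iq n) => _ /measurable_int/measurable_EFinP.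
  move=> t Dt; apply/cvgrPdist_le => e e0; have := qa t Dt e e0.
  by apply: filterS => n; apply: le_trans; rewrite -Im_sub; exact: Im_le_normc.
have ia : cintegrable mu D a.
  apply: (@cintegrable_le _ _ _ mu D a (fun t => 3 / rho * B t)) => //.
    exact: integrable_EFinZl.
  by move=> t Dt; have [k1 _] := key t Dt; rewrite mulrAC.
exists (cint mu D a).
set I := Rintegral mu D B.
have I0 : 0 <= I by apply: Rintegral_ge0.
apply: (@quadratic_cdiff _ _ _ (22 * I / rho ^+ 2) (rho / 2)).
- by apply: divr_ge0; [rewrite mulr_ge0|exact: sqr_ge0].
- lra.
move=> h hr.
have zh : normc (z0 + h) < 1 by have := le_normcD z0 h; rewrite /rho in hr *; lra.
have ih : cintegrable mu D (fun t => h * a t) by exact: cintegrableZ.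
have i1 := iG _ zh; have i2 := iG _ z01.
rewrite (mulrC (cint mu D a)) -cintZ// -cintB// -cintB//; last exact: cintegrableB.
apply: (@le_trans _ _ (2 * Rintegral mu D (fun t => 11 * (normc h / rho) ^+ 2 * B t))).
  apply: normc_cint_le => //.
  - by apply: cintegrableB => //; exact: cintegrableB.
  - exact: integrable_EFinZl.
  - move=> t Dt; have [_ k2] := key t Dt.
    by rewrite (mulrC h); apply: le_trans (k2 _ hr) _; rewrite mulrAC.
rewrite RintegralZl// -/I le_eqVlt; apply/orP; left; apply/eqP.
by field; lra.
Qed.

End LayerCake.

(** * The set of angles where the circle is close to 1 *)

Section CircleSublevel.
Variable R : realType.
Local Notation C := R[i].
Local Notation leb := (@lebesgue_measure R).
Implicit Types (a l t u x : R).

Lemma pi_le4 : pi <= 4 :> R.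
Proof. by have [/andP[_]] := pihalf_02_cos_pihalf R; lra. Qed.

(** On [0,1] the mean value theorem gives the slope cos 1. Beyond 1, sin x >= sin 1 >= cos 1 by
    monotonicity, and x <= pi / 2 <= 2 explains the halved constant. *)
Lemma sin_ge_linear x : 0 <= x <= pi / 2 -> cos 1 / 2 * x <= sin x.
Proof.
move=> /andP[x0 x1]; have c0 := cos1_gt0 R; have p4 := pi_le4; have p2 := pi_ge2 R.
have small (y : R) : 0 < y -> y <= 1 -> cos 1 * y <= sin y.
  move=> y0 y1; have [|c] := @MVT R sin cos 0 y y0.
    by apply: continuous_subspaceT => c; exact: continuous_sin.
  rewrite in_itv /= => /andP[cp cy]; rewrite sin0 !subr0 => ->.
  apply: ler_wpM2r; first exact: ltW.
  by rewrite ltW// ltr_cos ?in_itv/=; [lra|apply/andP; split; lra..].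
have [->|xn0] := eqVneq x 0; first by rewrite mulr0 sin0.
have xp : 0 < x by rewrite lt_def xn0.
have [xl|xl] := leP x 1; first by have := small x xp xl; nra.
have := small 1 ltr01 (lexx _); rewrite mulr1 => s1.
have : sin 1 < sin x by rewrite ltr_sin// in_itv/=; apply/andP; split; lra.
nra.
Qed.

Lemma normc_1subcis_sqr t : normc (1 - cis t) ^+ 2 = (2 * sin (t / 2)) ^+ 2.
Proof.
rewrite normc_sqr Re_sub Im_sub /= sub0r sqrrN.
have E : cos t = 1 - 2 * sin (t / 2) ^+ 2.
  have -> : cos t = cos (t / 2 *+ 2) by congr cos; rewrite -mulr_natr; field.
  rewrite cos_mulr2n.
  by rewrite cos2sin2 -mulr_natr; ring.
have := cos2Dsin2 t; rewrite E; set s := sin (t / 2); set c := sin t => h.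
have -> : c ^+ 2 = 1 - (1 - 2 * s ^+ 2) ^+ 2 by move: h; lra.
ring.
Qed.

Lemma normc_1subcis t : normc (1 - cis t) = 2 * `|sin (t / 2)|.
Proof.
apply: (@pexpIrn _ 2) => //; rewrite ?nnegrE ?normc_ge0 ?mulr_ge0//.
by rewrite normc_1subcis_sqr !exprMn real_normK ?num_real.
Qed.

Lemma normc_1subcis_ge t : `|t| <= pi -> cos 1 / 2 * `|t| <= normc (1 - cis t).
Proof.
rewrite normc_1subcis => tp; have c0 := cos1_gt0 R; have t0 := normr_ge0 t.
have h1 : cos 1 / 2 * (`|t| / 2) <= sin (`|t| / 2).
  by apply: sin_ge_linear; apply/andP; split; lra.
have h2 : sin (`|t| / 2) <= `|sin (t / 2)|.
  have [t1|t1] := leP 0 t; first by rewrite ger0_norm// ler_norm.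
  by rewrite ltr0_norm// mulNr sinN -normrN ler_norm.
lra.
Qed.

Lemma cis_int (k : int) : cis (2 * pi * k%:~R) = 1 :> C.
Proof.
have nat_case (n : nat) : cis (2 * pi * n%:R) = 1 :> C.
  elim: n => [|n ih]; first by rewrite mulr0 cis0.
  by rewrite -[n.+1%:R]natr1 mulrDr mulr1 cisD ih cis2pi mulr1.
case: k => n; first exact: nat_case.
rewrite NegzE mulrNz mulrN.
have := cisD (2 * pi * n.+1%:R : R) (- (2 * pi * n.+1%:R)).
by rewrite subrr cis0 nat_case mul1r.
Qed.

Lemma normc_1subcis_continuous : continuous (fun t : R => normc (1 - cis t)).
Proof.
move=> t; apply: (@pcont_normc R (fun t => 1 - cis t)).
move=> e e0; have [d d0 Hd] := @pcont_circle R 1 t e e0.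
exists d => // s /Hd; rewrite RtoC1 !mul1r normcB; congr (normc _ <= _); ring.
Qed.

(** With k the floor of a / (2 pi), the arc lies between 2 pi k and 2 pi (k + 2), so each of its
    angles is within pi of [b 0], [b 1] or [b 2]. Near each of them [normc_1subcis_ge] confines the
    set to an interval of length 2 u / c1; hence 6 / c1, whatever the position of the arc. *)
Lemma circle_sublevel : exists2 c : R, 0 <= c & forall a l u, 0 < l <= 2 * pi -> 0 < u ->
  (leb (pitv a l `&` [set t | (normc (1 - cis t) <= u)%R]) <= (c * u)%:E)%E.
Proof.
have c0 := cos1_gt0 R; have pi0 := pi_gt0 R.
pose c1 : R := cos 1 / 2; have c10 : 0 < c1 by rewrite /c1; lra.
exists (6 / c1); first by rewrite divr_ge0// ltW.
move=> a l u /andP[l0 l2] u0.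
pose k := Num.floor (a / (2 * pi)).
have := floor_itv (a / (2 * pi)); rewrite -/k intrD => /andP[].
have p2 : 0 < 2 * pi :> R by lra.
rewrite ler_pdivlMr// ltr_pdivrMr// => ka ak.
pose b (j : nat) : R := 2 * pi * (k + j%:Z)%:~R.
have bE j : b j = k%:~R * (2 * pi) + 2 * pi * j%:R.
  by rewrite /b intrD mulrDr (mulrC (2 * pi) k%:~R).
pose I j : set R := `[b j - u / c1, b j + u / c1].
have mI j : measurable (I j) by exact: measurable_itv.
have uc0 : 0 < u / c1 by rewrite divr_gt0.
have lI j : leb (I j) = (2 * (u / c1))%:E.
  rewrite (@lebesgue_measure_cc R (b j - u / c1)); last lra.
  by congr EFin; lra.
have inI j t : `|t - b j| <= pi -> normc (1 - cis t) <= u -> I j t.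
  move=> tb tu; rewrite /I /= in_itv /=.
  have bj : cis (b j) = 1 :> C by exact: cis_int.
  have E : cis t = cis (t - b j) by have := cisD (t - b j) (b j); rewrite subrK bj mulr1.
  rewrite E in tu; have := normc_1subcis_ge tb; rewrite -/c1 => h.
  have {h} : `|t - b j| <= u / c1 by rewrite ler_pdivlMr// mulrC; exact: le_trans tu.
  by rewrite ler_norml => /andP[? ?]; apply/andP; split; lra.
rewrite /pitv; have mS : measurable (`[a, a + l] `&` [set t | (normc (1 - cis t) <= u)%R]).
  apply: measurable_fun_le => //.
  by apply: measurable_funTS; apply: continuous_measurable_fun; exact: normc_1subcis_continuous.
have mU : measurable (I 0%N `|` I 1%N `|` I 2%N).
  by apply: measurableU; [apply: measurableU|]; exact: mI.
apply: (@le_trans _ _ (leb (I 0%N `|` I 1%N `|` I 2%N))).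
  apply: le_measure; [by rewrite inE|by rewrite inE|].
  move=> t [] /=; rewrite in_itv/= => /andP[t1 t2] tu.
  have b0 := bE 0%N; have b1 := bE 1%N; have b2 := bE 2%N.
  have [h0|h0] := leP t (b 0%N + pi).
    by left; left; apply: inI => //; rewrite ler_norml; apply/andP; split; lra.
  have [h1|h1] := leP t (b 1%N + pi).
    by left; right; apply: inI => //; rewrite ler_norml; apply/andP; split; lra.
  by right; apply: inI => //; rewrite ler_norml; apply/andP; split; lra.
have mU01 : measurable (I 0%N `|` I 1%N) by apply: measurableU; exact: mI.
have U2 (A B : set R) : measurable A -> measurable B -> (leb (A `|` B) <= leb A + leb B)%E.
  by move=> mA mB; exact: measureU2.
apply: le_trans (U2 _ _ mU01 (mI 2%N)) _.
apply: le_trans (leeD (U2 _ _ (mI 0%N) (mI 1%N)) (lexx _)) _; rewrite !lI.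
by rewrite -!EFinD lee_fin; apply: eq_ler; field; lra.
Qed.

End CircleSublevel.

(** * Near and far parts of the integral defining the operator *)

Section Kernel.
Variables (R : realType) (mu : {measure set R -> \bar R}) (f : R[i] -> R[i]) (K g lam c : R).
Local Notation C := R[i].
Local Notation D := (`[0, 1[%classic : set R).
Hypothesis hf : forall z, normc z < 1 -> cdifferentiable f z.
Hypothesis K0 : 0 <= K.
Hypothesis g0 : 0 <= g.
Hypothesis fK : forall z, normc z < 1 -> normc (f z) <= K * (1 - normc z) `^ (- g).
Hypothesis lam01 : 0 < lam <= 1.
Hypothesis c0 : 0 <= c.
Hypothesis muT : (mu setT < +oo)%E.
Hypothesis muc : forall t, 0 <= t < 1 -> (mu `[t, 1%R[ <= (c * (1 - t) `^ ((1 + lam) / 2 + g))%:E)%E.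
Implicit Types (t u : R) (z w : C).

(** The kernel is a dilation of this one holomorphic function, whose growth exponent is g + 1. *)
Let G z := f z / (1 - z).

Let k t z := G (RtoC t * z).

(** Two constraints meet here: 2 b < 1 for square integrability on the circle, and b > (1 - lam) / 2
    for convergence of the near part, that is [beta < sg]. The choice is the midpoint of ](1 - lam)
    / 2, 1 / 2[, and the margin [sg - beta] is lam / 4. *)
Let b := 1 / 2 - lam / 4.
Let beta := g + 1 - b.
Let sg := (1 + lam) / 2 + g.
Let Dnear u : set R := D `&` [set t | 1 - t <= u].
Let Dfar u : set R := D `&` [set t | u < 1 - t].

Lemma one_sub_neq0 z : normc z < 1 -> 1 - z != 0.
Proof.
by move=> z1; rewrite subr_eq0; apply/negP => /eqP E; move: z1; rewrite -E normc1 ltxx.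
Qed.

Lemma div_1sub_holo z : normc z < 1 -> cdifferentiable G z.
Proof.
move=> z1; have [A HA] := hf z1; have nz := one_sub_neq0 z1.
have h : cdiff (fun w => 1 - w) z (0 + (0 * z + -1 * 1)).
  have := cdiffD (cdiff_cst 1 z) (cdiffM (cdiff_cst (-1) z) (cdiff_id z)).
  by rewrite (_ : (fun w => 1 + -1 * w) = (fun w => 1 - w))//; apply/funext => w; rewrite mulN1r.
by eexists; exact: (cdiffM HA (@cdiffV _ (fun w => 1 - w) z _ nz h)).
Qed.

Lemma normc_RtoCM_le t z : 0 <= t -> normc z <= 1 -> normc (RtoC t * z) <= t.
Proof.
move=> t0 z1; rewrite normcM normc_RtoC ger0_norm// -[leRHS]mulr1.
exact: ler_wpM2l.
Qed.

Lemma normc_one_sub_ge1 t z : 0 <= t -> normc z <= 1 -> 1 - t <= normc (1 - RtoC t * z).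
Proof.
move=> t0 z1; have := lerB_normc 1 (RtoC t * z); rewrite normc1.
by have := normc_RtoCM_le t0 z1; lra.
Qed.

(** Going from 1 to z through tz, the second step has length at most 1 - t, which is itself at most
    |1 - tz|. *)
Lemma normc_one_sub_ge2 t z : 0 <= t < 1 -> normc z <= 1 -> normc (1 - z) / 2 <= normc (1 - RtoC t * z).
Proof.
move=> /andP[t0 t1] z1; have h1 := normc_one_sub_ge1 t0 z1.
have := normc_triangle (RtoC t * z) 1 z.
have -> : RtoC t * z - z = - (RtoC (1 - t) * z) by rewrite RtoCB RtoC1; ring.
rewrite normcN; have := @normc_RtoCM_le (1 - t) z; lra.
Qed.

Lemma powRN_anti (x y a : R) : 0 <= a -> 0 < x -> x <= y -> y `^ (- a) <= x `^ (- a).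
Proof.
move=> a0 x0 xy; rewrite !powRN lef_pV2 ?posrE ?powR_gt0//; last exact: lt_le_trans xy.
by apply: ge0_ler_powR; rewrite ?nnegrE// ltW// (lt_le_trans x0).
Qed.

Lemma radial_le t z : 0 <= t < 1 -> normc z <= 1 -> normc (f (RtoC t * z)) <= K * (1 - t) `^ (- g).
Proof.
move=> /andP[t0 t1] z1; have h := normc_RtoCM_le t0 z1.
apply: le_trans (fK _) _; first lra.
apply: ler_wpM2l => //; apply: powRN_anti => //; lra.
Qed.

Lemma div_1sub_growth z : normc z < 1 -> normc (G z) <= K * (1 - normc z) `^ (- (g + 1)).
Proof.
move=> z1; have zp : 0 < 1 - normc z by lra.
rewrite normcM normcV opprD powRD; last by rewrite (gt_eqF zp) implybT.
rewrite mulrA; apply: ler_pM; rewrite ?normc_ge0 ?invr_ge0 ?normc_ge0 ?fK//.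
rewrite (powR_inv1 (ltW zp)) lef_pV2 ?posrE ?normc_gt0 ?one_sub_neq0//.
by have := lerB_normc 1 z; rewrite normc1.
Qed.

(** The exponent is weakened from g + 1 to g + 2 so that the integral of [int_Dfar_le] serves both
    for integrability and for the Lipschitz bound. *)
Lemma kernel_le_rough t z : 0 <= t < 1 -> normc z <= 1 -> normc (k t z) <= K * (1 - t) `^ (- (g + 2)).
Proof.
move=> /andP[t0 t1] z1; have h := normc_RtoCM_le t0 z1.
have tp : 0 < 1 - t by lra.
apply: le_trans (div_1sub_growth _) _; first lra.
apply: ler_wpM2l => //; apply: (@le_trans _ _ ((1 - t) `^ (- (g + 1)))).
  by have gp := g0; apply: powRN_anti; lra.
by apply: ger_powR; [apply/andP; split|]; lra.
Qed.

Lemma b_bounds : 0 < b /\ b < 1 / 2.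
Proof. by rewrite /b; case/andP: lam01; split; lra. Qed.

(** The factor 1 / |1 - tz| is shared out: the power 1 - b goes to the bound 1 - t, the power b to
    the bound |1 - z| / 2. *)
Lemma kernel_le t z : 0 <= t < 1 -> normc z <= 1 -> z != 1 ->
  normc (k t z) <= K * 2 `^ b * normc (1 - z) `^ (- b) * (1 - t) `^ (- beta).
Proof.
move=> /[dup] t01 /andP[t0 t1] z1 zn1.
have tp : 0 < 1 - t by lra.
have zp : 0 < normc (1 - z) by rewrite normc_gt0 subr_eq0 eq_sym.
have [b0 b12] := b_bounds.
rewrite /k /G normcM normcV.
set x := normc (1 - RtoC t * z).
have x1 : 1 - t <= x := normc_one_sub_ge1 t0 z1.
have x2 : normc (1 - z) / 2 <= x := normc_one_sub_ge2 t01 z1.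
have x0 : 0 < x by lra.
have E : x^-1 = x `^ (- (1 - b)) * x `^ (- b).
  rewrite -powRD; last by rewrite (gt_eqF x0) implybT.
  by rewrite -powR_inv1 ?ltW//; congr powR; ring.
have h1 : x `^ (- (1 - b)) <= (1 - t) `^ (- (1 - b)) by apply: powRN_anti => //; lra.
have h2 : x `^ (- b) <= 2 `^ b * normc (1 - z) `^ (- b).
  apply: le_trans (@powRN_anti _ x b _ _ x2) _; [exact: ltW|by rewrite divr_gt0|].
  by rewrite powRM; [rewrite powR_invE// opprK mulrC|exact: ltW|rewrite invr_ge0].
have h3 := radial_le t01 z1.
have -> : K * 2 `^ b * normc (1 - z) `^ (- b) * (1 - t) `^ (- beta) =
  (K * (1 - t) `^ (- g)) * ((1 - t) `^ (- (1 - b)) * (2 `^ b * normc (1 - z) `^ (- b))).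
  have -> : (1 - t) `^ (- beta) = (1 - t) `^ (- g) * (1 - t) `^ (- (1 - b)).
    rewrite -powRD; last by rewrite (gt_eqF tp) implybT.
    by congr powR; rewrite /beta; ring.
  ring.
apply: ler_pM => //; rewrite ?normc_ge0 ?invr_ge0 ?normc_ge0// E.
by apply: ler_pM; rewrite ?powR_ge0.
Qed.

Lemma kernel_lipschitz t z w : 0 <= t < 1 -> normc z <= 1 -> normc w <= 1 ->
  normc (k t z - k t w) <= 18 * K * 2 `^ (g + 1) * normc (z - w) * (1 - t) `^ (- (g + 2)).
Proof.
move=> /andP[t0 t1] z1 w1.
have g10 : 0 <= g + 1 by have gp := g0; lra.
apply: le_trans (holo_lipschitz div_1sub_holo K0 g10 div_1sub_growth t1 (normc_RtoCM_le t0 z1) (normc_RtoCM_le t0 w1)) _.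
have -> : g + 1 + 1 = g + 2 by ring.
rewrite -mulrBr mulrAC; apply: ler_wpM2r; first exact: powR_ge0.
apply: ler_wpM2l; first by rewrite !mulr_ge0// powR_ge0.
by rewrite normcM normc_RtoC ger0_norm// -[leRHS]mul1r; apply: ler_wpM2r; rewrite ?normc_ge0// ltW.
Qed.

Lemma kernel_pcont t z : `|t| < 1 -> normc z <= 1 -> pcont (k^~ z) t.
Proof.
move=> t1 z1; have tz : normc (RtoC t * z) < 1.
  rewrite normcM normc_RtoC; apply: le_lt_trans t1; rewrite -[leRHS]mulr1.
  by apply: ler_wpM2l.
apply: (@pcont_comp _ G (fun t => RtoC t * z)); last first.
  by have [A HA] := div_1sub_holo tz; exact: cdiff_cont HA.
move=> e e0; exists e => // s se; rewrite -mulrBl -RtoCB normcM normc_RtoC.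
by rewrite -[leRHS]mulr1; apply: ler_pM; rewrite ?normc_ge0// ltW.
Qed.

Lemma kernel_measurable z : normc z <= 1 -> measurable_fun D (fun t => complex.Re (k t z)) /\
  measurable_fun D (fun t => complex.Im (k t z)).
Proof.
move=> z1.
have sub : D `<=` (`]-1, 1[%classic : set R).
  by move=> t /=; rewrite !in_itv /= => /andP[? ?]; apply/andP; split; lra.
have co : open (`]-1, 1[%classic : set R) by exact: interval_open.
split.
  apply: (@measurable_funS _ _ _ _ _ _ (fun t => complex.Re (k t z)) _ sub) => //.
  apply: open_continuous_measurable_fun => // t /[!inE] /=; rewrite in_itv /= => /andP[? ?].
  by apply: pcont_Re; apply: kernel_pcont => //; rewrite ltr_norml; apply/andP; split.
apply: (@measurable_funS _ _ _ _ _ _ (fun t => complex.Im (k t z)) _ sub) => //.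
apply: open_continuous_measurable_fun => // t /[!inE] /=; rewrite in_itv /= => /andP[? ?].
by apply: pcont_Im; apply: kernel_pcont => //; rewrite ltr_norml; apply/andP; split.
Qed.

Lemma measurable_itv01 : measurable D.
Proof. exact: measurable_itv. Qed.

Lemma measurable_1sub A : measurable_fun A (fun t : R => 1 - t).
Proof. by apply: measurable_funB; [exact: measurable_cst|exact: measurable_id]. Qed.

Lemma measurable_1sub_powR A a : measurable_fun A (fun t : R => (1 - t) `^ a).
Proof. exact: (measurableT_comp (measurable_powR a) (@measurable_1sub A)). Qed.

Lemma measurable_Dnear u : measurable (Dnear u).
Proof. by apply: measurable_fun_le; [exact: measurable_itv01|exact: measurable_1sub|exact: measurable_cst]. Qed.

Lemma measurable_Dfar u : measurable (Dfar u).
Proof.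
have -> : Dfar u = D `\` Dnear u.
  apply/seteqP; split=> t /=; first by move=> [Dt ut]; split=> // -[_ /=]; rewrite leNgt ut.
  move=> [Dt nE]; split=> //=; case: (ltP u (1 - t)) => // h.
  by exfalso; apply: nE; split.
by apply: measurableD; [exact: measurable_itv01|exact: measurable_Dnear].
Qed.

Lemma Dnear_Dfar u : D = Dnear u `|` Dfar u.
Proof.
apply/seteqP; split=> t; last by case=> -[].
by move=> Dt; case: (leP (1 - t) u) => h; [left|right].
Qed.

Lemma disj_Dnear_Dfar u : [disjoint Dnear u & Dfar u].
Proof. by apply/disj_setPS => t [[_ /= h1] [_ /= h2]]; lra. Qed.

Lemma mu_sublevel u : 0 < u -> (mu (D `&` [set t | (1 - t <= u)%R]) <= (c * u `^ sg)%:E)%E.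
Proof.
move=> u0; have gp := g0; have sg0 : 0 < sg by rewrite /sg; case/andP: lam01 => ? ?; lra.
(* For u >= 1 the set is all of [0,1), and the Carleson bound at 0 suffices because u^sg >= 1. *)
have [u1|u1] := leP 1 u.
  have -> : D `&` [set t | (1 - t <= u)%R] = `[0, 1[%classic.
    apply/seteqP; split=> t; first by case.
    move=> Dt; split=> //=; move: Dt; rewrite /= in_itv /= => /andP[? ?]; lra.
  apply: le_trans (muc (_ : 0 <= 0 < 1)) _; first by rewrite lexx ltr01.
  rewrite lee_fin; apply: ler_wpM2l => //; rewrite subr0 powR1.
  have := @ge0_ler_powR R sg (ltW sg0) 1 u; rewrite powR1; apply; rewrite ?nnegrE//; lra.
have -> : D `&` [set t | (1 - t <= u)%R] = `[1 - u, 1[%classic.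
  apply/seteqP; split=> t /=; rewrite !in_itv /=.
    by move=> [/andP[? ->] ?]; rewrite andbT; lra.
  by move=> /andP[? ->]; rewrite andbT; split; lra.
apply: le_trans (muc (_ : 0 <= 1 - u < 1)) _; first by apply/andP; split; lra.
by rewrite lee_fin -/sg; have -> : 1 - (1 - u) = u by ring.
Qed.

(** The layers decrease towards t = 1 since [beta < sg]; the power lam / 4 of u is the margin. *)
Lemma int_Dnear_le : exists2 A : R, 0 <= A & forall u, 0 < u ->
  (\int[mu]_(t in Dnear u) ((1 - t) `^ (- beta))%:E <= (A * u `^ (lam / 4))%:E)%E.
Proof.
have [b0 b12] := b_bounds; case/andP: lam01 => l0 l1.
have gp := g0.
have bs : beta < sg by rewrite /beta /sg /b; lra.
have /andP[q0 q1] : 0 <= (2 : R) `^ (beta - sg) < 1 by apply: powR2_lt1; lra.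
exists (2 `^ beta * c / (1 - 2 `^ (beta - sg))).
  by apply: divr_ge0; [rewrite mulr_ge0// powR_ge0|lra].
move=> u u0.
apply: le_trans (@layer_cake_small _ _ R mu (Dnear u) (fun t => 1 - t) c sg beta u _ _ _ _ _ _ _) _ => //.
- exact: measurable_Dnear.
- exact: measurable_1sub.
- by move=> t [/=]; rewrite in_itv /= => /andP[? ?] ?; apply/andP; split; lra.
- by rewrite bs andbT /beta; lra.
- move=> v v0 vu; apply: le_trans (mu_sublevel v0).
  apply: le_measure; rewrite ?inE; [| |by move=> t [[? ?] ?]].
    by apply: measurable_fun_le; [exact: measurable_Dnear|exact: measurable_1sub|exact: measurable_cst].
  exact: measurable_Dnear.
rewrite lee_fin; apply: eq_ler.
have -> : sg - beta = lam / 4 by rewrite /sg /beta /b; field.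
ring.
Qed.

(** Here the kernel exponent g + 2 exceeds [sg], so the layers are summed away from t = 1 and the
    bound blows up as u tends to 0, with power sg - (g + 2). *)
Lemma int_Dfar_le : exists2 A : R, 0 <= A & forall u, 0 < u ->
  (\int[mu]_(t in Dfar u) ((1 - t) `^ (- (g + 2)))%:E <= (A * u `^ ((lam - 3) / 2))%:E)%E.
Proof.
case/andP: lam01 => l0 l1.
have gp := g0; have /andP[q0 q1] : 0 <= (2 : R) `^ (sg - (g + 2)) < 1 by apply: powR2_lt1; rewrite /sg; lra.
exists (2 `^ sg * c / (1 - 2 `^ (sg - (g + 2)))).
  by apply: divr_ge0; [rewrite mulr_ge0// powR_ge0|lra].
move=> u u0.
apply: le_trans (@layer_cake_large _ _ R mu (Dfar u) (fun t => 1 - t) c sg (g + 2) u _ _ _ _ _ _ _ _) _ => //.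
- exact: measurable_Dfar.
- exact: measurable_1sub.
- by move=> t [].
- lra.
- rewrite /sg; lra.
- move=> v v0; apply: le_trans (mu_sublevel v0).
  apply: le_measure; rewrite ?inE; [| |by move=> t [[? ?] ?]].
    by apply: measurable_fun_le; [exact: measurable_Dfar|exact: measurable_1sub|exact: measurable_cst].
  exact: measurable_Dnear.
rewrite lee_fin; apply: eq_ler.
have -> : sg - (g + 2) = (lam - 3) / 2 by rewrite /sg; field.
ring.
Qed.

Lemma cintegrable_Dnear z u : 0 < u -> normc z <= 1 -> z != 1 -> cintegrable mu (Dnear u) (k^~ z).
Proof.
move=> u0 z1 zn1; have [A A0 HA] := int_Dnear_le.
have [m1 m2] := kernel_measurable z1.
have subD : Dnear u `<=` D by move=> t [].
apply: (@cintegrable_le _ _ _ _ _ _ (fun t => K * 2 `^ b * normc (1 - z) `^ (- b) * (1 - t) `^ (- beta))).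
- exact: measurable_Dnear.
- exact: measurable_funS measurable_itv01 subD m1.
- exact: measurable_funS measurable_itv01 subD m2.
- apply: integrable_EFinZl; first exact: measurable_Dnear.
  apply: ge0_integrable (HA u u0); [exact: measurable_Dnear|exact: measurable_1sub_powR|by move=> t _; exact: powR_ge0].
- by move=> t [/=]; rewrite in_itv /= => t01 _; exact: kernel_le.
Qed.

Lemma cintegrable_Dfar z u : 0 < u -> normc z <= 1 -> cintegrable mu (Dfar u) (k^~ z).
Proof.
move=> u0 z1; have [A A0 HA] := int_Dfar_le.
have [m1 m2] := kernel_measurable z1.
have subD : Dfar u `<=` D by move=> t [].
apply: (@cintegrable_le _ _ _ _ _ _ (fun t => K * (1 - t) `^ (- (g + 2)))).
- exact: measurable_Dfar.
- exact: measurable_funS measurable_itv01 subD m1.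
- exact: measurable_funS measurable_itv01 subD m2.
- apply: integrable_EFinZl; first exact: measurable_Dfar.
  apply: ge0_integrable (HA u u0); [exact: measurable_Dfar|exact: measurable_1sub_powR|by move=> t _; exact: powR_ge0].
- by move=> t [/=]; rewrite in_itv /= => t01 _; exact: kernel_le_rough.
Qed.

(** At u = 1 the near part is everything, so integrability over [0,1) is a case of
    [cintegrable_Dnear]. *)
Lemma Dnear1 : Dnear 1 = D.
Proof.
apply/seteqP; split=> t; first by case.
by move=> Dt; split=> //=; move: Dt; rewrite /= in_itv /= => /andP[? ?]; lra.
Qed.

Lemma cesaro_split z u : 0 < u -> normc z <= 1 -> z != 1 ->
  cesaro_like mu f z = cint mu (Dnear u) (k^~ z) + cint mu (Dfar u) (k^~ z).
Proof.
move=> u0 z1 zn1; rewrite -cint_setU; [|exact: measurable_Dnear|exact: measurable_Dfar| |exact: disj_Dnear_Dfar].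
  by rewrite -Dnear_Dfar.
by rewrite -Dnear_Dfar -Dnear1; exact: cintegrable_Dnear.
Qed.

Lemma cint_Dnear_le : exists2 A : R, 0 <= A & forall u z, 0 < u -> normc z <= 1 -> z != 1 ->
  normc (cint mu (Dnear u) (k^~ z)) <= A * normc (1 - z) `^ (- b) * u `^ (lam / 4).
Proof.
have [A A0 HA] := int_Dnear_le.
exists (2 * (K * 2 `^ b * A)); first by rewrite !mulr_ge0// powR_ge0.
move=> u z u0 z1 zn1.
have ii : mu.-integrable (Dnear u) (EFin \o (fun t => (1 - t) `^ (- beta))).
  apply: ge0_integrable (HA u u0); [exact: measurable_Dnear|exact: measurable_1sub_powR|by move=> t _; exact: powR_ge0].
apply: le_trans (normc_cint_le (measurable_Dnear u) (cintegrable_Dnear u0 z1 zn1)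
  (B := fun t => K * 2 `^ b * normc (1 - z) `^ (- b) * (1 - t) `^ (- beta)) _ _) _.
- by apply: integrable_EFinZl; first exact: measurable_Dnear.
- by move=> t [/=]; rewrite in_itv /= => t01 _; exact: kernel_le.
rewrite RintegralZl//; last exact: measurable_Dnear.
have : Rintegral mu (Dnear u) (fun t => (1 - t) `^ (- beta)) <= A * u `^ (lam / 4).
  by apply: ge0_Rintegral_le (HA u u0) => t _; exact: powR_ge0.
set I := Rintegral _ _ _ => hI.
have P0 : 0 <= K * 2 `^ b * normc (1 - z) `^ (- b) by rewrite !mulr_ge0// powR_ge0.
have : K * 2 `^ b * normc (1 - z) `^ (- b) * I <= K * 2 `^ b * normc (1 - z) `^ (- b) * (A * u `^ (lam / 4)).
  exact: ler_wpM2l.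
lra.
Qed.

Lemma cint_Dfar_le : exists2 A : R, 0 <= A & forall u z w, 0 < u -> normc z <= 1 -> normc w <= 1 ->
  normc (cint mu (Dfar u) (k^~ z) - cint mu (Dfar u) (k^~ w)) <= A * normc (z - w) * u `^ ((lam - 3) / 2).
Proof.
have [A A0 HA] := int_Dfar_le.
exists (2 * (18 * K * 2 `^ (g + 1) * A)); first by rewrite !mulr_ge0// powR_ge0.
move=> u z w u0 z1 w1.
have ii : mu.-integrable (Dfar u) (EFin \o (fun t => (1 - t) `^ (- (g + 2)))).
  apply: ge0_integrable (HA u u0); [exact: measurable_Dfar|exact: measurable_1sub_powR|by move=> t _; exact: powR_ge0].
have iz := cintegrable_Dfar u0 z1; have iw := cintegrable_Dfar u0 w1.
rewrite -cintB//; last exact: measurable_Dfar.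
apply: le_trans (normc_cint_le (measurable_Dfar u) (cintegrableB (measurable_Dfar u) iz iw)
  (B := fun t => 18 * K * 2 `^ (g + 1) * normc (z - w) * (1 - t) `^ (- (g + 2))) _ _) _.
- by apply: integrable_EFinZl; first exact: measurable_Dfar.
- by move=> t [/=]; rewrite in_itv /= => t01 _; exact: kernel_lipschitz.
rewrite RintegralZl//; last exact: measurable_Dfar.
have : Rintegral mu (Dfar u) (fun t => (1 - t) `^ (- (g + 2))) <= A * u `^ ((lam - 3) / 2).
  by apply: ge0_Rintegral_le (HA u u0) => t _; exact: powR_ge0.
set I := Rintegral _ _ _ => hI.
have P0 : 0 <= 18 * K * 2 `^ (g + 1) * normc (z - w) by rewrite !mulr_ge0// ?powR_ge0 ?normc_ge0.
have : 18 * K * 2 `^ (g + 1) * normc (z - w) * I <= 18 * K * 2 `^ (g + 1) * normc (z - w) * (A * u `^ ((lam - 3) / 2)).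
  exact: ler_wpM2l.
lra.
Qed.

(** These bounds, together with holomorphy, are all that the Morrey estimate uses. [Fc u] is the
    integral over [Dfar u], and its vanishing at u = 1 turns the near estimate into a pointwise
    bound. *)
Lemma cesaro_near_far : exists A (Fc : R -> C -> C), [/\ 0 <= A,
  forall u z, 0 < u -> normc z <= 1 -> z != 1 ->
    normc (cesaro_like mu f z - Fc u z) <= A * normc (1 - z) `^ (- (1 / 2 - lam / 4)) * u `^ (lam / 4),
  forall u z w, 0 < u -> normc z <= 1 -> normc w <= 1 ->
    normc (Fc u z - Fc u w) <= A * normc (z - w) * u `^ ((lam - 3) / 2) &
  forall z, Fc 1 z = 0].
Proof.
have [A1 A10 H1] := cint_Dnear_le; have [A2 A20 H2] := cint_Dfar_le.
exists (A1 + A2), (fun u z => cint mu (Dfar u) (k^~ z)); split.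
- exact: addr_ge0.
- move=> u z u0 z1 zn1; rewrite (cesaro_split u0 z1 zn1) addrK.
  apply: le_trans (H1 u z u0 z1 zn1) _; apply: ler_wpM2r; first exact: powR_ge0.
  by apply: ler_wpM2r; [exact: powR_ge0|rewrite lerDl].
- move=> u z w u0 z1 w1; apply: le_trans (H2 u z w u0 z1 w1) _.
  apply: ler_wpM2r; first exact: powR_ge0.
  by apply: ler_wpM2r; [exact: normc_ge0|rewrite lerDr].
- move=> z; have -> : Dfar 1 = set0.
    apply/seteqP; split=> t // -[/=]; rewrite in_itv /= => /andP[? ?]; lra.
  by apply: complex_ReIm_eq; rewrite /= Rintegral_set0.
Qed.

(** For |z| <= r the points tz also satisfy |tz| <= r, so the kernel has a constant bound,
    integrable because the measure is finite. *)
Lemma cesaro_holo z : normc z < 1 -> cdifferentiable (cesaro_like mu f) z.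
Proof.
have muD : (mu D < +oo)%E.
  by apply: le_lt_trans muT; apply: le_measure; rewrite ?inE; [exact: measurable_itv01| |].
apply: (@holo_cint _ _ R mu D (fun t z => k t z) measurable_itv01).
- move=> t /=; rewrite in_itv /= => /andP[t0 t1] w w1.
  have h : normc (0 + RtoC t * w) < 1.
    by rewrite add0r; apply: le_lt_trans (normc_RtoCM_le t0 (ltW w1)) t1.
  have [A HA] := div_1sub_holo h; exists (A * RtoC t).
  have := cdiff_affine HA; congr cdiff.
  by apply/funext => x; rewrite add0r.
- move=> w w1; rewrite -Dnear1; apply: cintegrable_Dnear => //; first exact: ltW.
  by apply/negP => /eqP E; move: w1; rewrite E normc1 ltxx.
- move=> r r1; have [M M0 HM] := holo_bounded div_1sub_holo r1.
  exists (fun=> M).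
    apply: (measurable_bounded_integrable measurable_itv01 muD (measurable_cst _)).
    exists M; split; first exact: num_real.
    by move=> x Mx t _ /=; rewrite ger0_norm// ltW.
  move=> t /=; rewrite in_itv /= => /andP[t0 t1] w wr; apply: HM.
  rewrite normcM normc_RtoC ger0_norm//; apply: le_trans wr.
  by rewrite -[leRHS]mul1r; apply: ler_wpM2r; rewrite ?normc_ge0// ltW.
Qed.

End Kernel.

(** * Powers of the distance to 1 integrated over arcs *)

Section CircleIntegrals.
Variable R : realType.
Local Notation C := R[i].
Local Notation leb := (@lebesgue_measure R).
Local Notation phi := (fun t : R => normc (1 - cis t)).
Implicit Types (a l t u : R).

Lemma cis_eq1 t : cis t = 1 -> exists k : int, t = 2 * pi * k%:~R.
Proof.
move=> c1; have pi0 := pi_gt0 R; have p2 : 0 < 2 * pi :> R by lra.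
pose k := Num.floor ((t + pi) / (2 * pi)); exists k.
have := floor_itv ((t + pi) / (2 * pi)); rewrite -/k intrD => /andP[].
rewrite ler_pdivlMr// ltr_pdivrMr// => k1 k2.
have sp : `|t - 2 * pi * k%:~R| <= pi.
  by rewrite ler_norml; apply/andP; split; lra.
have cs : cis (t - 2 * pi * k%:~R) = 1.
  by have := cisD (t - 2 * pi * k%:~R) (2 * pi * k%:~R); rewrite subrK cis_int mulr1 c1.
have := normc_1subcis_ge sp; rewrite cs subrr normc0.
have c0 := cos1_gt0 R; have := normr_ge0 (t - 2 * pi * k%:~R) => n0 h.
have : `|t - 2 * pi * k%:~R| = 0 by nra.
by move/normr0_eq0/eqP; rewrite subr_eq0 => /eqP.
Qed.

(** The exceptional angles are the integer multiples of 2 pi, a countable and hence null set. *)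
Lemma ae_cis (P : R -> Prop) : (forall t, cis t != 1 :> C -> P t) ->
  {ae lebesgue_measure, forall t : R, P t}.
Proof.
move=> HP; pose A : set R := [set 2 * pi * k%:~R | k in [set: int]].
have cA : countable A by apply: sub_countable (card_image_le _ _) (countableP _).
exists A; split.
- by apply: countable_measurable => // t; exact: measurable_set1.
- exact: countable_lebesgue_measure0.
- move=> t /= nP; have [/cis_eq1[k ->]|/HP//] := eqVneq (cis t : C) 1.
  by exists k.
Qed.

Lemma ae_cis_le_integral (D : set R) (f1 f2 : R -> R) : measurable D ->
  measurable_fun D f1 -> measurable_fun D f2 ->
  (forall t, D t -> 0 <= f1 t) -> (forall t, D t -> 0 <= f2 t) ->
  (forall t, D t -> cis t != 1 :> C -> f1 t <= f2 t) ->
  (\int[leb]_(t in D) (f1 t)%:E <= \int[leb]_(t in D) (f2 t)%:E)%E.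
Proof.
move=> mD m1 m2 p1 p2 f12; apply: ae_ge0_le_integral => //.
- exact/measurable_EFinP.
- exact/measurable_EFinP.
- by apply: ae_cis => t ct Dt; rewrite lee_fin; exact: f12.
Qed.

Lemma measurable_1subcis (D : set R) e : measurable_fun D (fun t : R => normc (1 - cis t) `^ e).
Proof.
apply: (measurableT_comp (measurable_powR e)); apply: measurable_funTS.
by apply: continuous_measurable_fun; exact: normc_1subcis_continuous.
Qed.

(** Where the distance to 1 is at most l, the layers apply with exponent 1 from [circle_sublevel],
    and e < 1 makes them summable. On the rest the integrand is at most l^(-e) over a set of measure
    at most l, which is the summand 1 in the constant. *)
Lemma circle_powint (e : R) : 0 < e < 1 -> exists2 K : R, 0 <= K & forall a l, 0 < l <= 2 * pi ->
  (\int[leb]_(t in pitv a l) (normc (1 - cis t) `^ (- e))%:E <= (K * l `^ (1 - e))%:E)%E.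
Proof.
move=> /andP[e0 e1]; have [c c0 Hc] := circle_sublevel R.
have /andP[q0 q1] : 0 <= (2 : R) `^ (e - 1) < 1 by apply: powR2_lt1; lra.
exists (2 `^ e * c / (1 - 2 `^ (e - 1)) + 1).
  by apply: addr_ge0 => //; apply: divr_ge0; [rewrite mulr_ge0// powR_ge0|lra].
move=> a l /[dup] l02 /andP[l0 l2].
have mI : measurable (pitv a l) by exact: measurable_itv.
have mphi (A : set R) : measurable_fun A phi.
  by apply: measurable_funTS; apply: continuous_measurable_fun; exact: normc_1subcis_continuous.
pose D1 := pitv a l `&` [set t | (phi t <= l)%R].
have mD1 : measurable D1 by apply: measurable_fun_le => //; exact: mphi.
pose D2 := pitv a l `\` D1.
have mD2 : measurable D2 by exact: measurableD.
have E : pitv a l = D1 `|` D2 by rewrite setDUK// => t [].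
rewrite [X in integral _ X]E ge0_integral_setU//; last 3 first.
- by apply/measurable_EFinP; exact: measurable_1subcis.
- by move=> t _; rewrite lee_fin powR_ge0.
- by apply/disj_setPS => t [h1 [_ h2]].
rewrite mulrDl EFinD; apply: leeD.
  apply: le_trans (@layer_cake_small _ _ R leb D1 phi c 1 e l _ _ _ _ _ _ _) _ => //.
  - exact: mphi.
  - by move=> t [_ tl]; apply/andP; split; [apply: normc_ge0|apply: tl].
  - by rewrite e0.
  - move=> u u0 ul; rewrite (powRr1 (ltW u0)); apply: le_trans (Hc a l u l02 u0).
    have m1 : measurable (D1 `&` [set t | (phi t <= u)%R]) by apply: measurable_fun_le => //; exact: mphi.
    have m2 : measurable (pitv a l `&` [set t | (phi t <= u)%R]) by apply: measurable_fun_le => //; exact: mphi.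
    by apply: le_measure; rewrite ?inE// => t [[? ?] ?].
  by rewrite lee_fin; apply: eq_ler; ring.
apply: (@le_trans _ _ (\int[leb]_(t in D2) (cst (l `^ (- e))%:E) t)%E).
  apply: ge0_le_integral => //.
  - by move=> t _; rewrite lee_fin powR_ge0.
  - by apply/measurable_EFinP; exact: measurable_1subcis.
  - move=> t [It nD]; rewrite lee_fin; apply: powRN_anti => //; first exact: ltW.
    by rewrite leNgt; apply/negP => h; apply: nD; split=> //=; exact: ltW.
rewrite integral_cst// mul1r.
have -> : l `^ (1 - e) = l `^ (- e) * l.
  by rewrite addrC powRD ?powRr1 ?ltW// (gt_eqF l0) implybT.
rewrite EFinM; apply: lee_wpmul2l; first by rewrite lee_fin powR_ge0.
have al : a <= a + l by lra.
have -> : l%:E = lebesgue_measure (pitv a l).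
  by rewrite (lebesgue_measure_cc al); congr EFin; ring.
by apply: le_measure; rewrite ?inE// => t [].
Qed.

Lemma normc_cisB t s : normc (cis t - cis s) <= `|t - s|.
Proof.
have sinle (x : R) : 0 <= x -> `|sin x| <= x.
  move=> x0; have [->|xn0] := eqVneq x 0; first by rewrite sin0 normr0.
  have xp : 0 < x by rewrite lt_def xn0.
  have [|y _] := @MVT R sin cos 0 x xp.
    by apply: continuous_subspaceT => y; exact: continuous_sin.
  rewrite sin0 !subr0 => ->; rewrite normrM (ger0_norm x0) -[leRHS]mul1r.
  by apply: ler_wpM2r => //; exact: cos_max.
have E : cis t = cis s * cis (t - s) by rewrite -cisD addrC subrK.
have -> : cis t - cis s = - (cis s * (1 - cis (t - s))) by rewrite E; ring.
rewrite normcN normcM normc_cis mul1r normc_1subcis.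
have -> : `|sin ((t - s) / 2)| = `|sin (`|t - s| / 2)|.
  have [h|h] := leP 0 (t - s); first by rewrite (ger0_norm h).
  by rewrite (ltr0_norm h) mulNr sinN normrN.
have := sinle (`|t - s| / 2); have := normr_ge0 (t - s); lra.
Qed.

End CircleIntegrals.

(** * From near and far bounds to the Morrey space *)

(* [Fc u z] stands for the part [u < 1 - t] of the integral defining [F z]. *)
Section Morrey.
Variables (R : realType) (lam A : R) (F : R[i] -> R[i]) (Fc : R -> R[i] -> R[i]).
Local Notation C := R[i].
Local Notation leb := (@lebesgue_measure R).
Local Notation phi := (fun t : R => normc (1 - cis t)).
Local Notation b := (1 / 2 - lam / 4).
Hypothesis lam01 : 0 < lam <= 1.
Hypothesis hF : forall z, normc z < 1 -> cdifferentiable F z.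
Hypothesis A0 : 0 <= A.
Hypothesis Fnear : forall u z, 0 < u -> normc z <= 1 -> z != 1 ->
  normc (F z - Fc u z) <= A * normc (1 - z) `^ (- b) * u `^ (lam / 4).
Hypothesis Ffar : forall u z w, 0 < u -> normc z <= 1 -> normc w <= 1 ->
  normc (Fc u z - Fc u w) <= A * normc (z - w) * u `^ ((lam - 3) / 2).
Hypothesis Fc1 : forall z, Fc 1 z = 0.
Implicit Types (a l t u : R) (z w : C).

Let b0 : 0 < b. Proof. by case/andP: lam01 => ? ?; lra. Qed.
Let b2 : 0 < 2 * b < 1. Proof. by case/andP: lam01 => ? ?; apply/andP; split; lra. Qed.

Lemma near_far_le z : normc z <= 1 -> z != 1 -> normc (F z) <= A * normc (1 - z) `^ (- b).
Proof. by move=> z1 zn1; have := Fnear ltr01 z1 zn1; rewrite Fc1 subr0 powR1 mulr1. Qed.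

(** Continuity up to the boundary except at 1: first u is fixed to make the near parts small, then
    the far part is Lipschitz with a constant depending on this u. *)
Lemma near_far_cont w : normc w <= 1 -> w != 1 -> forall e : R, 0 < e -> exists2 d : R, 0 < d &
  forall z, normc z <= 1 -> normc (z - w) < d -> normc (F z - F w) <= e.
Proof.
move=> w1 wn1 e e0; have bp := b0; have Ap := A0; case/andP: (lam01) => l0 l1.
have wp : 0 < normc (1 - w) by rewrite normc_gt0 subr_eq0 eq_sym.
pose P := (normc (1 - w) / 2) `^ (- b).
have P0 : 0 < P by rewrite powR_gt0// divr_gt0.
have AP : 0 <= A * P by rewrite mulr_ge0// ltW.
have q0 : 0 < e / (4 * (A * P) + 4) by rewrite divr_gt0//; lra.
(* The value for which A P u^(lam/4) <= e / 4, where [P] bounds |1 - z|^(-b) at all points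
   considered. *)
pose u := (e / (4 * (A * P) + 4)) `^ (4 / lam).
have u0 : 0 < u by rewrite powR_gt0.
have uE : u `^ (lam / 4) = e / (4 * (A * P) + 4).
  rewrite /u -powRrM (_ : 4 / lam * (lam / 4) = 1) ?powRr1 ?(ltW q0)//.
  by field; lra.
pose Q := u `^ ((lam - 3) / 2); have Q0 : 0 < Q by rewrite powR_gt0.
have AQ : 0 <= A * Q by rewrite mulr_ge0// ltW.
have d2 : 0 < e / (2 * (A * Q + 1)) by rewrite divr_gt0//; lra.
exists (Num.min (normc (1 - w) / 2) (e / (2 * (A * Q + 1)))).
  by rewrite lt_min d2 andbT divr_gt0.
move=> z z1; rewrite lt_min => /andP[zw1 zw2].
have zz : normc (1 - w) / 2 <= normc (1 - z).
  by have := normc_triangle z 1 w; lra.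
have zn1 : z != 1 by rewrite eq_sym -subr_eq0 -normc_gt0; lra.
have Pz : normc (1 - z) `^ (- b) <= P by apply: powRN_anti => //; [exact: ltW|lra].
have Pw : normc (1 - w) `^ (- b) <= P by apply: powRN_anti => //; [exact: ltW|lra|lra].
have t1 : normc (F z - Fc u z) <= A * P * u `^ (lam / 4).
  apply: le_trans (Fnear u0 z1 zn1) _; apply: ler_wpM2r; first exact: powR_ge0.
  exact: ler_wpM2l.
have t2 : normc (F w - Fc u w) <= A * P * u `^ (lam / 4).
  apply: le_trans (Fnear u0 w1 wn1) _; apply: ler_wpM2r; first exact: powR_ge0.
  exact: ler_wpM2l.
have t3 := Ffar u0 z1 w1.
have T : normc (F z - F w) <= normc (F z - Fc u z) + normc (Fc u z - Fc u w) + normc (F w - Fc u w).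
  have := normc_triangle (Fc u z) (F z) (F w); have := normc_triangle (Fc u w) (Fc u z) (F w).
  by rewrite (normcB (Fc u w) (F w)); lra.
apply: le_trans T _; rewrite uE in t1 t2.
have h1 : A * P * (e / (4 * (A * P) + 4)) <= e / 4.
  by rewrite mulrA ler_pdivrMr; [nra|lra].
have h2 : A * normc (z - w) * Q <= e / 2.
  have nz := normc_ge0 (z - w); move: zw2; rewrite ltr_pdivlMr; [nra|lra].
rewrite -/Q in t3; lra.
Qed.

Let g t := F (cis t).

Lemma boundary_pcont t : cis t != 1 :> C -> pcont g t.
Proof.
move=> tn1 e e0; have c1 s : normc (cis s : C) <= 1 by rewrite normc_cis.
have [d d0 Hd] := near_far_cont (c1 t) tn1 e0.
exists d => // s sd; apply: Hd => //; exact: le_lt_trans (normc_cisB _ _) sd.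
Qed.

Lemma cis_neq1 t : (cis t != 1 :> C) = (cos t < 1).
Proof.
rewrite lt_neqAle cos_le1 andbT; congr negb; apply/eqP/eqP; first by case.
move=> ct; have : sin t = 0 by apply: cos1sin0; rewrite ct normr1.
by rewrite /cis ct => ->.
Qed.

(** The boundary function is continuous on the open set cos t < 1, and on its complement it is
    constantly [F 1], whatever that value is. *)
Lemma boundary_measurable (p : C -> R) :
  (forall t, cis t != 1 :> C -> {for t, continuous (fun s => p (g s))}) ->
  measurable_fun setT (fun t => p (g t)).
Proof.
move=> pc; pose U := [set t : R | cos t < 1].
have oU : open U.
  have -> : U = cos @^-1` [set x : R | x < 1] by [].
  by apply: open_comp; [move=> t _; exact: continuous_cos|exact: open_lt].
have mU : measurable U by exact: open_measurable.
have -> : setT = U `|` ~` U by rewrite setUv.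
apply/measurable_funU => //; first exact: measurableC.
split.
  apply: open_continuous_measurable_fun => // t /[!inE] /= Ut; apply: pc.
  by rewrite cis_neq1.
apply/(measurable_fun_eqP (cst (p (F 1)))); last exact: measurable_cst.
move=> t /[!inE] /= /negP; rewrite -cis_neq1 negbK => /eqP E.
by rewrite /g E.
Qed.

Lemma radial_limit : {ae lebesgue_measure, forall t : R,
  (fun r : R => F (RtoC r * cis t)) @ at_left (1 : R) --> g t}.
Proof.
apply: ae_cis => t tn1.
have c1 : normc (cis t : C) <= 1 by rewrite normc_cis.
apply/cvgrPdist_le => e e0; have [eE e0'] := posC_RtoC e0.
have [d d0 Hd] := near_far_cont c1 tn1 e0'.
near=> r.
have r0 : 0 <= r by near: r; exact: (nbhs_left_ge ltr01).
have r1 : r <= 1 by near: r; exact: nbhs_left_le.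
rewrite eE lecR -normcN opprB; apply: Hd; first by rewrite normc_circle.
rewrite -{2}(mul1r (cis t)) -RtoC1 -mulrBl -RtoCB normcM normc_cis mulr1 normc_RtoC distrC.
rewrite ger0_norm; last by rewrite subr_ge0.
by near: r; exact: nbhs_left_ltBl.
Unshelve. all: by end_near.
Qed.

(** By [normc_one_sub_ge2], |1 - r e^(it)| >= |1 - e^(it)| / 2, so one majorant |1 - e^(it)|^(-2b),
    integrable as 2 b < 1, serves for all r. *)
Lemma near_far_hardy2 : hardy 2%:E F.
Proof.
split; first exact/analytic_cdiffP.
have [K K0 HK] := circle_powint b2; have pi0 := pi_gt0 R.
exists ((A * 2 `^ b) ^+ 2 * (K * (2 * pi) `^ (1 - 2 * b))) => r /[dup] r01 /andP[r0 r1].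
have p2 : 0 < 2 * pi :> R by lra.
have l02 : 0 < (2 * pi : R) <= 2 * pi by rewrite p2 lexx.
apply: (@le_trans _ _ (\int[leb]_(t in pitv 0 (2 * pi)) ((A * 2 `^ b) ^+ 2 * normc (1 - cis t) `^ (- (2 * b)))%:E)%E).
  apply: ae_cis_le_integral.
  - exact: measurable_itv.
  - apply: (measurableT_comp (measurable_powR 2)); apply: measurable_funTS.
    by apply: continuous_measurable_fun => t; exact: circle_normc_continuous.
  - by apply: measurable_funM; [exact: measurable_cst|exact: measurable_1subcis].
  - by move=> t _; exact: powR_ge0.
  - by move=> t _; rewrite mulr_ge0 ?sqr_ge0 ?powR_ge0.
  move=> t _ tn1; have c1 : normc (cis t : C) <= 1 by rewrite normc_cis.
  have z1 : normc (RtoC r * cis t) < 1 by rewrite normc_circle.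
  have zn1 : RtoC r * cis t != 1 by apply/negP => /eqP E; move: z1; rewrite E normc1 ltxx.
  have tp : 0 < normc (1 - cis t) by rewrite normc_gt0 subr_eq0 eq_sym.
  have h : normc (F (RtoC r * cis t)) <= A * 2 `^ b * normc (1 - cis t) `^ (- b).
    apply: le_trans (near_far_le (ltW z1) zn1) _; rewrite -mulrA; apply: ler_wpM2l => //.
    apply: le_trans (@powRN_anti _ _ _ b (ltW b0) _ (normc_one_sub_ge2 r01 c1)) _.
      by rewrite divr_gt0.
    by rewrite powRM; [rewrite powR_invE// opprK mulrC|exact: ltW|rewrite invr_ge0].
  rewrite powR_mulrn ?normc_ge0//.
  have -> : (A * 2 `^ b) ^+ 2 * normc (1 - cis t) `^ (- (2 * b)) = (A * 2 `^ b * normc (1 - cis t) `^ (- b)) ^+ 2.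
    rewrite [RHS]exprMn; congr (_ * _); rewrite expr2 -powRD ?(gt_eqF tp) ?implybT//.
    by congr powR; ring.
  by rewrite ler_pXn2r// nnegrE ?normc_ge0// !mulr_ge0 ?powR_ge0.
under eq_integral do rewrite EFinM.
rewrite ge0_integralZl_EFin//; last 3 first.
- by move=> t _; rewrite lee_fin powR_ge0.
- by apply/measurable_EFinP; exact: measurable_1subcis.
- exact: sqr_ge0.
  rewrite [leRHS]EFinM; apply: lee_wpmul2l; first by rewrite lee_fin sqr_ge0.
  exact: HK.
exact: measurable_itv.
Qed.

Theorem near_far_morrey : morrey lam F.
Proof.
split; first exact: near_far_hardy2.
have mp (p : C -> R) : (forall t, cis t != 1 :> C -> {for t, continuous (fun s => p (g s))}) ->
  measurable_fun setT (fun t => p (g t)) by exact: boundary_measurable.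
exists g; split; first by apply: mp => t /boundary_pcont; exact: pcont_Re.
split; first by apply: mp => t /boundary_pcont; exact: pcont_Im.
split; first exact: radial_limit.
have [K K0 HK] := circle_powint b2.
(* [q * H] will bound the distance from the mean to [c]: the average of |g - c| is at most 2 (K + 1)
   q, doubled by [normc_cint_le]. *)
pose H := 4 * (K + 1).
exists (A ^+ 2 * (4 * (K + 1) + 2 * H ^+ 2)) => a l /[dup] l02 /andP[l0 l2].
have l0' := ltW l0; have Ap := A0.
have mI : measurable (pitv a l) by exact: measurable_itv.
have lebI : leb (pitv a l) = l%:E.
  have al : a <= a + l by lra.
  by rewrite (lebesgue_measure_cc al); congr EFin; ring.
have cstint x : (\int[leb]_(t in pitv a l) x%:E = (x * l)%:E)%E.
  by rewrite EFinM -lebI; exact: (integral_cst leb mI x%:E).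
(* Oscillation is first measured from the far part at one end of the arc, with the cut u equal to
   the length of the arc. *)
pose c := Fc l (cis a).
pose q := A * l `^ ((lam - 1) / 2).
have q0 : 0 <= q by rewrite mulr_ge0// powR_ge0.
have lD (x y : R) : l `^ (x + y) = l `^ x * l `^ y by rewrite powRD// (gt_eqF l0) implybT.
(* With y = (l / |1 - e^(it)|)^b one gets |g - c| <= q (y + 1). The function psi = 2 y^2 + 2
   dominates both y + 1 and (y + 1)^2, so one integral controls the mean and the square; its average
   over the arc is at most 2 (K + 1). *)
pose psi t := 2 * l `^ (2 * b) * normc (1 - cis t) `^ (- (2 * b)) + 2.
have mpsi : measurable_fun (pitv a l) psi.
  apply: measurable_funD; last exact: measurable_cst.
  by apply: measurable_funM; [exact: measurable_cst|exact: measurable_1subcis].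
have psi0 t : 0 <= psi t by rewrite addr_ge0// !mulr_ge0// powR_ge0.
have Ipsi : (\int[leb]_(t in pitv a l) (psi t)%:E <= (2 * (K + 1) * l)%:E)%E.
  rewrite /psi; under eq_integral do rewrite EFinD EFinM.
  have l2b : 0 <= 2 * l `^ (2 * b) by rewrite mulr_ge0// powR_ge0.
  rewrite ge0_integralD//; last 2 first.
  - by move=> t _; rewrite -EFinM lee_fin mulr_ge0// powR_ge0.
  - by apply/measurable_EFinP; apply: measurable_funM; [exact: measurable_cst|exact: measurable_1subcis].
  rewrite ge0_integralZl_EFin//; last 2 first.
  - by move=> t _; rewrite lee_fin powR_ge0.
  - by apply/measurable_EFinP; exact: measurable_1subcis.
  have -> : (\int[leb]_(t in pitv a l) 2%:E = (2 * l)%:E)%E.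
    exact: cstint.
  have -> : 2 * (K + 1) * l = 2 * l `^ (2 * b) * (K * l `^ (1 - 2 * b)) + 2 * l.
    have -> : l `^ (1 - 2 * b) = l * l `^ (- (2 * b)) by rewrite lD powRr1.
    have : l `^ (2 * b) * l `^ (- (2 * b)) = 1 by rewrite -lD subrr powRr0.
    move=> E; have -> : 2 * l `^ (2 * b) * (K * (l * l `^ (- (2 * b)))) = 2 * K * l * (l `^ (2 * b) * l `^ (- (2 * b))) by ring.
    by rewrite E; ring.
  rewrite EFinD; apply: leeD => //; rewrite [leRHS]EFinM.
  by apply: lee_wpmul2l; [rewrite lee_fin|exact: HK].
have nb t : pitv a l t -> cis t != 1 :> C ->
    normc (g t - c) <= q * psi t /\ normc (g t - c) ^+ 2 <= q ^+ 2 * psi t.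
  rewrite /pitv /= in_itv /= => /andP[ta tal] tn1.
  have c1 s : normc (cis s : C) <= 1 by rewrite normc_cis.
  have tp : 0 < normc (1 - cis t) by rewrite normc_gt0 subr_eq0 eq_sym.
  pose y := normc (1 - cis t) `^ (- b) * l `^ b.
  have y0 : 0 <= y by rewrite mulr_ge0// powR_ge0.
  have yy : y ^+ 2 = l `^ (2 * b) * normc (1 - cis t) `^ (- (2 * b)).
    rewrite exprMn !expr2 -lD -powRD ?(gt_eqF tp) ?implybT// mulrC.
    by congr (l `^ _ * _ `^ _); ring.
  have psiE : psi t = 2 * y ^+ 2 + 2 by rewrite yy /psi; ring.
  have n1 := Fnear l0 (c1 t) tn1.
  have n2 := Ffar l0 (c1 t) (c1 a).
  have E1 : l `^ (lam / 4) = l `^ ((lam - 1) / 2) * l `^ b by rewrite -lD; congr powR; field.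
  have E2 : l * l `^ ((lam - 3) / 2) = l `^ ((lam - 1) / 2).
    by rewrite -{1}(powRr1 l0') -lD; congr powR; field.
  have n2' : normc (Fc l (cis t) - c) <= q.
    apply: le_trans n2 _; rewrite /q -E2 mulrA; apply: ler_wpM2r; first exact: powR_ge0.
    apply: ler_wpM2l => //; apply: le_trans (normc_cisB _ _) _.
    by rewrite ger0_norm; lra.
  have n1' : normc (g t - Fc l (cis t)) <= q * y.
    by apply: le_trans n1 _; rewrite E1 /q /y; apply: eq_ler; ring.
  have n3 : normc (g t - c) <= q * (y + 1).
    by apply: le_trans (normc_triangle (Fc l (cis t)) _ _) _; rewrite mulrDr mulr1; exact: lerD.
  split.
    by apply: le_trans n3 _; apply: ler_wpM2l => //; rewrite psiE; nra.
  apply: (@le_trans _ _ ((q * (y + 1)) ^+ 2)).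
    by rewrite ler_pXn2r// nnegrE ?normc_ge0// mulr_ge0// addr_ge0.
  by rewrite exprMn; apply: ler_wpM2l; [exact: sqr_ge0|rewrite psiE; have := sqr_ge0 (y - 1); lra].
have mN : measurable_fun (pitv a l) (fun t => normc (g t - c)).
  apply: measurable_funTS; apply: (mp (fun z => normc (z - c))) => t /boundary_pcont gc.
  apply: (@pcont_normc R (fun s => g s - c)); apply: pcontB => //.
  by move=> e e0; exists 1 => // s _; rewrite subrr normc0 ltW.
have scaleint k : 0 <= k -> (\int[leb]_(t in pitv a l) (k * psi t)%:E <= (k * (2 * (K + 1) * l))%:E)%E.
  move=> k0; under eq_integral do rewrite EFinM.
  rewrite ge0_integralZl_EFin//; last 2 first.
  - by move=> t _; rewrite lee_fin.
  - exact/measurable_EFinP.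
  by rewrite EFinM; apply: lee_wpmul2l; [rewrite lee_fin|exact: Ipsi].
have L1 : (\int[leb]_(t in pitv a l) (normc (g t - c))%:E <= (q * (2 * (K + 1) * l))%:E)%E.
  apply: le_trans (scaleint q q0); apply: ae_cis_le_integral => //.
  - by apply: measurable_funM => //; exact: measurable_cst.
  - by move=> t _; exact: normc_ge0.
  - by move=> t _; rewrite mulr_ge0.
  - by move=> t It tn1; case: (nb t It tn1).
have L2 : (\int[leb]_(t in pitv a l) (normc (g t - c) ^+ 2)%:E <= (q ^+ 2 * (2 * (K + 1) * l))%:E)%E.
  apply: le_trans (scaleint (q ^+ 2) (sqr_ge0 _)); apply: ae_cis_le_integral => //.
  - exact: measurable_funX.
  - by apply: measurable_funM => //; exact: measurable_cst.
  - by move=> t _; exact: sqr_ge0.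
  - by move=> t _; rewrite mulr_ge0// sqr_ge0.
  - by move=> t It tn1; case: (nb t It tn1).
have iN : leb.-integrable (pitv a l) (EFin \o (fun t => normc (g t - c))).
  by apply: ge0_integrable L1 => // t _; exact: normc_ge0.
have ic : cintegrable leb (pitv a l) (fun=> c).
  by apply: pcont_cintegrable => ? _ eps eps0; exists 1 => // ? _; rewrite subrr normc0 ltW.
have igc : cintegrable leb (pitv a l) (fun t => g t - c).
  apply: (@cintegrable_le _ _ R leb (pitv a l) (fun t => g t - c) (fun t => normc (g t - c))) => //.
    apply: measurable_funTS; apply: (mp (fun z => complex.Re (z - c))) => t /boundary_pcont gc.
    apply: (@pcont_Re R (fun s => g s - c)); apply: pcontB => //.
    by move=> e e0; exists 1 => // s _; rewrite subrr normc0 ltW.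
  apply: measurable_funTS; apply: (mp (fun z => complex.Im (z - c))) => t /boundary_pcont gc.
  apply: (@pcont_Im R (fun s => g s - c)); apply: pcontB => //.
  by move=> e e0; exists 1 => // s _; rewrite subrr normc0 ltW.
have mE : cmean g a l - c = RtoC l^-1 * cint leb (pitv a l) (fun t => g t - c).
  have -> : cmean g a l = RtoC l^-1 * cint leb (pitv a l) g.
    by apply: complex_ReIm_eq; rewrite ?Re_mul ?Im_mul /=; ring.
  have -> : cint leb (pitv a l) g = cint leb (pitv a l) (fun t => g t - c) + c * RtoC l.
    have -> : c * RtoC l = cint leb (pitv a l) (fun=> c).
      have al : a <= a + l by lra.
      by rewrite (cint_itv_cst c al); congr (_ * RtoC _); ring.
    by rewrite -cintD//; apply: eq_cint => t _; rewrite subrK.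
  have ll : RtoC l^-1 * RtoC l = 1 :> C by rewrite -RtoCM mulVf ?gt_eqF.
  have -> : RtoC l^-1 * (cint leb (pitv a l) (fun t => g t - c) + c * RtoC l) - c =
    RtoC l^-1 * cint leb (pitv a l) (fun t => g t - c) + c * (RtoC l^-1 * RtoC l - 1) by ring.
  by rewrite ll subrr mulr0 addr0.
have nm : normc (cmean g a l - c) <= q * H.
  rewrite mE normcM normc_RtoC ger0_norm ?invr_ge0//.
  have h : normc (cint leb (pitv a l) (fun t => g t - c)) <= 2 * (q * (2 * (K + 1) * l)).
    apply: (@le_trans _ _ (2 * Rintegral leb (pitv a l) (fun t => normc (g t - c)))).
      by apply: normc_cint_le.
    by apply: ler_wpM2l => //; apply: ge0_Rintegral_le L1 => t _; exact: normc_ge0.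
  rewrite mulrC ler_pdivrMr//; apply: le_trans h _; rewrite /H; apply: eq_ler; ring.
apply: (@le_trans _ _ ((l `^ (- lam))%:E * (2 * (q ^+ 2 * (2 * (K + 1) * l)) + 2 * (q * H) ^+ 2 * l)%:E)%E); last first.
  rewrite -EFinM lee_fin; apply: eq_ler.
  (* The scaling: q^2 l = A^2 l^lam, exactly cancelled by the Morrey weight. *)
  have E3 : l `^ (- lam) * (l `^ ((lam - 1) / 2) ^+ 2 * l) = 1.
    have -> : l `^ ((lam - 1) / 2) ^+ 2 * l = l `^ ((lam - 1) / 2) * l `^ ((lam - 1) / 2) * l `^ 1.
      by rewrite powRr1// expr2.
    by rewrite -!lD -[RHS](powRr0 l); congr powR; field.
  rewrite /q.
  have -> : l `^ (- lam) * (2 * ((A * l `^ ((lam - 1) / 2)) ^+ 2 * (2 * (K + 1) * l)) +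
     2 * (A * l `^ ((lam - 1) / 2) * H) ^+ 2 * l) =
     A ^+ 2 * (4 * (K + 1) + 2 * H ^+ 2) * (l `^ (- lam) * (l `^ ((lam - 1) / 2) ^+ 2 * l)) by ring.
  by rewrite E3 mulr1.
apply: lee_wpmul2l; first by rewrite lee_fin powR_ge0.
(* The mean is exchanged for [c] by (x + y)^2 <= 2 x^2 + 2 y^2. *)
apply: (@le_trans _ _ (\int[leb]_(t in pitv a l) (2%:E * (normc (g t - c) ^+ 2)%:E + (2 * (q * H) ^+ 2)%:E))%E).
  apply: ge0_le_integral => //.
  - by move=> t _; rewrite lee_fin sqr_ge0.
  - apply/measurable_EFinP; apply: measurable_funX; apply: measurable_funTS.
    apply: (mp (fun z => normc (z - cmean g a l))) => t /boundary_pcont gc.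
    apply: (@pcont_normc R (fun s => g s - cmean g a l)); apply: pcontB => //.
    by move=> e e0; exists 1 => // s _; rewrite subrr normc0 ltW.
  - apply/measurable_EFinP; apply: measurable_funD; last exact: measurable_cst.
    by apply: measurable_funM; [exact: measurable_cst|exact: measurable_funX].
  - move=> t _; rewrite -EFinM -EFinD lee_fin.
    have T : normc (g t - cmean g a l) <= normc (g t - c) + q * H.
      apply: le_trans (normc_triangle c _ _) _; rewrite (normcB c); lra.
    have n0 := normc_ge0 (g t - c).
    have T2 : normc (g t - cmean g a l) ^+ 2 <= (normc (g t - c) + q * H) ^+ 2.
      rewrite ler_pXn2r// nnegrE ?normc_ge0//.
      by apply: le_trans T; exact: normc_ge0.
    by apply: le_trans T2 _; have := sqr_ge0 (normc (g t - c) - q * H); lra.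
rewrite ge0_integralD//; last 3 first.
- by move=> t _; rewrite -EFinM lee_fin mulr_ge0// sqr_ge0.
- apply/measurable_EFinP; apply: measurable_funM; [exact: measurable_cst|exact: measurable_funX].
- by move=> t _; rewrite lee_fin mulr_ge0// sqr_ge0.
rewrite ge0_integralZl_EFin//; last 2 first.
- by move=> t _; rewrite lee_fin sqr_ge0.
- by apply/measurable_EFinP; exact: measurable_funX.
rewrite cstint [leRHS]EFinD; apply: leeD => //.
by rewrite [leRHS]EFinM; apply: lee_wpmul2l.
Qed.

End Morrey.

(** * Testing the Bloch condition on functions increasing along [0,1) *)

Section BlochTest.
Variables (R : realType) (mu : {measure set R -> \bar R}) (f : R[i] -> R[i]) (fr : R -> R).
Local Notation C := R[i].
Local Notation D := (`[0, 1[%classic : set R).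
Hypothesis hf : forall z, normc z < 1 -> cdifferentiable f z.
Hypothesis muT : (mu setT < +oo)%E.
Hypothesis ffr : forall x, 0 <= x < 1 -> f (RtoC x) = RtoC (fr x).
Hypothesis fr0 : forall x, 0 <= x < 1 -> 0 <= fr x.
Hypothesis frm : forall x y, 0 <= x -> x <= y -> y < 1 -> fr x <= fr y.
Implicit Types (a h t x : R).

Let kr t x := fr (t * x) / (1 - t * x).

Lemma cesaro_integrable z : normc z < 1 ->
  cintegrable mu D (fun t => f (RtoC t * z) / (1 - RtoC t * z)).
Proof.
move=> z1; have mD : measurable D by exact: measurable_itv01.
have muD : (mu D < +oo)%E by apply: le_lt_trans muT; apply: le_measure; rewrite ?inE.
have [m1 m2] := kernel_measurable hf (ltW z1).
have [M M0 HM] := holo_bounded (div_1sub_holo hf) z1.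
apply: (@cintegrable_le _ _ R mu D _ (fun=> M)) => //.
  apply: (measurable_bounded_integrable mD muD (measurable_cst _)).
  exists M; split; first exact: num_real.
  by move=> x Mx t _ /=; rewrite ger0_norm// ltW.
move=> t /=; rewrite in_itv /= => /andP[t0 t1]; apply: HM.
rewrite normcM normc_RtoC ger0_norm// -[leRHS]mul1r.
by apply: ler_wpM2r; rewrite ?normc_ge0// ltW.
Qed.

Let tx01 t x : D t -> 0 <= x < 1 -> 0 <= t * x < 1.
Proof.
rewrite /= in_itv /= => /andP[t0 t1] /andP[x0 x1].
by rewrite mulr_ge0//=; nra.
Qed.

Let kernel_real t x : D t -> 0 <= x < 1 ->
  f (RtoC t * RtoC x) / (1 - RtoC t * RtoC x) = RtoC (kr t x).
Proof.
move=> Dt x01; rewrite -RtoCM ffr; last exact: tx01.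
by rewrite -[1]RtoC1 -RtoCB -RtoCV -RtoCM.
Qed.

Let kr_integrable x : 0 <= x < 1 -> mu.-integrable D (EFin \o (fun t => kr t x)).
Proof.
move=> /[dup] x01 /andP[x0 x1]; have x1' : normc (RtoC x) < 1 by rewrite normc_RtoC ger0_norm.
have [ii _] := cesaro_integrable x1'; move: ii; apply: eq_integrable; first exact: measurable_itv01.
by move=> t /[!inE] Dt /=; rewrite kernel_real.
Qed.

Let Re_cesaro x : 0 <= x < 1 ->
  complex.Re (cesaro_like mu f (RtoC x)) = Rintegral mu D (fun t => kr t x).
Proof.
by move=> x01; apply: eq_Rintegral => t /[!inE] Dt; rewrite kernel_real.
Qed.

(** The growth of [fr] is discarded by monotonicity; what remains is the increment of 1 / (1 - tx),
    with the larger denominator kept twice. *)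
Let kr_incr t a h : D t -> 0 <= a -> 0 < h -> a + h < 1 ->
  fr (t * a) * (t * h / (1 - t * a) ^+ 2) <= kr t (a + h) - kr t a.
Proof.
move=> Dt a0 h0 ah1.
have /andP[x0 x1] : 0 <= t * a < 1 by apply: tx01 => //; apply/andP; split; lra.
have /andP[y0 y1] : 0 <= t * (a + h) < 1 by apply: tx01 => //; apply/andP; split; lra.
have th0 : 0 <= t * h by move: Dt; rewrite /= in_itv /= => /andP[? ?]; nra.
have xy : t * a <= t * (a + h) by rewrite mulrDr; lra.
have P0 : 0 < (1 - t * (a + h)) * (1 - t * a) by rewrite mulr_gt0//; lra.
have f0 : 0 <= fr (t * a) by apply: fr0; rewrite x0.
have fm := frm x0 xy y1.
apply: (@le_trans _ _ (fr (t * a) * (t * h / ((1 - t * (a + h)) * (1 - t * a))))).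
  apply: ler_wpM2l => //; apply: ler_wpM2l => //.
  rewrite lef_pV2 ?posrE//; last by rewrite exprn_gt0//; lra.
  by rewrite expr2; apply: ler_wpM2r; lra.
have -> : fr (t * a) * (t * h / ((1 - t * (a + h)) * (1 - t * a))) =
    fr (t * a) / (1 - t * (a + h)) - fr (t * a) / (1 - t * a).
  by field; apply/andP; split; lra.
by rewrite /kr lerD2r; apply: ler_wpM2r => //; rewrite invr_ge0; lra.
Qed.

(** On the real axis the increment of the operator is an integral of nonnegative increments of [kr],
    so restricting it to t >= a gives a lower bound for the derivative. There t a >= a^2, which is
    why [fr] is evaluated at a^2. *)
Lemma bloch_test lam : lam <= 1 -> bloch_type ((3 - lam) / 2) (cesaro_like mu f) ->
  exists2 M : R, 0 <= M & forall a, 1 / 2 <= a < 1 ->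
    fr (a ^+ 2) * fine (mu `[a, 1%R[) <= M * (1 - a) `^ ((1 + lam) / 2).
Proof.
set F := cesaro_like mu f => lam1 [anF [M HM]].
have M0 : 0 <= M.
  apply: le_trans (HM 0 _); last by rewrite normc0.
  by rewrite mulr_ge0 ?powR_ge0 ?normc_ge0.
exists (8 * M); first by rewrite mulr_ge0.
move=> a /andP[a2 a1]; have a0 : 0 <= a by lra.
have za : normc (RtoC a) < 1 by rewrite normc_RtoC ger0_norm.
have cd := derivable_cdiff (anF _ za); set A := F^`() (RtoC a) in cd.
have mA : measurable (`[a, 1[%classic : set R) by exact: measurable_itv.
have AD : (`[a, 1[%classic : set R) `<=` D.
  by move=> t /=; rewrite !in_itv /= => /andP[? ->]; rewrite andbT; lra.
have muA : mu `[a, 1%R[ \is a fin_num.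
  rewrite ge0_fin_numE//; apply: le_lt_trans muT.
  by apply: le_measure; rewrite ?inE.
set m := fine (mu `[a, 1%R[); have m0 : 0 <= m by exact: fine_ge0.
have mD01 : measurable D by exact: measurable_itv01.
have a21 : 0 <= a ^+ 2 < 1 by apply/andP; split; nra.
have w0 : 0 <= fr (a ^+ 2) by exact: fr0.
have d0 : 0 < 8 * (1 - a) ^+ 2 by rewrite mulr_gt0// exprn_gt0//; lra.
have key : fr (a ^+ 2) * m / (8 * (1 - a) ^+ 2) <= normc A.
  apply/ler_addgt0Pr => e e0; have [d dp Hd] := cd e e0.
  have mn : 0 < Num.min d (1 - a) by rewrite lt_min dp /=; lra.
  have md : Num.min d (1 - a) <= d by rewrite ge_min lexx.
  have ma : Num.min d (1 - a) <= 1 - a by rewrite ge_min lexx orbT.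
  pose h := Num.min d (1 - a) / 2; have h0 : 0 < h by rewrite /h; lra.
  have ah1 : a + h < 1 by rewrite /h; lra.
  have nh : normc (RtoC h) = h by rewrite normc_RtoC ger0_norm// ltW.
  have /Hd : normc (RtoC h) < d by rewrite nh /h; lra.
  rewrite nh -RtoCD => Hh.
  have ii1 : 0 <= a + h < 1 by apply/andP; split; lra.
  have ii2 : 0 <= a < 1 by rewrite a0.
  have i1 := kr_integrable ii1; have i2 := kr_integrable ii2.
  have i3 : mu.-integrable D (EFin \o (fun t => kr t (a + h) - kr t a)).
    by have := integrableB mD01 i1 i2; apply: eq_integrable.
  (* For t in [a,1): t >= 1/2 and 1 - ta <= 1 - a^2 <= 2 (1 - a), so [kr_incr] gives 1/2 times 1/4,
     the constant 8. *)
  pose w := fr (a ^+ 2) * (h / (8 * (1 - a) ^+ 2)).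
  have low : w * m <= Rintegral mu D (fun t => kr t (a + h) - kr t a).
    have kr0 t : D t -> 0 <= kr t (a + h) - kr t a.
      move=> Dt; apply: le_trans (kr_incr Dt a0 h0 ah1).
      have ta := tx01 Dt ii2.
      rewrite mulr_ge0 ?fr0// divr_ge0 ?sqr_ge0//.
      by move: Dt; rewrite /= in_itv /= => /andP[? ?]; rewrite mulr_ge0// ltW.
    rewrite -lee_fin EFinM fineK// fineK; last exact: (integrable_fin_num mD01 i3).
    rewrite -(integral_cst mu mA w%:E).
    have mk : measurable_fun D (fun t => (kr t (a + h) - kr t a)%:E).
      by case/integrableP: i3.
    apply: (@le_trans _ _ (\int[mu]_(t in `[a, 1%R[) (kr t (a + h) - kr t a)%:E)%E); last first.
      by apply: ge0_subset_integral => // t Dt; rewrite lee_fin kr0.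
    apply: ge0_le_integral => //.
    - by move=> t _; rewrite lee_fin !mulr_ge0// ?invr_ge0 ltW.
    - exact: measurable_funS mD01 AD mk.
    move=> t At; have Dt := AD t At; rewrite lee_fin.
    apply: le_trans (kr_incr Dt a0 h0 ah1).
    move: At; rewrite /= in_itv /= => /andP[ta t1].
    have /andP[x0 x1] := tx01 Dt ii2.
    apply: ler_pM => //.
    - by rewrite divr_ge0 ?ltW.
    - by apply: frm; [exact: sqr_ge0|rewrite expr2; apply: ler_wpM2r|].
    - rewrite ler_pdivrMr// mulrAC ler_pdivlMr; last by rewrite exprn_gt0//; lra.
      have -> : t * h * (8 * (1 - a) ^+ 2) = 2 * t * h * (2 * (1 - a)) ^+ 2 by ring.
      apply: ler_pM; rewrite ?sqr_ge0 ?(ltW h0)//.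
        by nra.
      have aa : a * a <= t * a by exact: ler_wpM2r.
      by have := sqr_ge0 (1 - a); rewrite ler_pXn2r ?nnegrE//; lra.
  have up : Rintegral mu D (fun t => kr t (a + h) - kr t a) <= (normc A + e) * h.
    rewrite RintegralB//.
    rewrite -!Re_cesaro// -/F -Re_sub.
    have -> : F (RtoC (a + h)) - F (RtoC a) =
      (F (RtoC (a + h)) - F (RtoC a) - A * RtoC h) + A * RtoC h by ring.
    apply: le_trans (ler_norm _) _; apply: le_trans (Re_le_normc _) _.
    apply: le_trans (le_normcD _ _) _; rewrite normcM nh mulrDl; lra.
  rewrite -(ler_pM2r h0); apply: le_trans up; apply: le_trans low.
  by rewrite /w; apply: eq_ler; ring.
have pa : 0 < 1 - a by lra.
have bl : (1 - a) `^ ((3 - lam) / 2) * normc A <= M.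
  apply: le_trans (HM _ za); apply: ler_wpM2r; first exact: normc_ge0.
  rewrite normc_RtoC ger0_norm//.
  by apply: ge0_ler_powR; rewrite ?nnegrE; nra.
(* The Bloch weight takes the power (3 - lam) / 2 and leaves the Carleson power (1 + lam) / 2. *)
have E : (1 - a) ^+ 2 = (1 - a) `^ ((1 + lam) / 2) * (1 - a) `^ ((3 - lam) / 2).
  rewrite -powRD; last by rewrite (gt_eqF pa) implybT.
  by rewrite -powR_mulrn ?ltW//; congr powR; field.
move: key; rewrite ler_pdivrMr// => /le_trans; apply.
have -> : normc A * (8 * (1 - a) ^+ 2) =
  8 * ((1 - a) `^ ((3 - lam) / 2) * normc A) * (1 - a) `^ ((1 + lam) / 2) by rewrite E; ring.
by apply: ler_wpM2r; [exact: powR_ge0|apply: ler_wpM2l].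
Qed.

End BlochTest.

(** * A function of the Hardy space that is large along a given sequence *)

Section TestFunction.
Variables (R : realType) (q : R) (a : nat -> R).
Local Notation C := R[i].
Local Notation leb := (@lebesgue_measure R).
Local Notation count := (@counting nat R).
Hypothesis q0 : 0 < q.
Hypothesis a01 : forall n, 0 <= a n < 1.
Implicit Types (n : nat) (t x r : R) (z : C).

(** An integer above 1/q, so that |1 - a z|^(-kq) has exponent above 1 and its circle integrals are
    governed by the distance 1 - a. *)
Let k : nat := (Num.truncn q^-1).+1.

Let kq : 1 < k%:R * q.
Proof. by rewrite -ltr_pdivrMr// div1r; exact: truncnS_gt. Qed.

(** The Hardy size of (1 - a z)^(-k) is of order (1 - a)^(1/q - k); the power of 1 - a normalises
    it, and 4^-n makes the series converge. *)
Let c n : R := 4^-1 ^+ n * (1 - a n) `^ (k%:R - q^-1).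

Let G n z : C := RtoC (c n) / (1 - RtoC (a n) * z) ^+ k.

(** Writing the series as an integral for the counting measure makes [holo_cint] and [normc_cint_le]
    available for it. *)
Definition test_fun z : C := cint count setT (fun n => G n z).

Definition test_real x : R := Rintegral count setT (fun n => c n / (1 - a n * x) ^+ k).

Let an1 n : 0 < 1 - a n. Proof. by have /andP[_ ?] := a01 n; lra. Qed.

Let c0 n : 0 < c n.
Proof. by rewrite mulr_gt0// ?powR_gt0// exprn_gt0// invr_gt0. Qed.

Let c_le n : c n <= 4^-1 ^+ n.
Proof.
rewrite -[leRHS]mulr1; apply: ler_wpM2l; first by rewrite exprn_ge0// invr_ge0.
have kq' : 0 <= k%:R - q^-1.
  by rewrite subr_ge0 -div1r ler_pdivrMr// ltW.
have := @ge0_ler_powR R _ kq' (1 - a n) 1; rewrite powR1; apply; rewrite ?nnegrE//.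
  exact: ltW.
by have /andP[? _] := a01 n; lra.
Qed.

Let one_sub_ge n z : normc z <= 1 -> 1 - normc z <= normc (1 - RtoC (a n) * z).
Proof.
move=> z1; have := lerB_normc 1 (RtoC (a n) * z); rewrite normc1 normcM normc_RtoC.
have /andP[h0 h1] := a01 n; rewrite ger0_norm//; have := normc_ge0 z; nra.
Qed.

Let normc_G n z : normc (G n z) = c n / normc (1 - RtoC (a n) * z) ^+ k.
Proof. by rewrite normcM normcV normcX normc_RtoC ger0_norm ?ltW. Qed.

Let G_le n z r : r < 1 -> normc z <= r -> normc (G n z) <= (1 - r) ^- k * 4^-1 ^+ n.
Proof.
move=> r1 zr; have h := @one_sub_ge n z; rewrite normc_G mulrC.
have p0 : 0 < normc (1 - RtoC (a n) * z) by lra.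
apply: ler_pM; rewrite ?(ltW (c0 n)) ?c_le ?invr_ge0 ?exprn_ge0 ?normc_ge0//.
rewrite lef_pV2 ?posrE ?exprn_gt0//; last lra.
by rewrite ler_pXn2r// ?nnegrE; lra.
Qed.

Let geo_integrable (b rho : R) : 0 <= b -> 0 <= rho < 1 ->
  count.-integrable setT (EFin \o (fun n => b * rho ^+ n)) /\
  Rintegral count setT (fun n => b * rho ^+ n) <= b / (1 - rho).
Proof.
move=> b0 /[dup] rho01 /andP[rho0 rho1].
have t0 n : 0 <= b * rho ^+ n by rewrite mulr_ge0// exprn_ge0.
have le : (\int[count]_n (b * rho ^+ n)%:E <= (b / (1 - rho))%:E)%E.
  rewrite ge0_integral_count; last by move=> n; rewrite lee_fin t0.
  exact: nneseries_geometric_le.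
split; first exact: (ge0_integrable _ _ _ le).
exact: (ge0_Rintegral_le _ le).
Qed.

Let q4 : 0 <= (4^-1 : R) < 1. Proof. by apply/andP; split; lra. Qed.

Let G_integrable z : normc z < 1 -> cintegrable count setT (fun n => G n z).
Proof.
move=> z1; apply: (@cintegrable_le _ _ R count setT _ (fun n => (1 - normc z) ^- k * 4^-1 ^+ n)) => //.
- by apply: (geo_integrable _ q4).1; rewrite invr_ge0 exprn_ge0//; lra.
- by move=> n _; exact: G_le.
Qed.

Lemma test_fun_holo z : normc z < 1 -> cdifferentiable test_fun z.
Proof.
move: z; apply: (@holo_cint _ _ R count setT G) => //.
- move=> n _ z z1.
  have nz : (1 - RtoC (a n) * z) ^+ k != 0.
    by rewrite expf_neq0// -normc_gt0; have := @one_sub_ge n z (ltW z1); lra.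
  have h : cdiff (fun w => 1 + - RtoC (a n) * w) z (0 + (0 * z + - RtoC (a n) * 1)).
    exact: cdiffD (cdiff_cst 1 z) (cdiffM (cdiff_cst _ z) (cdiff_id z)).
  have [B HB] := cdiffX k h.
  have HB' : cdiff (fun w => (1 - RtoC (a n) * w) ^+ k) z B.
    by apply: (cdiff_local ltr01 _ HB) => w _; rewrite mulNr.
  by eexists; exact: (cdiffM (cdiff_cst (RtoC (c n)) z) (@cdiffV _ (fun w => (1 - RtoC (a n) * w) ^+ k) z _ nz HB')).
- move=> r r1; exists (fun n => (1 - r) ^- k * 4^-1 ^+ n).
    by apply: (geo_integrable _ q4).1; rewrite invr_ge0 exprn_ge0//; lra.
  by move=> n _ z zr; exact: G_le.
Qed.

Let G_real n x : G n (RtoC x) = RtoC (c n / (1 - a n * x) ^+ k).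
Proof. by rewrite RtoCM RtoCV RtoCX RtoCB RtoCM RtoC1. Qed.

Lemma test_fun_real x : 0 <= x < 1 -> test_fun (RtoC x) = RtoC (test_real x).
Proof.
move=> x01; apply: complex_ReIm_eq => /=.
  by apply: eq_Rintegral => n _; rewrite G_real.
by rewrite /Rintegral integral0_eq// => n _; rewrite G_real.
Qed.

Let real_integrable x : 0 <= x < 1 -> count.-integrable setT (EFin \o (fun n => c n / (1 - a n * x) ^+ k)).
Proof.
move=> /andP[x0 x1]; have x1' : normc (RtoC x) < 1 by rewrite normc_RtoC ger0_norm.
have [ii _] := G_integrable x1'; move: ii; apply: eq_integrable => // n _ /=.
by rewrite G_real.
Qed.

Let real_den n x : 0 <= x < 1 -> 0 < 1 - a n * x.
Proof. by move=> /andP[? ?]; have /andP[? ?] := a01 n; nra. Qed.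

Let real_term0 n x : 0 <= x < 1 -> 0 <= c n / (1 - a n * x) ^+ k.
Proof.
by move=> x01; rewrite divr_ge0 ?(ltW (c0 n))// exprn_ge0// ltW// real_den.
Qed.

Lemma test_real_ge0 x : 0 <= x < 1 -> 0 <= test_real x.
Proof. by move=> x01; apply: Rintegral_ge0 => n _; exact: real_term0. Qed.

Lemma test_real_le x y : 0 <= x -> x <= y -> y < 1 -> test_real x <= test_real y.
Proof.
move=> x0 xy y1.
have hx : 0 <= x < 1 by apply/andP; split; lra.
have hy : 0 <= y < 1 by apply/andP; split; lra.
apply: le_Rintegral => //; [exact: real_integrable|exact: real_integrable|].
move=> n _; apply: ler_wpM2l; first exact: ltW.
have dx := real_den n hx; have dy := real_den n hy; have /andP[? ?] := a01 n.
rewrite lef_pV2 ?posrE ?exprn_gt0// ler_pXn2r ?nnegrE ?(ltW dx) ?(ltW dy)//.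
by nra.
Qed.

Let test_real_term n x : 0 <= x < 1 -> c n / (1 - a n * x) ^+ k <= test_real x.
Proof.
move=> x01; rewrite -lee_fin fineK; last exact: (integrable_fin_num _ (real_integrable x01)).
rewrite ge0_integral_count; last by move=> m; rewrite lee_fin real_term0.
apply: (@nneseries_ge_term _ (fun m => (c m / (1 - a m * x) ^+ k)%:E)).
by move=> m; rewrite lee_fin real_term0.
Qed.

(** Only the n-th term is kept; at a^2 its denominator involves 1 - a^3 <= 3 (1 - a), whence
    3^(-k). *)
Lemma test_real_ge : exists2 b : R, 0 < b & forall n,
  b * 4^-1 ^+ n * (1 - a n) `^ (- q^-1) <= test_real (a n ^+ 2).
Proof.
exists (3 ^- k); first by rewrite invr_gt0 exprn_gt0.
move=> n; have /andP[h0 h1] := a01 n; have h2 := an1 n.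
have x01 : 0 <= a n ^+ 2 < 1 by apply/andP; split; nra.
apply: le_trans (test_real_term n x01); rewrite /c.
have -> : (1 - a n) `^ (- q^-1) = (1 - a n) `^ (k%:R - q^-1) / (1 - a n) ^+ k.
  rewrite -powR_mulrn ?ltW// -powRN -powRD ?(gt_eqF h2) ?implybT//.
  by congr powR; ring.
have -> : 3 ^- k * 4^-1 ^+ n * ((1 - a n) `^ (k%:R - q^-1) / (1 - a n) ^+ k) =
  4^-1 ^+ n * (1 - a n) `^ (k%:R - q^-1) / (3 * (1 - a n)) ^+ k.
  by rewrite exprMn invfM; ring.
apply: ler_wpM2l; first by exact: ltW (c0 n).
have d0 := real_den n x01.
rewrite lef_pV2 ?posrE ?exprn_gt0//; last by rewrite mulr_gt0.
rewrite ler_pXn2r ?nnegrE ?(ltW d0)//; last by rewrite mulr_ge0// ltW.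
by nra.
Qed.

(** As |1 - a r e^(it)| >= |1 - e^(it)| / 2, its sublevel sets have measure at most 2 b u. It is
    also at least 1 - a, so the layers start there and kq > 1 makes them summable; the starting
    level is halved because [layer_cake_large] wants a strict inequality. *)
Let circle_int : exists2 K : R, 0 <= K & forall n r, 0 <= r < 1 ->
  (\int[leb]_(t in pitv 0 (2 * pi)) (normc (1 - RtoC (a n) * (RtoC r * cis t)) `^ (- (k%:R * q)))%:E
    <= (K * (1 - a n) `^ (1 - k%:R * q))%:E)%E.
Proof.
have [b b0 Hb] := circle_sublevel R; have pi0 := pi_gt0 R; have kq1 := kq.
have p2 : 0 < 2 * pi :> R by lra.
have l02 : 0 < (2 * pi : R) <= 2 * pi by rewrite p2 lexx.
have /andP[e0 e1] : 0 <= (2 : R) `^ (1 - k%:R * q) < 1 by apply: powR2_lt1; lra.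
exists (2 * (b * 2) * 2^-1 `^ (1 - k%:R * q) / (1 - 2 `^ (1 - k%:R * q))).
  by rewrite divr_ge0 ?subr_ge0 ?(ltW e1)// !mulr_ge0// powR_ge0.
move=> n r /andP[r0 r1]; have /andP[h0 h1] := a01 n; have h2 := an1 n.
have ar : 0 <= a n * r < 1 by apply/andP; split; nra.
have E t : RtoC (a n) * (RtoC r * cis t) = RtoC (a n * r) * cis t by rewrite RtoCM mulrA.
have mI : measurable (pitv 0 (2 * pi) : set R) by exact: measurable_itv.
have mphi (A : set R) : measurable_fun A (fun t => normc (1 - RtoC (a n) * (RtoC r * cis t))).
  apply: measurable_funTS; apply: continuous_measurable_fun => t.
  apply: (@pcont_normc R (fun t => 1 - RtoC (a n) * (RtoC r * cis t))).
  move=> e ep; have [d d0 Hd] := @pcont_circle R (a n * r) t e ep.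
  exists d => // s /Hd; rewrite !E normcB; congr (normc _ <= _); ring.
have c1 t : normc (cis t : C) <= 1 by rewrite normc_cis.
apply: le_trans (@layer_cake_large _ _ R leb (pitv 0 (2 * pi))
  (fun t => normc (1 - RtoC (a n) * (RtoC r * cis t))) (b * 2) 1 (k%:R * q) ((1 - a n) / 2)
  _ _ _ _ _ _ _ _) _ => //.
- exact: mphi.
- move=> t _; have z1 : normc (RtoC r * cis t) <= 1 by rewrite normc_circle// ltW.
  have := normc_one_sub_ge1 h0 z1; lra.
- lra.
- by rewrite mulr_ge0.
- by rewrite divr_gt0.
- move=> u u0; rewrite (powRr1 (ltW u0)) -mulrA.
  have u20 : 0 < 2 * u by lra.
  apply: le_trans (Hb 0 (2 * pi) (2 * u) l02 u20).
  have m1 : measurable (pitv 0 (2 * pi) `&` [set t | (normc (1 - RtoC (a n) * (RtoC r * cis t)) <= u)%R]).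
    by apply: measurable_fun_le => //; exact: mphi.
  have m2 : measurable (pitv 0 (2 * pi) `&` [set t | (normc (1 - cis t) <= 2 * u)%R] : set R).
    apply: measurable_fun_le => //; apply: measurable_funTS; apply: continuous_measurable_fun.
    exact: normc_1subcis_continuous.
  apply: le_measure; rewrite ?inE// => t [It tu]; split => //.
  have {}tu : normc (1 - RtoC (a n) * (RtoC r * cis t)) <= u := tu.
  suff : normc (1 - cis t) <= 2 * u by [].
  by have := normc_one_sub_ge2 ar (c1 t); rewrite -E; lra.
rewrite lee_fin powRr1// powRM ?invr_ge0 ?(ltW h2)//; apply: eq_ler; ring.
Qed.

(** Chosen so that b n |1 - a_n z|^(-kq) is the q-th power of 2^-n (1 - a_n)^(k - 1/q) / |1 - a_n
    z|^k. *)
Let b n : R := (2^-1 `^ q) ^+ n * (1 - a n) `^ (k%:R * q - 1).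

Let b0 n : 0 <= b n. Proof. by rewrite mulr_ge0 ?exprn_ge0 ?powR_ge0. Qed.

(* Writing |G n z| = 4^-n x_n, each 2^-n x_n is at most S^(1/q) with S = sum_n (2^-n x_n)^q, hence
   |f| <= 4 S^(1/q) for q < 1 and q >= 1 alike. *)
Let test_fun_powq z : normc z < 1 -> ((normc (test_fun z) `^ q)%:E <=
  (4 `^ q)%:E * \sum_(0 <= n <oo) (b n * normc (1 - RtoC (a n) * z) `^ (- (k%:R * q)))%:E)%E.
Proof.
move=> z1; set S := (\sum_(0 <= n <oo) _)%E.
have t0 n : (0 <= (b n * normc (1 - RtoC (a n) * z) `^ (- (k%:R * q)))%:E)%E.
  by rewrite lee_fin mulr_ge0// powR_ge0.
have S0 : (0 <= S)%E by apply: nneseries_ge0.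
have St n : ((b n * normc (1 - RtoC (a n) * z) `^ (- (k%:R * q)))%:E <= S)%E.
  exact: (@nneseries_ge_term _ (fun n => (b n * normc (1 - RtoC (a n) * z) `^ (- (k%:R * q)))%:E)).
(* If the sum is infinite the bound is trivial. *)
case: S S0 St => [s||]// s0 st; last by rewrite gt0_muley ?leey// lte_fin powR_gt0.
rewrite lee_fin in s0.
have Gs n : normc (G n z) <= s `^ q^-1 * 2^-1 ^+ n.
  set P := normc (1 - RtoC (a n) * z).
  have P0 : 0 < P by have := @one_sub_ge n z (ltW z1); rewrite -/P; lra.
  have h2 := an1 n.
  pose y := 2^-1 ^+ n * ((1 - a n) `^ (k%:R - q^-1) / P ^+ k).
  have y0 : 0 <= y by rewrite !mulr_ge0 ?powR_ge0 ?exprn_ge0 ?invr_ge0 ?exprn_ge0 ?ltW.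
  have yq : y `^ q <= s.
    have := st n; rewrite lee_fin -/P; apply: le_trans; apply: eq_ler.
    have p2 : 0 <= 2^-1 ^+ n :> R by rewrite exprn_ge0 ?invr_ge0.
    have pk : 0 <= P ^+ k by rewrite exprn_ge0 ?ltW.
    have pk' : 0 <= (P ^+ k)^-1 by rewrite invr_ge0.
    rewrite /y powRM// ?mulr_ge0 ?powR_ge0// powRM ?powR_ge0// powR_exprn ?invr_ge0//.
    have -> : (P ^+ k)^-1 `^ q = P `^ (- (k%:R * q)).
      by rewrite powR_invE// -powR_mulrn ?(ltW P0)// -powRrM mulrN.
    rewrite -powRrM /b -mulrA; congr (_ * (_ `^ _ * _)).
    by rewrite mulrBl mulVf ?gt_eqF.
  have ys : y <= s `^ q^-1.
    have -> : y = (y `^ q) `^ q^-1 by rewrite -powRrM divff ?gt_eqF// powRr1.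
    by apply: ge0_ler_powR; rewrite ?nnegrE ?powR_ge0// invr_ge0 ltW.
  rewrite normc_G -/P.
  have -> : c n / P ^+ k = y * 2^-1 ^+ n.
    rewrite /y /c; have -> : 4^-1 = 2^-1 * 2^-1 :> R by field.
    by rewrite exprMn; ring.
  by apply: ler_wpM2r => //; rewrite exprn_ge0// invr_ge0.
have q2 : 0 <= (2^-1 : R) < 1 by apply/andP; split; lra.
have [i1 i2] := geo_integrable (powR_ge0 s q^-1) q2.
(* One factor 2 is the sum of 2^-n, the other comes from [normc_cint_le]. *)
have fs : normc (test_fun z) <= 4 * s `^ q^-1.
  apply: (@le_trans _ _ (2 * Rintegral count setT (fun n => s `^ q^-1 * 2^-1 ^+ n))).
    by apply: normc_cint_le => //; exact: G_integrable.
  have : s `^ q^-1 / (1 - 2^-1) = 2 * s `^ q^-1 by field.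
  by move: i2 => /[swap] ->; lra.
rewrite -EFinM lee_fin.
apply: (@le_trans _ _ ((4 * s `^ q^-1) `^ q)).
  by apply: ge0_ler_powR; rewrite ?nnegrE ?normc_ge0 ?mulr_ge0 ?powR_ge0// ltW.
by rewrite powRM ?powR_ge0// -powRrM mulVf ?gt_eqF// powRr1.
Qed.

(** The bound of [test_fun_powq] is integrated term by term; in each term the powers of 1 - a_n
    cancel against [circle_int], leaving the geometric series of 2^(-qn), uniformly in r. *)
Lemma test_fun_hardy : hardy q%:E test_fun.
Proof.
split; first by apply/analytic_cdiffP; exact: test_fun_holo.
have [K K0 HK] := circle_int.
have /andP[e0 e1] : 0 <= (2^-1 `^ q : R) < 1 by rewrite powR_invE//; apply: powR2_lt1; have := q0; lra.
exists (4 `^ q * (K / (1 - 2^-1 `^ q))) => r /[dup] r01 /andP[r0 r1].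
have z1 t : normc (RtoC r * cis t) < 1 by rewrite normc_circle.
have mI : measurable (pitv 0 (2 * pi) : set R) by exact: measurable_itv.
pose h n t := (b n * normc (1 - RtoC (a n) * (RtoC r * cis t)) `^ (- (k%:R * q)))%:E : \bar R.
have h0 n t : (0 <= h n t)%E by rewrite lee_fin mulr_ge0// powR_ge0.
have mphi n : measurable_fun (pitv 0 (2 * pi))
    (fun t => normc (1 - RtoC (a n) * (RtoC r * cis t)) `^ (- (k%:R * q))).
  apply: (measurableT_comp (measurable_powR _)); apply: measurable_funTS.
  apply: continuous_measurable_fun => t.
  apply: (@pcont_normc R (fun t => 1 - RtoC (a n) * (RtoC r * cis t))) => e ep.
  have [d d0 Hd] := @pcont_circle R (a n * r) t e ep.
  exists d => // s /Hd; rewrite RtoCM normcB; congr (normc _ <= _); ring.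
have mh n : measurable_fun (pitv 0 (2 * pi)) (h n).
  by apply/measurable_EFinP; apply: measurable_funM; [exact: measurable_cst|exact: mphi].
have mS : measurable_fun (pitv 0 (2 * pi)) (fun t => \sum_(0 <= n <oo) h n t)%E.
  by apply: ge0_emeasurable_sum.
apply: (@le_trans _ _ (\int[leb]_(t in pitv 0 (2 * pi)) ((4 `^ q)%:E * \sum_(0 <= n <oo) h n t))%E).
  apply: ge0_le_integral => //.
  - by move=> t _; rewrite lee_fin powR_ge0.
  - apply/measurable_EFinP; apply: (measurableT_comp (measurable_powR q)); apply: measurable_funTS.
    by apply: continuous_measurable_fun => t; apply: circle_normc_continuous => //; exact: test_fun_holo.
  - apply: emeasurable_funM; first exact: measurable_cst.
    exact: mS.
  - by move=> t _; exact: test_fun_powq.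
rewrite ge0_integralZl_EFin//; last by move=> t _; apply: nneseries_ge0.
rewrite [leRHS]EFinM; apply: lee_wpmul2l; first by rewrite lee_fin powR_ge0.
rewrite integral_nneseries//.
apply: le_trans (nneseries_geometric_le K0 (_ : 0 <= 2^-1 `^ q < 1)); last by rewrite e0.
apply: lee_nneseries => [n _ _|n _]; first by apply: integral_ge0.
rewrite /h; under eq_integral do rewrite EFinM.
rewrite ge0_integralZl_EFin//; last 2 first.
- by move=> t _; rewrite lee_fin powR_ge0.
- by apply/measurable_EFinP; exact: mphi.
apply: (@le_trans _ _ ((b n)%:E * (K * (1 - a n) `^ (1 - k%:R * q))%:E)%E).
  by apply: lee_wpmul2l; [rewrite lee_fin|exact: HK].
rewrite -EFinM lee_fin /b; apply: eq_ler.
have : (1 - a n) `^ (k%:R * q - 1) * (1 - a n) `^ (1 - k%:R * q) = 1.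
  rewrite -powRD; last by rewrite (gt_eqF (an1 n)) implybT.
  by rewrite -[RHS](powRr0 (1 - a n)); congr powR; ring.
move=> E; have -> : (2^-1 `^ q) ^+ n * (1 - a n) `^ (k%:R * q - 1) * (K * (1 - a n) `^ (1 - k%:R * q)) =
  K * (2^-1 `^ q) ^+ n * ((1 - a n) `^ (k%:R * q - 1) * (1 - a n) `^ (1 - k%:R * q)) by ring.
by rewrite E mulr1.
Qed.

End TestFunction.

(** * The two implications *)

Section Carleson.
Variables (R : realType) (mu : {measure set R -> \bar R}).
Hypothesis muT : (mu setT < +oo)%E.
Implicit Types (p : \bar R) (f : R[i] -> R[i]) (a lam s : R).

Lemma cesaro_morrey p lam f : (0 < p)%E -> 0 < lam <= 1 ->
  carleson ((1 + lam) / 2 + invp p) mu -> hardy p f -> morrey lam (cesaro_like mu f).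
Proof.
move=> p0 lam01 [c [c0 muc]] hpf.
have hf : forall z, normc z < 1 -> cdifferentiable f z.
  by apply/analytic_cdiffP; case: p p0 muc hpf => [q| |]//= _ _ [].
have [K K0 fK] := hardy_growth p0 hpf.
have g0 : 0 <= invp p.
  by case: p p0 {muc hpf fK} => [q| |]//=; rewrite lte_fin => q0; rewrite invr_ge0 ltW.
have [A [Fc [A0 near far Fc1]]] := cesaro_near_far hf K0 g0 fK lam01 (ltW c0) muc.
apply: (near_far_morrey lam01 _ A0 near far Fc1).
exact: (cesaro_holo hf K0 g0 fK lam01 (ltW c0) muT muc).
Qed.

Let mu_fin a : mu `[a, 1%R[ \is a fin_num.
Proof.
rewrite ge0_fin_numE//; apply: le_lt_trans muT.
by apply: le_measure; rewrite ?inE//; exact: measurable_itv.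
Qed.

(** For a < 1/2 the factor 2^s (1 - a)^s is at least 1, so a multiple of the total mass suffices. *)
Lemma carleson_near1 s M : 0 <= s ->
  (forall a, 1 / 2 <= a < 1 -> fine (mu `[a, 1%R[) <= M * (1 - a) `^ s) -> carleson s mu.
Proof.
move=> s0 HM; have muf : mu setT \is a fin_num by rewrite ge0_fin_numE.
set m := fine (mu setT); have m0 : 0 <= m by exact: fine_ge0.
have p20 : 0 < 2 `^ s :> R by rewrite powR_gt0.
have mp : 0 <= m * 2 `^ s by rewrite mulr_ge0// ltW.
have aM : 0 <= `|M| := normr_ge0 M.
exists (`|M| + m * 2 `^ s + 1); split; first lra.
move=> a /andP[a0 a1]; rewrite -(fineK (mu_fin a)) lee_fin.
have P0 := powR_ge0 (1 - a) s.
have [a2|a2] := leP (1 / 2) a.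
  apply: le_trans (HM a _) _; first by rewrite a2.
  by apply: ler_wpM2r => //; have := ler_norm M; lra.
have : fine (mu `[a, 1%R[) <= m.
  by apply: fine_le => //; apply: le_measure; rewrite ?inE//; exact: measurable_itv.
move=> /le_trans; apply.
have h : 1 <= 2 `^ s * (1 - a) `^ s.
  rewrite -powRM//; last lra.
  have := @ge0_ler_powR R s s0 1 (2 * (1 - a)); rewrite powR1; apply; rewrite ?nnegrE//; lra.
rewrite 2!mulrDl -mulrA mul1r.
have : m <= m * (2 `^ s * (1 - a) `^ s) by rewrite -[leLHS]mulr1; exact: ler_wpM2l.
have : 0 <= `|M| * (1 - a) `^ s by rewrite mulr_ge0.
lra.
Qed.

Lemma carleson_of_bloch p lam : (0 < p)%E -> 0 < lam <= 1 ->
  (forall f, hardy p f -> bloch_type ((3 - lam) / 2) (cesaro_like mu f)) ->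
  carleson ((1 + lam) / 2 + invp p) mu.
Proof.
case: p => [q| |]//; last first.
  move=> _ /andP[l0 l1] /(_ (fun=> 1)) H.
  have hol z : normc z < 1 -> cdifferentiable (fun=> 1 : R[i]) z.
    by move=> _; eexists; exact: cdiff_cst.
  have /H bl : hardy +oo%E (fun=> 1 : R[i]).
    by split; [exact/analytic_cdiffP|exists 1 => z _; rewrite normc1].
  have [M M0 HM] := @bloch_test R mu (fun=> 1) (fun=> 1) hol muT
    (fun _ _ => esym (RtoC1 R)) (fun _ _ => ler01) (fun _ _ _ _ _ => lexx _) lam l1 bl.
  rewrite /= addr0; apply: (@carleson_near1 _ M); first lra.
  by move=> a a1; have := HM a a1; rewrite mul1r.
rewrite lte_fin => q0 /andP[l0 l1] H; apply: contrapT => nc.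
have qi : 0 < q^-1 by rewrite invr_gt0.
have s0 : 0 <= (1 + lam) / 2 + q^-1 by lra.
(* If no such point existed for some n, [carleson_near1] with constant 16^n would make the measure
   Carleson. Restricting to a >= 1/2 is what [bloch_test] requires. *)
have /choice[a Ha] : forall n : nat, exists a, 1 / 2 <= a < 1 /\
    16 ^+ n * (1 - a) `^ ((1 + lam) / 2 + q^-1) < fine (mu `[a, 1%R[).
  move=> n; apply: contrapT => /forallNP na; apply: nc.
  apply: (@carleson_near1 _ (16 ^+ n)) => // a a1; rewrite leNgt; apply/negP => h.
  by apply: (na a).
have a01 n : 0 <= a n < 1 by have [/andP[? ?] _] := Ha n; apply/andP; split; lra.
have [M M0 HM] := bloch_test (@test_fun_holo R q a q0 a01) muT
  (@test_fun_real R q a) (@test_real_ge0 R q a a01)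
  (@test_real_le R q a q0 a01) l1 (H _ (test_fun_hardy q0 a01)).
have [b b0 Hb] := test_real_ge q0 a01.
(* The lower bounds 4^-n for the function and 16^n for the measure multiply to 4^n, while all powers
   of 1 - a_n cancel. *)
have b4 n : b * 4 ^+ n <= M.
  have [a1 h] := Ha n; have /andP[_ an1] := a01 n; have pa : 0 < 1 - a n by lra.
  have P0 : 0 < (1 - a n) `^ ((1 + lam) / 2) by rewrite powR_gt0.
  rewrite -(ler_pM2r P0); apply: le_trans (HM _ a1).
  apply: (@le_trans _ _ ((b * 4^-1 ^+ n * (1 - a n) `^ (- q^-1)) *
      (16 ^+ n * (1 - a n) `^ ((1 + lam) / 2 + q^-1)))); last first.
    apply: ler_pM; [| |exact: Hb|exact: ltW].
      by rewrite !mulr_ge0 ?powR_ge0 ?exprn_ge0 ?invr_ge0// ltW.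
    by rewrite mulr_ge0 ?powR_ge0 ?exprn_ge0.
  have -> : (1 - a n) `^ ((1 + lam) / 2) = (1 - a n) `^ (- q^-1) * (1 - a n) `^ ((1 + lam) / 2 + q^-1).
    by rewrite -powRD ?(gt_eqF pa) ?implybT//; congr powR; ring.
  have -> : 4 ^+ n = 4^-1 ^+ n * 16 ^+ n :> R by rewrite -exprMn; congr (_ ^+ _); field.
  by apply: eq_ler; ring.
(* Since 4^-n tends to 0, some n has 4^-n < b / (M + 1), against [b4]. *)
have e0 : 0 < b / (M + 1) by rewrite divr_gt0//; lra.
have h4 : `|4^-1 : R| < 1 by rewrite ger0_norm ?invr_ge0//; lra.
have /cvgrPdist_lt/(_ _ e0)[n _ /(_ n (leqnn n))] := cvg_expr h4.
rewrite /= sub0r normrN ger0_norm ?exprn_ge0 ?invr_ge0// exprVn ltr_pdivlMr; last lra.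
rewrite mulrC ltr_pdivrMr ?exprn_gt0//; have := b4 n; lra.
Qed.

End Carleson.

Unset Implicit Arguments.

Theorem theorem1p1 (R : realType) (p : \bar R) (lam : R)
    (mu : {measure set R -> \bar R})
    (X : set (R[i] -> R[i])) (nX : (R[i] -> R[i]) -> R) :
  (0 < p)%E -> 0 < lam <= 1 ->
  (mu setT < +oo)%E -> mu (~` `[0, 1[) = 0%E ->
  banach_space_in_HD X nX ->
  morrey lam `<=` X ->
  X `<=` bloch_type ((3 - lam) / 2) ->
  ((forall f, hardy p f -> X (cesaro_like mu f)) <->
   carleson ((1 + lam) / 2 + invp p) mu).
Proof.
move=> p0 lam01 muT _ _ LX XB; split=> [H|cm f hf].
  by apply: carleson_of_bloch => // f hf; apply: XB; exact: H.
by apply: LX; exact: cesaro_morrey cm hf.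
Qed.
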